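(* The contravariant functors $\mathcal{P}:\mathbf{SDS}\to\mathbf{OBD}_{\mathrm{po}}$ and $\mathcal{V}:\mathbf{OBD}_{\mathrm{po}}\to\mathbf{SDS}$ are equivalences of categories which are inverse to each other, with respect to the natural isomorphisms $\tau$ between $1_{\mathbf{OBD}_{\mathrm{po}}}$ and $\mathcal{P}\mathcal{V}$ (with components $\tau_B:B\to\mathcal{P}(\mathcal{V}(B))$) and $\sigma$ between $1_{\mathbf{SDS}}$ and $\mathcal{V}\mathcal{P}$ (with components $\sigma_{\mathcal{X}}:\mathcal{X}\to\mathcal{V}(\mathcal{P}(\mathcal{X}))$).
   Context: **Bratteli diagrams.** A Bratteli diagram $(V,E)$ consists of a vertex set $V=V_0\sqcup V_1\sqcup\cdots$ with each $V_n$ finite and non-empty and $V_0$ a singleton, and an edge set $E=E_1\sqcup E_2\sqcup\cdots$ with each $E_n$ finite and non-empty, together with maps $r,s:E\to V$ (range, source) such that $r(E_n)\subseteq V_n$, $s(E_n)\subseteq V_{n-1}$, $s^{-1}\{v\}\neq\varnothing$ for all $v\in V$ and $r^{-1}\{v\}\ne\varnothing$ for all $v\in V\setminus V_0$. An ordered Bratteli diagram $(V,E,\geq)$ is a Bratteli diagram with a partial order on $E$ such that $e,e'$ are comparable iff $r(e)=r(e')$. It is properly ordered if there is exactly one infinite path $x_{\max}=(e_1,e_2,\ldots)$ ($e_i\in E_i$, $r(e_i)=s(e_{i+1})$) consisting of maximal edges, and exactly one, $x_{\min}$, consisting of minimal edges. **Edge sets.** An ordered edge set from a finite set $S$ to a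 finite set $T$ is a finite set $F$ with maps $s:F\to S$, $r:F\to T$ and a linear order on each $r^{-1}\{w\}$, $w\in T$. If $G$ is an ordered edge set from $T$ to $U$, then $F\circ G=\{(e,g)\in F\times G: r(e)=s(g)\}$, with source $s(e)$, range $r(g)$, and order: for $r(g)=r(g')$, $(e,g)<(e',g')$ iff $g<g'$, or $g=g'$ and $e<e'$. Write $F\cong F'$ if there is a bijection $F\to F'$ preserving sources, ranges and order. For $k<l$, $E_{k,l}=E_{k+1}\circ\cdots\circ E_l$; $E_{k,k}$ consists of one edge from $v$ to $v$ for each $v\in V_k$. **The category $\mathbf{OBD}$.** Objects: ordered Bratteli diagrams. An ordered premorphism $f:B=(V,E,\ge)\to C=(W,S,\ge)$ is a triple $(F,(f_n)_{n\ge0},\geq)$ where $(f_n)$ is an unbounded sequence of integers with $0=f_0\le f_1\le\cdots$, and $F=F_0\sqcup F_1\sqcup\cdots$ where each $F_n$ is a non-empty finite ordered edge set from $V_n$ to $W_{f_n}$ such that every $v\in V_n$ is the source of some edge of $F_n$ (that is, $s^{-1}\{v\}\neq\varnothing$ for all $v\in V$) and every $w\in W_{f_n}$ is the range of some edge of $F_n$, $F_0$ is a singleton, and $E_{n+1}\circ F_{n+1}\cong F_n\circ S_{f_n,f_{n+1}}$ for all $n\ge0$. The composition of $f:B\to C$ and $g=(G,(g_n),\ge):C\to D$ is $gf=(H,(h_n),\ge)$ with $h_n=g_{f_n}$, $H_n=F_n\circ G_{f_n}$. Premorphisms $f,g:B\to C$ are equivalent if there are positive integers $n_1<m_1<n_2<m_2<\cdots$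 with $f_{n_k}<g_{m_k}<f_{n_{k+1}}$ and, for all $k\ge1$, $E_{n_k,m_k}\circ G_{m_k}\cong F_{n_k}\circ S_{f_{n_k},g_{m_k}}$ and $E_{m_k,n_{k+1}}\circ F_{n_{k+1}}\cong G_{m_k}\circ S_{g_{m_k},f_{n_{k+1}}}$. Morphisms in $\mathbf{OBD}$ are equivalence classes $[f]$, with $[g][f]=[gf]$. $\mathbf{OBD}_{\mathrm{po}}$ is the full subcategory of properly ordered Bratteli diagrams. **The category $\mathbf{SDS}$.** An essentially minimal totally disconnected dynamical system $(X,\varphi,x_0)$ consists of a metrizable compact totally disconnected space $X$, a homeomorphism $\varphi$ of $X$ such that $(X,\varphi)$ has a unique minimal (non-empty closed invariant) subset, and a point $x_0$ of that subset. A Kakutani–Rokhlin partition for it is a finite partition $P=\{Z(k,j): 1\le k\le K,\ 1\le j\le J(k)\}$ of $X$ into non-empty clopen sets with $\varphi(Z(k,j))=Z(k,j+1)$ for $1\le j<J(k)$, and such that the top $Z=\bigcup_kZ(k,J(k))$ contains $x_0$ and $\varphi(Z)=\bigcup_kZ(k,1)$; the sequences $(Z(k,1),\ldots,Z(k,J(k)))$ are its towers. A system of Kakutani–Rokhlin partitions is a sequence $\mathcal{R}=(P_n)_{n\ge0}$ of such partitions with $P_0=\{X\}$, $P_{n+1}$ refining $P_n$ (written $P_n\le P_{n+1}$), the tops $Z_n$ of $P_n$ ($n\ge1$) decreasing with intersection $\{x_0\}$, and $\bigcup_nP_n$ a basis for the topology of $X$. Objects of $\mathbf{SDS}$ are quadruples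 $(X,\varphi,x_0,\mathcal{R})$; morphisms $(X,\varphi,x_0,\mathcal{R})\to(Y,\psi,y_0,\mathcal{S})$ are continuous maps $\alpha:X\to Y$ with $\alpha\circ\varphi=\psi\circ\alpha$ and $\alpha(x_0)=y_0$. **The edge set $E(P,Q)$.** If $P\le Q$ are Kakutani–Rokhlin partitions and the top of $P$ contains the top of $Q$, $E(P,Q)$ is the set of triples $(S,T,k)$ with $S=(Z_1,\ldots,Z_n)$ a tower of $P$, $T=(Y_1,\ldots,Y_m)$ a tower of $Q$, $k\ge0$ an integer with $Y_{k+j}\subseteq Z_j$ for $1\le j\le n$; source $S$, range $T$, and $(S,T,k)\le(S',T',k')$ iff $T=T'$ and $k\le k'$. **The functor $\mathcal{P}$.** On objects with $\mathcal{R}=(P_n)$: $\mathcal{P}(X,\varphi,x_0,\mathcal{R})$ has $V_n=\{(n,T): T\text{ a tower of }P_n\}$ and $E_n$ the copy $\{(n,S,T,k):(S,T,k)\in E(P_{n-1},P_n)\}$ of $E(P_{n-1},P_n)$ with its order; it is a properly ordered Bratteli diagram. For a morphism $\alpha:(X,\varphi,x_0,(P_n))\to(Y,\psi,y_0,(Q_n))$, let $\alpha^{-1}(Q_n)$ be the set of inverse images of elements of $Q_n$, a Kakutani–Rokhlin partition for $(X,\varphi,x_0)$; for a tower $S=(Z_1,\ldots,Z_m)$ of $Q_n$ write $\alpha^{-1}(S)=(\alpha^{-1}(Z_1),\ldots,\alpha^{-1}(Z_m))$. Choose integers $0=f_0\le f_1\le\cdots$, unbounded, with $\alpha^{-1}(Q_n)\le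 P_{f_n}$ and the top of $\alpha^{-1}(Q_n)$ containing the top of $P_{f_n}$; let $F_n=\{(n,S,T,k):(\alpha^{-1}(S),T,k)\in E(\alpha^{-1}(Q_n),P_{f_n})\}$ with source $(n,S)$, range $(f_n,T)$ and the induced order ($F_0$ a single edge). Then $f=(\bigsqcup F_n,(f_n),\ge)$ is an ordered premorphism $\mathcal{P}(Y,\psi,y_0,(Q_n))\to\mathcal{P}(X,\varphi,x_0,(P_n))$ and $\mathcal{P}(\alpha)=[f]$. **The functor $\mathcal{V}$.** For $B=(V,E,\ge)$ properly ordered, $X_B$ is the space of infinite paths $(e_1,e_2,\ldots)$ with basis of open sets the cylinders $U(e_1,\ldots,e_k)$ of paths beginning with $e_1,\ldots,e_k$. The Vershik map $\lambda_B$: $\lambda_B(x_{\max})=x_{\min}$; for other $x=(e_1,e_2,\ldots)$, if $k$ is least with $e_k$ not maximal, $f_k$ is the successor of $e_k$ in $r^{-1}\{r(e_k)\}$ and $(f_1,\ldots,f_{k-1})$ is the path of minimal edges from $V_0$ to $s(f_k)$, then $\lambda_B(x)=(f_1,\ldots,f_k,e_{k+1},\ldots)$. Let $P_0=\{X_B\}$ and, for $n\ge1$, $P_n=\{U(e_1,\ldots,e_n):(e_1,\ldots,e_n)\in E_{0,n}\}$, with one tower $T_v$ for each $v\in V_n$ consisting of those $U(e_1,\ldots,e_n)$ with $r(e_n)=v$ (in the order of $E_{0,n}$); $\mathcal{R}_B=(P_n)$. Then $\mathcal{V}(B)=(X_B,\lambda_B,x_{\max},\mathcal{R}_B)\in\mathbf{SDS}$.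 Let $f_B:B\to\mathcal{P}(\mathcal{V}(B))$ be the premorphism with $f_n=n$ and $F_n$ consisting of exactly one edge from $v$ to $(n,T_v)$ for each $v\in V_n$; $\tau_B=[f_B]$ is an isomorphism in $\mathbf{OBD}$. For a morphism $h:B\to C$, $\mathcal{V}(h):\mathcal{V}(C)\to\mathcal{V}(B)$ is the unique morphism $\alpha$ in $\mathbf{SDS}$ with $\mathcal{P}(\alpha)=\tau_Ch\tau_B^{-1}$. For $\mathcal{X}\in\mathbf{SDS}$, $\sigma_{\mathcal{X}}:\mathcal{X}\to\mathcal{V}(\mathcal{P}(\mathcal{X}))$ is the unique isomorphism with $\mathcal{P}(\sigma_{\mathcal{X}})=\tau_{\mathcal{P}(\mathcal{X})}^{-1}$.
   Formalization: Morphisms of SDS are required to be surjective: for a non-surjective α some α⁻¹(Q_n) has empty members, so P(α) is not a premorphism (e.g. the inclusion of the fixed point into the shift on Z ∪ {∞}). *)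

(* Defs.v *)
From HB Require Import structures.
From mathcomp Require Import all_boot all_order all_algebra finmap.
From mathcomp Require Import all_classical reals topology.

Set Implicit Arguments.
Unset Strict Implicit.
Unset Printing Implicit Defensive.

Import Order.TTheory GRing.Theory Num.Theory.

Local Open Scope classical_set_scope.

Record edgeset (S T : finType) := EdgeSet {
  edge :> finType;
  src : edge -> S;
  rng : edge -> T;
  ele : rel edge;
  ele_refl : reflexive ele;
  ele_anti : antisymmetric ele;
  ele_trans : transitive ele;
  (* so [ele] restricts to a linear order on each fibre of [rng], and edges
     with different ranges are incomparable *)
  ele_cmp : forall e e', (ele e e' || ele e' e) = (rng e == rng e')
}.

Arguments src {S T} _ _.
Arguments rng {S T} _ _.
Arguments ele {S T} _ _ _.

Definition elt (S T : finType) (F : edgeset S T) (e e' : F) :=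
  (e != e') && ele F e e'.

Definition emax (S T : finType) (F : edgeset S T) (e : F) :=
  forall e' : F, ele F e e' -> e' = e.

Definition emin (S T : finType) (F : edgeset S T) (e : F) :=
  forall e' : F, ele F e' e -> e' = e.

Definition esucc (S T : finType) (F : edgeset S T) (e e' : F) :=
  elt e e' /\ forall e'' : F, elt e e'' -> ele F e' e''.

Definition eiso (S T : finType) (F G : edgeset S T) :=
  exists h : F -> G,
    [/\ bijective h,
        forall e, src G (h e) = src F e,
        forall e, rng G (h e) = rng F e &
        forall e e', ele G (h e) (h e') = ele F e e'].

Lemma ele_rng (S T : finType) (F : edgeset S T) (e e' : F) :
  ele F e e' -> rng F e = rng F e'.
Proof. by move=> h; apply/eqP; rewrite -ele_cmp h. Qed.

Section EComp.
Variables (S T U : finType) (F : edgeset S T) (G : edgeset T U).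

Definition ecomp_edge := {p : F * G | rng F p.1 == src G p.2}.

Definition ecomp_ele (p q : ecomp_edge) :=
  elt (val p).2 (val q).2 ||
  ((val p).2 == (val q).2) && ele F (val p).1 (val q).1.

Lemma ecomp_refl : reflexive ecomp_ele.
Proof. by move=> p; rewrite /ecomp_ele eqxx ele_refl orbT. Qed.

Lemma ecomp_anti : antisymmetric ecomp_ele.
Proof.
move=> [[a b] p] [[c d] q] /andP[]; rewrite /ecomp_ele /elt /=.
case: (eqVneq b d) => [e2|n2] /=.
  by move=> h1 h2; apply: val_inj; rewrite /= e2;
    congr pair; apply: (@ele_anti _ _ F); rewrite h1 h2.
rewrite !orbF => h1 h2.
by case/eqP: n2; apply: (@ele_anti _ _ G); rewrite h1 h2.
Qed.

Lemma ecomp_trans : transitive ecomp_ele.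
Proof.
move=> [[c d] q] [[a b] p] [[e f] r]; rewrite /ecomp_ele /elt /=.
case: (eqVneq b d) => [->|n2] /=.
  by case: (eqVneq d f) => [//|//] /= _; exact: ele_trans.
rewrite orbF => h1; case: (eqVneq d f) => [<-|n2'] /=.
  by rewrite n2 h1.
rewrite orbF => h2; have h3 := ele_trans h1 h2; rewrite h3 andbT.
case: eqVneq => //= e2; case/eqP: n2.
by apply: (@ele_anti _ _ G); rewrite h1 e2 h2.
Qed.

Lemma ecomp_cmp p q :
  (ecomp_ele p q || ecomp_ele q p) = (rng G (val p).2 == rng G (val q).2).
Proof.
move: p q => [[a b] p] [[c d] q]; rewrite /ecomp_ele /elt /=.
case: (eqVneq b d) => [e2|n2] /=.
  by rewrite e2 ele_cmp; move: (p) (q) => /= /eqP -> /eqP ->; rewrite e2 !eqxx.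
by rewrite !orbF ele_cmp.
Qed.

Definition ecomp : edgeset S U :=
  @EdgeSet S U ecomp_edge
    (fun p => src F (val p).1) (fun p => rng G (val p).2) ecomp_ele
    ecomp_refl ecomp_anti ecomp_trans ecomp_cmp.
End EComp.

Infix "\;e" := ecomp (at level 50, left associativity).

Section EDiag.
Variables (V : nat -> finType) (k l : nat).

(* one edge from v to v for every v if [k = l], no edge otherwise *)
Definition ediag_edge :=
  {p : V k * V l | Tagged (fun n => V n : eqType) p.1 ==
                   Tagged (fun n => V n : eqType) p.2}.

Definition ediag_ele (p q : ediag_edge) := p == q.

Lemma ediag_refl : reflexive ediag_ele. Proof. by move=> p; exact: eqxx. Qed.

Lemma ediag_anti : antisymmetric ediag_ele.
Proof. by move=> p q /andP[/eqP]. Qed.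

Lemma ediag_trans : transitive ediag_ele.
Proof. by move=> q p r /eqP ->. Qed.

Lemma ediag_cmp (p q : ediag_edge) :
  (ediag_ele p q || ediag_ele q p) = ((val p).2 == (val q).2).
Proof.
rewrite /ediag_ele (eq_sym q) orbb; apply/eqP/eqP => [->//|].
move: p q => [[a b] p] [[c d] q] /= bd; apply: val_inj => /=; rewrite -bd.
move: (p) (q) => /= /eqP pe /eqP qe; congr pair.
by apply: (@eq_from_Tagged _ (fun n => V n : eqType) k); rewrite pe qe bd.
Qed.

Definition ediag : edgeset (V k) (V l) :=
  @EdgeSet (V k) (V l) ediag_edge (fun p => (val p).1) (fun p => (val p).2)
    ediag_ele ediag_refl ediag_anti ediag_trans ediag_cmp.
End EDiag.

Lemma eiso_refl (S T : finType) (F : edgeset S T) : eiso F F.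
Proof. by exists id; split=> //; exists id. Qed.

Lemma eiso_sym (S T : finType) (F G : edgeset S T) : eiso F G -> eiso G F.
Proof.
move=> [h [[g hg gh] hs hr hl]]; exists g; split.
- by exists h.
- by move=> e; rewrite -hs gh.
- by move=> e; rewrite -hr gh.
- by move=> e e'; rewrite -hl !gh.
Qed.

Lemma eiso_trans (S T : finType) (F G H : edgeset S T) :
  eiso F G -> eiso G H -> eiso F H.
Proof.
move=> [h [hb hs hr hl]] [g [gb gs gr gl]]; exists (g \o h); split=> [|e|e|e e'] /=.
- exact: bij_comp.
- by rewrite gs.
- by rewrite gr.
- by rewrite gl.
Qed.

Lemma eiso_mono (S T : finType) (F G : edgeset S T) (h : F -> G) :
  bijective h -> (forall e, src G (h e) = src F e) ->
  (forall e, rng G (h e) = rng F e) ->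
  (forall e e', ele F e e' -> ele G (h e) (h e')) -> eiso F G.
Proof.
move=> hb hs hr hl; exists h; split=> // e e'.
apply/idP/idP => [le|]; last exact: hl.
have : ele F e e' || ele F e' e by rewrite ele_cmp -!hr (ele_rng le).
case/orP=> // le'; have /(bij_inj hb) -> : h e = h e'; last exact: ele_refl.
by apply: (@ele_anti _ _ G); rewrite le hl.
Qed.

Lemma ecomp_iso (S T U : finType) (F F' : edgeset S T) (G G' : edgeset T U) :
  eiso F F' -> eiso G G' -> eiso (F \;e G) (F' \;e G').
Proof.
move=> [h [[h' hh' h'h] hs hr hl]] [k [[k' kk' k'k] ks kr kl]].
have P (p : F \;e G) : rng F' (h (val p).1) == src G' (k (val p).2).
  by rewrite hr ks (eqP (valP p)).
have P' (p : F' \;e G') : rng F (h' (val p).1) == src G (k' (val p).2).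
  by rewrite -hr h'h -ks k'k (eqP (valP p)).
pose f (p : F \;e G) : F' \;e G' := exist _ (h (val p).1, k (val p).2) (P p).
pose f' (p : F' \;e G') : F \;e G := exist _ (h' (val p).1, k' (val p).2) (P' p).
apply: (@eiso_mono _ _ _ _ f) => [|e|e|].
- exists f' => [] [[a b] ab]; apply: val_inj => /=.
    by rewrite hh' kk'.
  by rewrite h'h k'k.
- exact: hs.
- exact: kr.
- move=> [[a b] ab] [[c d] cd]; rewrite /= /ecomp_ele /elt /= hl kl.
  by rewrite (can_eq kk').
Qed.

Lemma ecompA (S T U W : finType)
    (F : edgeset S T) (G : edgeset T U) (H : edgeset U W) :
  eiso (F \;e (G \;e H)) (F \;e G \;e H).
Proof.
have P1 (p : F \;e (G \;e H)) : rng F (val p).1 == src G (val (val p).2).1.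
  exact: (valP p).
pose a1 (p : F \;e (G \;e H)) : F \;e G :=
  exist _ ((val p).1, (val (val p).2).1) (P1 p).
have P2 (p : F \;e (G \;e H)) : rng (F \;e G) (a1 p) == src H (val (val p).2).2.
  exact: (valP (val p).2).
pose f p : F \;e G \;e H := exist _ (a1 p, (val (val p).2).2) (P2 p).
have Q1 (p : F \;e G \;e H) : rng G (val (val p).1).2 == src H (val p).2.
  exact: (valP p).
pose b1 (p : F \;e G \;e H) : G \;e H :=
  exist _ ((val (val p).1).2, (val p).2) (Q1 p).
have Q2 (p : F \;e G \;e H) : rng F (val (val p).1).1 == src (G \;e H) (b1 p).
  exact: (valP (val p).1).
pose g p : F \;e (G \;e H) := exist _ ((val (val p).1).1, b1 p) (Q2 p).
apply: (@eiso_mono _ _ _ _ f) => //.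
  exists g.
    move=> [[x [[y z] yz]] xyz]; apply: val_inj => /=; congr pair.
    exact: val_inj.
  move=> [[[[x y] xy] z] xyz]; apply: val_inj => /=; congr pair.
  exact: val_inj.
move=> [[x [[y z] yz]] xyz] [[x' [[y' z'] yz']] xyz'].
rewrite /= /ecomp_ele /elt /= /ecomp_ele /elt -!val_eqE /= !xpair_eqE /=.
case: (eqVneq z z') => [_|nz] //=.
  by rewrite andbT.
by rewrite !andbF /= !orbF.
Qed.

Lemma ediag_comp (V : nat -> finType) k (T : finType) (F : edgeset (V k) T) :
  eiso (ediag V k k \;e F) F.
Proof.
have P (e : F) : Tagged (fun n => V n : eqType) (src F e) ==
                 Tagged (fun n => V n : eqType) (src F e) by [].
pose d e : ediag V k k := exist _ (src F e, src F e) (P e).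
pose g (e : F) : ediag V k k \;e F :=
  exist _ (d e, e) (eqxx (src F e)).
apply: eiso_sym; apply: (@eiso_mono _ _ _ _ g) => //.
  exists (fun p : ediag V k k \;e F => (val p).2) => //.
  move=> [[[[a b] /= ab] e] be]; apply: val_inj; congr pair.
  apply: val_inj => /=; move: (be) => /= /eqP <-; congr pair.
  by apply: (@eq_from_Tagged _ (fun n => V n : eqType)); apply/esym/eqP.
move=> e e' le; rewrite /= /ecomp_ele /elt /= le andbT.
by case: eqVneq => //= <-; exact: eqxx.
Qed.

Lemma comp_ediag (V : nat -> finType) k (S : finType) (F : edgeset S (V k)) :
  eiso (F \;e ediag V k k) F.
Proof.
have P (e : F) : Tagged (fun n => V n : eqType) (rng F e) ==
                 Tagged (fun n => V n : eqType) (rng F e) by [].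
pose d e : ediag V k k := exist _ (rng F e, rng F e) (P e).
pose g (e : F) : F \;e ediag V k k :=
  exist _ (e, d e) (eqxx (rng F e)).
apply: eiso_sym; apply: (@eiso_mono _ _ _ _ g) => //.
  exists (fun p : F \;e ediag V k k => (val p).1) => //.
  move=> [[e [[a b] /= ab]] be]; apply: val_inj; congr pair.
  apply: val_inj => /=; move: (be) => /= /eqP ->; congr pair.
  by apply: (@eq_from_Tagged _ (fun n => V n : eqType)); apply/eqP.
move=> e e' le; rewrite /= /ecomp_ele /elt /= le andbT; apply/orP; right.
by rewrite -val_eqE /= (ele_rng le) eqxx.
Qed.

(* [dedge B n] is the edge set from level [n] to level [n.+1], that is
   $E_{n+1}$. *)
Record diagram := Diagram {
  vtx : nat -> finType;
  dedge : forall n, edgeset (vtx n) (vtx n.+1)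
}.

Record is_bratteli (B : diagram) : Prop := IsBratteli {
  vtx_ne : forall n, 0 < #|vtx B n|;
  vtx0 : #|vtx B 0| = 1;
  dedge_ne : forall n, 0 < #|dedge B n|;
  dedge_src : forall n (v : vtx B n), exists e : dedge B n, src _ e = v;
  dedge_rng : forall n (v : vtx B n.+1), exists e : dedge B n, rng _ e = v
}.

(* $E_{k,l}$ for $k \leq l$; there are no edges if $k > l$ *)
Fixpoint epath (B : diagram) (k l : nat) : edgeset (vtx B k) (vtx B l) :=
  match l with
  | 0 => ediag (vtx B) k 0
  | m.+1 => if k <= m then epath B k m \;e dedge B m else ediag (vtx B) k m.+1
  end.

Lemma epath_diag B k : epath B k k = ediag (vtx B) k k.
Proof. by case: k => //= k; rewrite ltnn. Qed.

Lemma epathS B k l : k <= l -> epath B k l.+1 = epath B k l \;e dedge B l.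
Proof. by move=> /= ->. Qed.

Lemma epath1 B k : eiso (epath B k k.+1) (dedge B k).
Proof. by rewrite epathS // epath_diag; exact: ediag_comp. Qed.

Lemma epath_cat B k l m : k <= l -> l <= m ->
  eiso (epath B k l \;e epath B l m) (epath B k m).
Proof.
move=> kl; elim: m => [|m IHm] lm.
  by move: lm; rewrite leqn0 => /eqP l0; subst l; exact: comp_ediag.
move: lm; rewrite leq_eqVlt => /orP[/eqP e|].
  by subst l; rewrite (epath_diag B m.+1); exact: comp_ediag.
rewrite ltnS => lm; rewrite !epathS //; last exact: leq_trans lm.
apply: eiso_trans (ecompA _ _ _) _.
by apply: ecomp_iso (eiso_refl _); exact: IHm.
Qed.

(* an infinite path; its edge from level [n] to level [n.+1] is [pth x n] *)
Record path_space (B : diagram) := PathSpace {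
  pth :> forall n, dedge B n;
  pthP : forall n, rng _ (pth n) = src _ (pth n.+1)
}.

Definition max_path (B : diagram) (x : path_space B) := forall n, emax (x n).
Definition min_path (B : diagram) (x : path_space B) := forall n, emin (x n).

Definition properly_ordered (B : diagram) :=
  (exists! x : path_space B, max_path x) /\
  (exists! x : path_space B, min_path x).

Record premorphism (B C : diagram) := Premorphism {
  plev : nat -> nat;
  pedge : forall n, edgeset (vtx B n) (vtx C (plev n));
  plev0 : plev 0 = 0;
  plev_mono : forall n, plev n <= plev n.+1;
  plev_unb : forall N, exists n, N <= plev n;
  pedge_ne : forall n, 0 < #|pedge n|;
  pedge_src : forall n (v : vtx B n), exists e : pedge n, src _ e = v;
  pedge_rng : forall n (w : vtx C (plev n)), exists e : pedge n, rng _ e = w;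
  pedge0 : #|pedge 0| = 1;
  pedge_comm : forall n,
    eiso (dedge B n \;e pedge n.+1) (pedge n \;e epath C (plev n) (plev n.+1))
}.

Arguments plev {B C} _ _.
Arguments pedge {B C} _ _.

Definition pequiv (B C : diagram) (f g : premorphism B C) :=
  exists n m : nat -> nat, 0 < n 0 /\ forall k,
    [/\ n k < m k < n k.+1,
        plev f (n k) < plev g (m k) < plev f (n k.+1),
        eiso (epath B (n k) (m k) \;e pedge g (m k))
             (pedge f (n k) \;e epath C (plev f (n k)) (plev g (m k))) &
        eiso (epath B (m k) (n k.+1) \;e pedge f (n k.+1))
             (pedge g (m k) \;e epath C (plev g (m k)) (plev f (n k.+1)))].

Section PremorphismTheory.
Variables (B C : diagram).
Implicit Types f g h : premorphism B C.

Lemma plev_le f m n : m <= n -> plev f m <= plev f n.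
Proof.
elim: n => [|n IHn]; first by rewrite leqn0 => /eqP ->.
rewrite leq_eqVlt => /orP[/eqP ->//|]; rewrite ltnS => /IHn h.
exact: leq_trans h (plev_mono f n).
Qed.

Lemma plev_event f N : exists n0, forall n, n0 <= n -> N <= plev f n.
Proof.
have [n0 h] := plev_unb f N; exists n0 => n /(plev_le f); exact: leq_trans.
Qed.

Lemma pedge_path f k l : k <= l ->
  eiso (epath B k l \;e pedge f l)
       (pedge f k \;e epath C (plev f k) (plev f l)).
Proof.
elim: l => [|l IHl].
  rewrite leqn0 => /eqP k0; subst k; rewrite !epath_diag.
  apply: eiso_trans (ediag_comp _) _; apply: eiso_sym; exact: comp_ediag.
rewrite leq_eqVlt => /orP[/eqP e|].
  subst k; rewrite !epath_diag.
  apply: eiso_trans (ediag_comp _) _; apply: eiso_sym; exact: comp_ediag.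
rewrite ltnS => kl; rewrite epathS //.
apply: eiso_trans (eiso_sym (ecompA _ _ _)) _.
apply: eiso_trans (ecomp_iso (eiso_refl _) (pedge_comm f l)) _.
apply: eiso_trans (ecompA _ _ _) _.
apply: eiso_trans (ecomp_iso (IHl kl) (eiso_refl _)) _.
apply: eiso_trans (eiso_sym (ecompA _ _ _)) _.
apply: ecomp_iso (eiso_refl _) _.
by apply: epath_cat; [exact: plev_le|exact: plev_mono].
Qed.

(* [f] eventually factors through [g]; equivalence is the symmetric version *)
Definition pdom f g := forall n, exists m0, forall m, m0 <= m ->
  [/\ n < m, plev f n < plev g m &
      eiso (epath B n m \;e pedge g m)
           (pedge f n \;e epath C (plev f n) (plev g m))].

Lemma pdom_ext f g (fg : forall n, plev f n = plev g n) :
  (forall n m, plev f n <= m ->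
     eiso (pedge f n \;e epath C (plev f n) m)
          (pedge g n \;e epath C (plev g n) m)) -> pdom f g.
Proof.
move=> H n; have [m1 h1] := plev_event g (plev f n).+1.
exists (maxn n.+1 m1) => m; rewrite geq_max => /andP[nm m1m].
have lt := h1 _ m1m; split=> //.
apply: eiso_trans (pedge_path g (ltnW nm)) _.
by apply: eiso_sym; apply: H; exact: ltnW.
Qed.

Lemma pdom_trans f g h : pdom f g -> pdom g h -> pdom f h.
Proof.
move=> fg gh n; have [m0 h0] := fg n; have [np fgp i1] := h0 _ (leqnn m0).
have [m1 h1] := gh m0; exists m1 => m /h1[pm ghm i2].
split; [exact: ltn_trans pm|exact: ltn_trans ghm|].
apply: eiso_trans.
  apply: ecomp_iso (eiso_refl _); apply: eiso_sym.
  apply: (epath_cat B (ltnW np) (ltnW pm)).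
apply: eiso_trans (eiso_sym (ecompA _ _ _)) _.
apply: eiso_trans (ecomp_iso (eiso_refl _) i2) _.
apply: eiso_trans (ecompA _ _ _) _.
apply: eiso_trans (ecomp_iso i1 (eiso_refl _)) _.
apply: eiso_trans (eiso_sym (ecompA _ _ _)) _.
apply: ecomp_iso (eiso_refl _) _.
exact: epath_cat (ltnW fgp) (ltnW ghm).
Qed.

Lemma pequiv_sym f g : pequiv f g -> pequiv g f.
Proof.
move=> [n [m [n0 H]]]; exists m, (n \o S); split.
  by have [/andP[]] := H 0; case: (m 0).
move=> k; have [/andP[_ a1] /andP[_ a2] _ a3] := H k.
have [/andP[b1 _] /andP[b2 _] b3 _] := H k.+1.
by split=> //=; apply/andP.
Qed.

Lemma pequiv_dom f g : pequiv f g -> pdom f g.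
Proof.
move=> [n [m [n0 H]]] i.
have nk k : k <= n k.
  elim: k => // k IHk; have [/andP[h1 h2] _ _ _] := H k.
  by apply: leq_ltn_trans IHk _; exact: ltn_trans h2.
have [/andP[nm _] /andP[fg _] I _] := H i.
have ini := nk i.
exists (m i) => p mp; split.
- by apply: leq_ltn_trans ini _; exact: leq_trans mp.
- apply: leq_ltn_trans (plev_le f ini) _; apply: leq_trans fg _.
  exact: plev_le.
have c1 := epath_cat B (leq_trans ini (ltnW nm)) mp.
apply: eiso_trans (ecomp_iso (eiso_sym c1) (eiso_refl _)) _.
apply: eiso_trans (eiso_sym (ecompA _ _ _)) _.
apply: eiso_trans (ecomp_iso (eiso_refl _) (pedge_path g mp)) _.
apply: eiso_trans (ecompA _ _ _) _.
have c2 := epath_cat C (leq_trans (plev_le f ini) (ltnW fg)) (plev_le g mp).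
apply: (eiso_trans _ (ecomp_iso (eiso_refl _) c2)).
apply: (eiso_trans _ (eiso_sym (ecompA _ _ _))).
apply: ecomp_iso (eiso_refl _).
have c3 := epath_cat B ini (ltnW nm).
apply: eiso_trans (ecomp_iso (eiso_sym c3) (eiso_refl _)) _.
apply: eiso_trans (eiso_sym (ecompA _ _ _)) _.
apply: eiso_trans (ecomp_iso (eiso_refl _) I) _.
apply: eiso_trans (ecompA _ _ _) _.
apply: eiso_trans (ecomp_iso (pedge_path f ini) (eiso_refl _)) _.
apply: eiso_trans (eiso_sym (ecompA _ _ _)) _.
apply: ecomp_iso (eiso_refl _) _.
exact: epath_cat (plev_le f ini) (ltnW fg).
Qed.

Lemma pdom_pequiv f g : pdom f g -> pdom g f -> pequiv f g.
Proof.
move=> /choice[u uP] /choice[w wP].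
pose n k := iter k (w \o u) 1; exists n, (u \o n); split=> // k.
have [a1 a2 a3] := uP (n k) _ (leqnn _).
have [b1 b2 b3] := wP (u (n k)) _ (leqnn _).
by split=> //=; apply/andP.
Qed.

Lemma pequiv_ext f g (fg : forall n, plev f n = plev g n) :
  (forall n m, plev f n <= m ->
     eiso (pedge f n \;e epath C (plev f n) m)
          (pedge g n \;e epath C (plev g n) m)) -> pequiv f g.
Proof.
move=> H; apply: pdom_pequiv; apply: pdom_ext => // n m gm.
by apply: eiso_sym; apply: H; rewrite fg.
Qed.

Lemma pequiv_refl f : pequiv f f.
Proof. by apply: pequiv_ext => // n m _; exact: eiso_refl. Qed.

Lemma pequiv_trans f g h : pequiv f g -> pequiv g h -> pequiv f h.
Proof.
move=> fg gh; apply: pdom_pequiv.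
  by apply: (@pdom_trans f g h); exact: pequiv_dom.
by apply: (@pdom_trans h g f); apply: pequiv_dom; exact: pequiv_sym.
Qed.

End PremorphismTheory.

Section PComp.
Variables (B C D : diagram) (g : premorphism C D) (f : premorphism B C).

Definition pcomp_lev n := plev g (plev f n).
Definition pcomp_edge n : edgeset (vtx B n) (vtx D (pcomp_lev n)) :=
  pedge f n \;e pedge g (plev f n).

Lemma pcomp_lev0 : pcomp_lev 0 = 0.
Proof. by rewrite /pcomp_lev plev0 plev0. Qed.

Lemma pcomp_mono n : pcomp_lev n <= pcomp_lev n.+1.
Proof. by apply: plev_le; exact: plev_mono. Qed.

Lemma pcomp_unb N : exists n, N <= pcomp_lev n.
Proof.
have [m h] := plev_unb g N; have [n k] := plev_unb f m; exists n.
exact: leq_trans h (plev_le g k).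
Qed.

Lemma pcomp_ne n : 0 < #|pcomp_edge n|.
Proof.
have /card_gt0P[e _] := pedge_ne f n; have [e' h] := pedge_src g (rng _ e).
have P : rng (pedge f n) e == src (pedge g (plev f n)) e' by rewrite h.
by apply/card_gt0P; exists (exist _ (e, e') P : pcomp_edge n).
Qed.

Lemma pcomp_src n (v : vtx B n) : exists e : pcomp_edge n, src _ e = v.
Proof.
have [e ev] := pedge_src f v; have [e' h] := pedge_src g (rng _ e).
have P : rng (pedge f n) e == src (pedge g (plev f n)) e' by rewrite h.
by exists (exist _ (e, e') P).
Qed.

Lemma pcomp_rng n (w : vtx D (pcomp_lev n)) :
  exists e : pcomp_edge n, rng _ e = w.
Proof.
have [e' ew] := pedge_rng (p := g) (n := plev f n) w.
have [e h] := pedge_rng (p := f) (src _ e').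
have P : rng (pedge f n) e == src (pedge g (plev f n)) e' by rewrite h.
by exists (exist _ (e, e') P).
Qed.

Lemma pcomp0 : #|pcomp_edge 0| = 1.
Proof.
apply/eqP; rewrite eqn_leq pcomp_ne andbT.
apply: (@leq_trans #|[the finType of (pedge f 0 * pedge g (plev f 0))%type]|).
  by rewrite card_sig; exact: max_card.
have : #|pedge g (plev f 0)| = 1 by rewrite plev0 pedge0.
by rewrite card_prod pedge0 => ->.
Qed.

Lemma pcomp_comm n :
  eiso (dedge B n \;e pcomp_edge n.+1)
       (pcomp_edge n \;e epath D (pcomp_lev n) (pcomp_lev n.+1)).
Proof.
apply: eiso_trans (ecompA _ _ _) _.
apply: eiso_trans (ecomp_iso (pedge_comm f n) (eiso_refl _)) _.
apply: eiso_trans (eiso_sym (ecompA _ _ _)) _.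
apply: eiso_trans (ecomp_iso (eiso_refl _) (pedge_path g (plev_mono f n))) _.
exact: ecompA.
Qed.

Definition pcomp : premorphism B D :=
  Premorphism pcomp_lev0 pcomp_mono pcomp_unb pcomp_ne pcomp_src pcomp_rng
    pcomp0 pcomp_comm.
End PComp.

Lemma pcomp_dom (B C D : diagram) (g g' : premorphism C D)
    (f f' : premorphism B C) :
  pdom f f' -> pdom g g' -> pdom (pcomp g f) (pcomp g' f').
Proof.
move=> df dg n; have [m0 H0] := df n; have [p0 K0] := dg (plev f n).
have [m1 H1] := plev_event f' p0.
exists (maxn m0 m1) => m; rewrite geq_max => /andP[/H0[nm ff' i] /H1/K0[_ gg' j]].
split=> //=.
apply: eiso_trans (ecompA _ _ _) _.
apply: eiso_trans (ecomp_iso i (eiso_refl _)) _.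
apply: eiso_trans (eiso_sym (ecompA _ _ _)) _.
apply: eiso_trans (ecomp_iso (eiso_refl _) j) _.
exact: ecompA.
Qed.

Lemma pcomp_equiv (B C D : diagram) (g g' : premorphism C D)
    (f f' : premorphism B C) :
  pequiv f f' -> pequiv g g' -> pequiv (pcomp g f) (pcomp g' f').
Proof.
move=> ef eg; apply: pdom_pequiv; apply: pcomp_dom; apply: pequiv_dom => //;
  exact: pequiv_sym.
Qed.

Section PId.
Variables (B : diagram) (wB : is_bratteli B).

Let dg n (v : vtx B n) : ediag (vtx B) n n := exist _ (v, v) (eqxx _).

Lemma pid_ne n : 0 < #|ediag (vtx B) n n|.
Proof. by have /card_gt0P[v _] := vtx_ne wB n; apply/card_gt0P; exists (dg v). Qed.

Lemma pid0 : #|ediag (vtx B) 0 0| = 1.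
Proof.
apply/eqP; rewrite eqn_leq pid_ne andbT.
apply: (@leq_trans #|[the finType of (vtx B 0 * vtx B 0)%type]|).
  by rewrite card_sig; exact: max_card.
by rewrite card_prod vtx0.
Qed.

Lemma pid_comm n :
  eiso (dedge B n \;e ediag (vtx B) n.+1 n.+1)
       (ediag (vtx B) n n \;e epath B n n.+1).
Proof.
apply: eiso_trans (comp_ediag _) _; apply: eiso_sym.
apply: eiso_trans (ediag_comp _) _; exact: epath1.
Qed.

Definition pid : premorphism B B :=
  @Premorphism B B id (fun n => ediag (vtx B) n n) erefl leqnSn
    (fun N => ex_intro _ N (leqnn N)) pid_ne
    (fun n v => ex_intro _ (dg v) erefl) (fun n v => ex_intro _ (dg v) erefl)
    pid0 pid_comm.
End PId.

Record category := Category {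
  obj :> Type;
  hom : obj -> obj -> Type;
  idm : forall A, hom A A;
  cmp : forall A B C, hom B C -> hom A B -> hom A C;
  cmp1m : forall A B (f : hom A B), cmp (idm B) f = f;
  cmpm1 : forall A B (f : hom A B), cmp f (idm A) = f;
  cmpA : forall A B C D (h : hom C D) (g : hom B C) (f : hom A B),
    cmp h (cmp g f) = cmp (cmp h g) f
}.

Arguments hom {_} _ _.
Arguments idm {_} _.
Arguments cmp {_ _ _ _} _ _.

Infix "\c" := cmp (at level 40, left associativity).

Record isom (C : category) (A B : C) := Isom {
  fwd :> hom A B;
  bwd : hom B A;
  bwdK : bwd \c fwd = idm A;
  fwdK : fwd \c bwd = idm B
}.

Definition full_subcategory (C : category) (P : C -> Prop) : category :=
  @Category {A : C | P A} (fun A B => hom (sval A) (sval B))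
    (fun A => idm (sval A)) (fun A B D g f => g \c f)
    (fun A B f => cmp1m f) (fun A B f => cmpm1 f)
    (fun A B D E h g f => cmpA h g f).

Record functor (C D : category) (F0 : C -> D) := Functor {
  fmap : forall A B, hom A B -> hom (F0 A) (F0 B);
  fmap1 : forall A, fmap (idm A) = idm (F0 A);
  fmapM : forall A B E (g : hom B E) (f : hom A B),
    fmap (g \c f) = fmap g \c fmap f
}.

Record contrafunctor (C D : category) (F0 : C -> D) := Contrafunctor {
  cfmap : forall A B, hom A B -> hom (F0 B) (F0 A);
  cfmap1 : forall A, cfmap (idm A) = idm (F0 A);
  cfmapM : forall A B E (g : hom B E) (f : hom A B),
    cfmap (g \c f) = cfmap f \c cfmap g
}.

Arguments fmap {C D F0} _ {A B} _.
Arguments cfmap {C D F0} _ {A B} _.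

Definition functor_id (C : category) : functor (fun A : C => A) :=
  @Functor C C (fun A => A) (fun A B f => f)
    (fun A => erefl) (fun A B E g f => erefl).

Section ContraComp.
Variables (C D E : category) (F0 : C -> D) (G0 : D -> E).
Variables (G : contrafunctor G0) (F : contrafunctor F0).

Lemma contra_comp1 A : cfmap G (cfmap F (idm A)) = idm (G0 (F0 A)).
Proof. by rewrite !cfmap1. Qed.

Lemma contra_compM A B X (g : hom B X) (f : hom A B) :
  cfmap G (cfmap F (g \c f)) = cfmap G (cfmap F g) \c cfmap G (cfmap F f).
Proof. by rewrite !cfmapM. Qed.

Definition contra_comp : functor (fun A => G0 (F0 A)) :=
  Functor contra_comp1 contra_compM.
End ContraComp.

Definition natural_isomorphism (C D : category) (F0 G0 : C -> D)
    (F : functor F0) (G : functor G0) (t : forall A, isom (F0 A) (G0 A)) :=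
  forall A B (h : hom A B), t B \c fmap F h = fmap G h \c t A.

Definition inverse_equivalences (C D : category) (F0 : C -> D) (G0 : D -> C)
    (F : contrafunctor F0) (G : contrafunctor G0)
    (t : forall B, isom B (F0 (G0 B))) (u : forall A, isom A (G0 (F0 A))) :=
  natural_isomorphism (functor_id D) (contra_comp F G) t /\
  natural_isomorphism (functor_id C) (contra_comp G F) u.

Record bratteli := Bratteli { bdiag :> diagram; bratteliP : is_bratteli bdiag }.

(* A morphism is an equivalence class of premorphisms. The class is a bare
   predicate because [premorphism B C] is too large a type for [set]. *)
Record obd_hom (B C : diagram) := ObdHom {
  obd_set : premorphism B C -> Prop;
  obd_setP : exists f, obd_set = pequiv f
}.

Definition class_of (B C : diagram) (f : premorphism B C) : obd_hom B C :=
  ObdHom (ex_intro _ f erefl).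

Lemma obd_hom_eq (B C : diagram) (h k : obd_hom B C) : obd_set h = obd_set k -> h = k.
Proof.
by case: h k => [h hP] [k kP] /= hk; subst k; rewrite (Prop_irrelevance hP kP).
Qed.

Lemma obd_homE (B C : diagram) (h : obd_hom B C) : exists f, h = class_of f.
Proof. by have [f fP] := obd_setP h; exists f; exact: obd_hom_eq. Qed.

Lemma class_of_eq (B C : diagram) (f g : premorphism B C) :
  pequiv f g -> class_of f = class_of g.
Proof.
move=> fg; apply: obd_hom_eq => /=; apply/funext => h; apply/propext; split.
  by apply: pequiv_trans; exact: pequiv_sym.
exact: pequiv_trans.
Qed.

Lemma class_of_inj (B C : diagram) (f g : premorphism B C) :
  class_of f = class_of g -> pequiv f g.
Proof.
move=> /(congr1 (fun h => obd_set h g)) /= ->; exact: pequiv_refl.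
Qed.

Definition obd_hom_comp_set (B C D : diagram) (k : obd_hom C D) (h : obd_hom B C)
    (c : premorphism B D) :=
  exists g f, [/\ obd_set k g, obd_set h f & pequiv (pcomp g f) c].

Lemma obd_hom_comp_setE (B C D : diagram) (g : premorphism C D)
    (f : premorphism B C) :
  obd_hom_comp_set (class_of g) (class_of f) = pequiv (pcomp g f).
Proof.
apply/funext => c; apply/propext; split.
  by move=> [g' [f' [/= gg' ff']]]; apply: pequiv_trans; exact: pcomp_equiv.
by move=> gfc; exists g, f; split=> //=; exact: pequiv_refl.
Qed.

Lemma obd_hom_comp_setP (B C D : diagram) (k : obd_hom C D) (h : obd_hom B C) :
  exists c, obd_hom_comp_set k h = pequiv c.
Proof.
have [g ->] := obd_homE k; have [f ->] := obd_homE h; exists (pcomp g f).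
exact: obd_hom_comp_setE.
Qed.

Definition obd_hom_comp (B C D : diagram) (k : obd_hom C D) (h : obd_hom B C) :
  obd_hom B D := ObdHom (obd_hom_comp_setP k h).

Lemma obd_hom_compE (B C D : diagram) (g : premorphism C D)
    (f : premorphism B C) :
  obd_hom_comp (class_of g) (class_of f) = class_of (pcomp g f).
Proof. by apply: obd_hom_eq; exact: obd_hom_comp_setE. Qed.

Lemma obd_hom1m (B C : bratteli) (h : obd_hom B C) :
  obd_hom_comp (class_of (pid (bratteliP C))) h = h.
Proof.
have [f ->] := obd_homE h; rewrite obd_hom_compE; apply: class_of_eq.
apply: pequiv_ext => // n m _; apply: ecomp_iso (eiso_refl _).
exact: comp_ediag.
Qed.

Lemma obd_homm1 (B C : bratteli) (h : obd_hom B C) :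
  obd_hom_comp h (class_of (pid (bratteliP B))) = h.
Proof.
have [f ->] := obd_homE h; rewrite obd_hom_compE; apply: class_of_eq.
apply: pequiv_ext => // n m _; apply: ecomp_iso (eiso_refl _).
exact: ediag_comp.
Qed.

Lemma obd_homA (A B C D : bratteli)
    (h : obd_hom C D) (g : obd_hom B C) (f : obd_hom A B) :
  obd_hom_comp h (obd_hom_comp g f) = obd_hom_comp (obd_hom_comp h g) f.
Proof.
have [h' ->] := obd_homE h; have [g' ->] := obd_homE g; have [f' ->] := obd_homE f.
rewrite !obd_hom_compE; apply: class_of_eq; apply: pequiv_ext => // n m _.
apply: ecomp_iso (eiso_refl _); apply: eiso_sym; exact: ecompA.
Qed.

Definition OBD : category :=
  @Category bratteli (fun B C => obd_hom B C)
    (fun B => class_of (pid (bratteliP B))) (fun A B C => @obd_hom_comp A B C)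
    obd_hom1m obd_homm1 obd_homA.

Definition OBDpo : category :=
  full_subcategory (fun B : OBD => properly_ordered (B : bratteli)).

Definition metrizable (R : realType) (X : topologicalType) :=
  exists d : X -> X -> R,
    [/\ forall x y, (d x y == 0%R) = (x == y),
        forall x y, d x y = d y x,
        forall x y z, (d x z <= d x y + d y z)%R &
        forall A : set X, open A <->
          forall x, A x -> exists2 e : R,
            (0 < e)%R & [set y | (d x y < e)%R] `<=` A].

Lemma metrizable_hausdorff (R : realType) (X : topologicalType) :
  metrizable R X -> hausdorff_space X.
Proof.
move=> [d [d0 dC dD dO]].
have dxx x : d x x = 0%R by apply/eqP; rewrite d0.
have bo x (e : R) : open [set y | (d x y < e)%R].
  apply/dO => y /= xy; exists (e - d x y)%R; first by rewrite subr_gt0.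
  by move=> z /= yz; apply: le_lt_trans (dD x y z) _; rewrite -ltrBrDl.
rewrite open_hausdorff => x y xy.
have dge : (0 <= d x y)%R.
  have := dD x y x; rewrite dxx (dC y x) -mulr2n.
  by rewrite pmulrn_lge0.
have dpos : (0 < d x y)%R by rewrite lt_neqAle dge eq_sym d0 xy.
exists ([set z | (d x z < d x y / 2)%R], [set z | (d y z < d x y / 2)%R]).
  by split; rewrite inE /= dxx divr_gt0.
split; [exact: bo|exact: bo|]; apply/eqP; rewrite -subset0 => z [/= h1 h2].
have h3 : (d z y < d x y / 2)%R by rewrite dC.
by have := le_lt_trans (dD x z y) (ltrD h1 h3); rewrite -splitr ltxx.
Qed.

Definition homeomorphism (X Y : topologicalType) (f : X -> Y) :=
  continuous f /\ exists g : Y -> X, [/\ continuous g, cancel f g & cancel g f].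

Definition closed_invariant (X : topologicalType) (phi : X -> X) (M : set X) :=
  [/\ closed M, M !=set0 & phi @` M = M].

Definition minimal_subset (X : topologicalType) (phi : X -> X) (M : set X) :=
  closed_invariant phi M /\
  forall N, closed_invariant phi N -> N `<=` M -> N = M.

Definition essentially_minimal (R : realType) (X : topologicalType)
    (phi : X -> X) (x0 : X) :=
  [/\ metrizable R X, compact [set: X], totally_disconnected [set: X],
      homeomorphism phi &
      exists2 M, unique (minimal_subset phi) M & M x0].

(* A partition together with its towers $(Z_1, \ldots, Z_n)$; the sets of a
   tower S are [nth set0 S j] for [j < size S], so indices start from 0. *)
Definition towers (X : Type) := {fset seq (set X)}.

Definition cells (X : Type) (P : towers X) : set (set X) :=
  [set Z | exists2 S, S \in P & Z \in S].

Definition tops (X : Type) (P : towers X) : set X :=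
  \bigcup_(S in [set S | S \in P]) last set0 S.

Definition bottoms (X : Type) (P : towers X) : set X :=
  \bigcup_(S in [set S | S \in P]) head set0 S.

Record kr_partition (X : topologicalType) (phi : X -> X) (x0 : X)
    (P : towers X) : Prop := KRPartition {
  kr_size : forall S, S \in P -> 0 < size S;
  kr_ne : forall Z, cells P Z -> Z !=set0;
  kr_clopen : forall Z, cells P Z -> clopen Z;
  kr_cover : forall x, exists2 Z, cells P Z & Z x;
  kr_disj : forall S T i j, S \in P -> T \in P -> i < size S -> j < size T ->
    nth set0 S i `&` nth set0 T j !=set0 -> S = T /\ i = j;
  kr_step : forall S i, S \in P -> i.+1 < size S ->
    phi @` nth set0 S i = nth set0 S i.+1;
  kr_top : tops P x0;
  kr_bottom : phi @` tops P = bottoms P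
}.

Definition refines (X : Type) (P Q : towers X) :=
  forall Y, cells Q Y -> exists2 Z, cells P Z & Y `<=` Z.

Record kr_system (X : topologicalType) (phi : X -> X) (x0 : X)
    (P : nat -> towers X) : Prop := KRSystem {
  krs_kr : forall n, kr_partition phi x0 (P n);
  krs_0 : P 0 = [fset [:: setT]]%fset;
  krs_refines : forall n, refines (P n) (P n.+1);
  krs_tops : forall n, 0 < n -> tops (P n.+1) `<=` tops (P n);
  krs_cap : \bigcap_(n in [set n | 0 < n]) tops (P n) = [set x0];
  krs_basis : basis (\bigcup_n cells (P n))
}.

Record system := System {
  space : topologicalType;
  smap : space -> space;
  spt : space;
  spart : nat -> towers space
}.

Record is_sds (R : realType) (X : system) : Prop := IsSDS {
  sds_em : essentially_minimal R (@smap X) (spt X);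
  sds_kr : kr_system (@smap X) (spt X) (spart X)
}.

Record sds (R : realType) := Sds { ssys :> system; sdsP : is_sds R ssys }.

(* Morphisms are taken to be surjective (factor maps): this holds if and only
   if the inverse images $\alpha^{-1}(Q_n)$ consist of non-empty sets, as
   Kakutani-Rokhlin partitions do (see [sds_surjP] below), and it is needed for
   every vertex to be the source of an edge of $F_n$. The inclusion of the fixed
   point into the shift on the one-point compactification of the integers is
   continuous, equivariant and pointed, but induces no ordered premorphism. *)
Record sds_hom (X Y : system) := SdsHom {
  sfun :> space X -> space Y;
  sfun_cont : continuous sfun;
  sfun_equiv : sfun \o @smap X = @smap Y \o sfun;
  sfun_pt : sfun (spt X) = spt Y;
  sfun_surj : forall y, exists x, sfun x = y
}.

Lemma sds_hom_eq (X Y : system) (a b : sds_hom X Y) :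
  a = b :> (_ -> _) -> a = b.
Proof.
case: a b => [a a1 a2 a3 a4] [b b1 b2 b3 b4] /= ab; subst b.
by congr SdsHom; exact: Prop_irrelevance.
Qed.

Section SdsCat.
Variable R : realType.

Definition sds_id (X : system) : sds_hom X X.
Proof.
apply: (@SdsHom X X id) => //; first by move=> x; exact: cvg_id.
by move=> y; exists y.
Defined.

Definition sds_comp (X Y Z : system) (b : sds_hom Y Z) (a : sds_hom X Y) :
  sds_hom X Z.
Proof.
apply: (@SdsHom X Z (b \o a)).
- by move=> x; apply: continuous_comp; exact: sfun_cont.
- apply/funext => x /=; have := congr1 (fun f => f x) (sfun_equiv a).
  by move=> /= ->; exact: (congr1 (fun f => f (a x)) (sfun_equiv b)).
- by rewrite /= !sfun_pt.
- move=> z; have [y <-] := sfun_surj b z; have [x <-] := sfun_surj a y.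
  by exists x.
Defined.

Definition SDS : category :=
  @Category (sds R) (fun X Y => sds_hom X Y)
    (fun X => sds_id X) (fun X Y Z => @sds_comp X Y Z)
    (fun X Y a => @sds_hom_eq X Y (sds_comp (sds_id Y) a) a erefl)
    (fun X Y a => @sds_hom_eq X Y (sds_comp a (sds_id X)) a erefl)
    (fun X Y Z W c b a => @sds_hom_eq X W
       (sds_comp c (sds_comp b a)) (sds_comp (sds_comp c b) a) erefl).
End SdsCat.

(* $Y_{k+j} \subseteq Z_j$ for all j, with $S = (Z_j)_j$ and $T = (Y_j)_j$ *)
Definition occurs (X : Type) (S T : seq (set X)) (k : nat) :=
  k + size S <= size T /\
  forall j, j < size S -> nth set0 T (k + j) `<=` nth set0 S j.

(* The triples (S, T, k) of $E(P, Q)$, where the towers S of P are given as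
   the values of a map [t] on a finite type. As towers are non-empty,
   [k < size T] always holds. *)
Section TowerEdges.
Variables (X : Type) (A : finType) (t : A -> seq (set X)) (Q : towers X).

Definition tower_edge :=
  {e : A * {T : Q & 'I_(size (val T))} |
    `[< occurs (t e.1) (val (tag e.2)) (tagged e.2) >]}.

Definition tower_src (e : tower_edge) : A := (val e).1.
Definition tower_rng (e : tower_edge) : Q := tag (val e).2.
Definition tower_pos (e : tower_edge) : nat := tagged (val e).2.

Definition tower_ele (e e' : tower_edge) :=
  (tower_rng e == tower_rng e') && (tower_pos e <= tower_pos e').

Hypothesis t_size : forall S, 0 < size (t S).
Hypothesis t_disj : forall S S',
  nth set0 (t S) 0 `&` nth set0 (t S') 0 !=set0 -> S = S'.
Hypothesis Q_ne : forall T : Q, forall Y, Y \in val T -> Y !=set0.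

Lemma tower_refl : reflexive tower_ele.
Proof. by move=> e; rewrite /tower_ele eqxx leqnn. Qed.

Lemma tower_anti : antisymmetric tower_ele.
Proof.
move=> e e' /andP[/andP[/eqP r1 p1] /andP[_ p2]].
have p : tower_pos e = tower_pos e' by apply/eqP; rewrite eqn_leq p1 p2.
move: e e' r1 p {p1 p2}; rewrite /tower_rng /tower_pos.
move=> [[S [T k]] h] [[S' [T' k']] h'] /= r p; subst T'.
have kk : k = k' by exact: val_inj.
subst k'; apply: val_inj => /=; congr pair; apply: t_disj.
have /asboolP[_ /(_ 0 (t_size S))] := h; rewrite /= addn0 => o.
have /asboolP[_ /(_ 0 (t_size S'))] := h'; rewrite /= addn0 => o'.
have [y yT] := Q_ne (mem_nth set0 (ltn_ord k)).
by exists y; split; [exact: o|exact: o'].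
Qed.

Lemma tower_trans : transitive tower_ele.
Proof.
move=> e' e e'' /andP[/eqP r1 p1] /andP[/eqP r2 p2].
by rewrite /tower_ele r1 r2 eqxx; exact: leq_trans p2.
Qed.

Lemma tower_cmp e e' :
  (tower_ele e e' || tower_ele e' e) = (tower_rng e == tower_rng e').
Proof.
by rewrite /tower_ele [tower_rng e' == _]eq_sym -andb_orr leq_total andbT.
Qed.

Definition tower_edges : edgeset A Q :=
  @EdgeSet A Q tower_edge tower_src tower_rng tower_ele
    tower_refl tower_anti tower_trans tower_cmp.
End TowerEdges.

Section KRLemmas.
Variables (X : topologicalType) (phi : X -> X) (x0 : X) (P : towers X).
Hypothesis krP : kr_partition phi x0 P.

Lemma kr_size_fset (S : P) : 0 < size (val S).
Proof. exact: (kr_size krP (fsvalP S)). Qed.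

Lemma kr_disj0 (S S' : P) :
  nth set0 (val S) 0 `&` nth set0 (val S') 0 !=set0 -> S = S'.
Proof.
move=> h; apply: val_inj.
by have [] := kr_disj krP (fsvalP S) (fsvalP S') (kr_size_fset S) (kr_size_fset S') h.
Qed.

Lemma kr_ne_fset (S : P) Z : Z \in val S -> Z !=set0.
Proof. by move=> h; apply: (kr_ne krP); exists (val S) => //; exact: fsvalP. Qed.
End KRLemmas.

(* $E(P, Q)$ *)
Definition kr_edges (X : topologicalType) (phi : X -> X) (x0 : X)
    (P Q : towers X) (krP : kr_partition phi x0 P)
    (krQ : kr_partition phi x0 Q) : edgeset P Q :=
  tower_edges (t := fun S : P => val S)
    (kr_size_fset krP) (@kr_disj0 _ _ _ _ krP) (@kr_ne_fset _ _ _ _ krQ).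

Definition Pdiag (R : realType) (X : sds R) : diagram :=
  Diagram (vtx := fun n => spart X n : finType)
    (fun n => kr_edges (krs_kr (sds_kr (sdsP X)) n)
                       (krs_kr (sds_kr (sdsP X)) n.+1)).

Definition preim_tower (X Y : Type) (a : X -> Y) (S : seq (set Y)) :=
  [seq a @^-1` Z | Z <- S].

(* $\alpha^{-1}(Q)$ *)
Definition preim_partition (X Y : Type) (a : X -> Y) (Q : towers Y) :
  towers X := [fset preim_tower a S | S in Q]%fset.

Lemma sds_surjP (R : realType) (X Y : sds R) (a : space X -> space Y) :
  continuous a ->
  (forall n Z, cells (preim_partition a (spart Y n)) Z -> Z !=set0) <->
  (forall y, exists x, a x = y).
Proof.
move=> ca; split; last first.
  move=> asurj n _ [_ /imfsetP[S /= SQ ->] /mapP[Z ZS ->]].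
  have [|y Zy] := kr_ne (krs_kr (sds_kr (sdsP Y)) n) (Z := Z); first by exists S.
  by have [x xy] := asurj y; exists x; rewrite /preimage /= xy.
move=> H y.
have [mY _ _ _ _] := sds_em (sdsP Y); have [_ cX _ _ _] := sds_em (sdsP X).
have cl : closed (a @` setT).
  apply: compact_closed; first exact: metrizable_hausdorff mY.
  by apply: continuous_compact => //; exact: continuous_subspaceT.
suff : (a @` setT) y by case=> x _ <-; exists x.
apply: cl => U /(proj2 (krs_basis (sds_kr (sdsP Y))) y)[Z [[n _ [S SQ ZS]] Zy] ZU].
have [|x] := H n (a @^-1` Z).
  exists (preim_tower a S); first by apply/imfsetP; exists S.
  by apply/mapP; exists Z.
by move=> Zx; exists (a x); split; [exists x|exact: ZU].
Qed.

Section PullEdges.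
Variables (R : realType) (X Y : sds R) (a : sds_hom X Y).

Lemma preim_size n (S : spart Y n) : 0 < size (preim_tower a (val S)).
Proof. by rewrite size_map; apply: (kr_size_fset (krs_kr (sds_kr (sdsP Y)) n)). Qed.

Lemma preim_disj n (S S' : spart Y n) :
  nth set0 (preim_tower a (val S)) 0 `&`
  nth set0 (preim_tower a (val S')) 0 !=set0 -> S = S'.
Proof.
have krY := krs_kr (sds_kr (sdsP Y)) n.
rewrite !(nth_map set0) ?(kr_size_fset krY)// => -[x [h h']].
by apply: (kr_disj0 krY); exists (a x).
Qed.

(* $F_n = \{(n,S,T,k) : (\alpha^{-1}(S),T,k) \in E(\alpha^{-1}(Q_n), P_m)\}$ *)
Definition pull_edges n m : edgeset (spart Y n) (spart X m) :=
  tower_edges (t := fun S : spart Y n => preim_tower a (val S))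
    (@preim_size n) (@preim_disj n)
    (@kr_ne_fset _ _ _ _ (krs_kr (sds_kr (sdsP X)) m)).

(* [f] is one of the premorphisms whose class defines $\mathcal{P}(\alpha)$:
   its levels $f_n$ are an admissible choice *)
Definition represents (f : premorphism (Pdiag Y) (Pdiag X)) :=
  forall n,
    [/\ refines (preim_partition a (spart Y n)) (spart X (plev f n)),
        tops (spart X (plev f n)) `<=` tops (preim_partition a (spart Y n)) &
        pedge f n = pull_edges n (plev f n)].
End PullEdges.

Fixpoint cylinder (B : diagram) (n : nat) :
    epath B 0 n -> set (path_space B) :=
  match n with
  | 0 => fun _ => setT
  | m.+1 => fun p => [set x | cylinder (val p).1 x /\ x m = (val p).2]
  end.

HB.instance Definition _ (B : diagram) := gen_eqMixin (path_space B).
HB.instance Definition _ (B : diagram) := gen_choiceMixin (path_space B).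

Section PathTopology.
Variable B : diagram.

Definition path_open (A : set (path_space B)) :=
  forall x, A x -> exists n, exists p : epath B 0 n,
    cylinder p x /\ cylinder p `<=` A.

Lemma cylinderP n (p : epath B 0 n) x z : cylinder p x ->
  cylinder p z <-> forall i, i < n -> z i = x i.
Proof.
elim: n p => [|n IHn] p //= [px xn]; split.
  move=> [pz zn] i; rewrite ltnS leq_eqVlt => /orP[/eqP ->|lt].
    by rewrite zn xn.
  exact: (iffLR (IHn _ px) pz).
move=> h; split; last by rewrite h.
by apply/(IHn _ px) => i lt; apply: h; exact: ltnW.
Qed.

Lemma path_openT : path_open setT.
Proof.
move=> x _; pose v := src _ (x 0).
by exists 0, (exist _ (v, v) (eqxx _) : ediag (vtx B) 0 0).
Qed.

Lemma path_openI : setI_closed path_open.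
Proof.
move=> A A' oA oA' x [/oA[n [p [px pA]]] /oA'[m [q [qx qA']]]].
have [nm|mn] := leqP n m; [exists m, q|exists n, p]; split=> // z h; split;
  [apply: pA|exact: qA'|exact: pA|apply: qA'].
  by apply/(cylinderP z px) => i /leq_trans/(_ nm); exact: (iffLR (cylinderP z qx)).
by apply/(cylinderP z qx) => i /ltn_trans/(_ mn); exact: (iffLR (cylinderP z px)).
Qed.

Lemma path_open_bigU (I : Type) (f : I -> set (path_space B)) :
  (forall i, path_open (f i)) -> path_open (\bigcup_i f i).
Proof.
move=> h x [i _ /h[n [p [px pf]]]]; exists n, p; split=> // z /pf fz.
by exists i.
Qed.

HB.instance Definition _ := isOpenTopological.Build (path_space B)
  path_openT path_openI path_open_bigU.
End PathTopology.

Lemma path_eq (B : diagram) (x y : path_space B) :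
  (forall n, x n = y n) -> x = y.
Proof.
case: x y => [x xP] [y yP] /= h.
have xy : x = y by apply: functional_extensionality_dep.
subst y.
by rewrite (Prop_irrelevance xP yP).
Qed.

Lemma emin_ex (S T : finType) (F : edgeset S T) (P : pred F) (e : F) : P e ->
  exists2 f : F, P f & forall f' : F, P f' -> rng F f' = rng F f -> ele F f f'.
Proof.
move=> Pe; case: (arg_minnP (fun f : F => #|[pred f' : F | ele F f' f]|) Pe).
move=> f Pf fmin; exists f => // f' Pf' rf.
have : ele F f f' || ele F f' f by rewrite ele_cmp rf.
case/orP=> // f'f; have := fmin f' Pf'; case: (eqVneq f f') => [->|ne].
  by rewrite ele_refl.
rewrite leqNgt => /negP[]; apply: proper_card; apply/properP; split.
  by apply/fintype.subsetP => g; rewrite !inE => gf'; exact: ele_trans f'f.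
exists f; rewrite !inE ?ele_refl //; apply: contraNN ne => ff'.
by apply/eqP; apply: (@ele_anti _ _ F); rewrite ff' f'f.
Qed.

Lemma emin_uniq (S T : finType) (F : edgeset S T) (e f : F) :
  emin e -> emin f -> rng F e = rng F f -> e = f.
Proof.
move=> me mf r; have : ele F e f || ele F f e by rewrite ele_cmp r.
by case/orP=> [/mf//|/me->].
Qed.

Lemma min_edge (B : diagram) (wB : is_bratteli B) n (v : vtx B n.+1) :
  exists2 e : dedge B n, rng _ e = v & emin e.
Proof.
have [e ev] := dedge_rng wB v.
have [|f /eqP fv fmin] := @emin_ex _ _ _ (fun f => rng _ f == v) e.
  exact/eqP.
exists f => // f' f'f; apply: (@ele_anti _ _ (dedge B n)); rewrite f'f fmin //.
  by rewrite (ele_rng f'f) fv.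
exact: ele_rng.
Qed.

Lemma min_ext (B : diagram) (wB : is_bratteli B) n (e : dedge B n)
    (x : forall i, dedge B i) :
  exists y : forall i, dedge B i,
    [/\ y n = e, forall i, i < n -> emin (y i),
        forall i, i < n -> rng _ (y i) = src _ (y i.+1) &
        forall i, n < i -> y i = x i].
Proof.
elim: n e x => [|n IHn] e x.
  exists (dfwith x 0 e); split=> //; first exact: dfwithin.
  by move=> i i0; apply: dfwithout; rewrite neq_ltn i0.
have [f fe fmin] := min_edge wB (src _ e).
have [y [yn ymin yp yx]] := IHn f (dfwith x n.+1 e).
have ye : y n.+1 = e by rewrite yx // dfwithin.
exists y; split=> //.
- move=> i; rewrite ltnS leq_eqVlt => /orP[/eqP ->|/ymin//].
  by rewrite yn.
- move=> i; rewrite ltnS leq_eqVlt => /orP[/eqP ->|/yp//].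
  by rewrite yn ye.
- move=> i ni; rewrite yx; last exact: ltnW.
  by apply: dfwithout; rewrite neq_ltn ni.
Qed.

Section Vershik.
Variable B : OBDpo.

Let D : diagram := bdiag (sval B).

Definition xmax : path_space D := sval (cid (proj1 (svalP B))).
Definition xmin : path_space D := sval (cid (proj2 (svalP B))).

Definition vershik_rel (x y : path_space D) :=
  (x = xmax /\ y = xmin) \/
  exists k, [/\ forall i, i < k -> emax (x i), ~ emax (x k),
                esucc (x k) (y k), forall i, i < k -> emin (y i) &
                forall i, k < i -> y i = x i].

Lemma emax_xmax (x : path_space D) : max_path x -> x = xmax.
Proof.
by move=> h; rewrite /xmax; case: cid => y [_ yP] /=; rewrite (yP _ h).
Qed.

Lemma vershik_total (x : path_space D) : exists y, vershik_rel x y.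
Proof.
have [h|] := pselect (max_path x).
  by exists xmin; left; split=> //; exact: emax_xmax.
move=> /existsNP h; have {}h : exists k, `[< ~ emax (x k) >].
  by case: h => k hk; exists k; apply/asboolP.
case: (ex_minnP h) => k /asboolP xk kmin.
have [f fs] : exists f, esucc (x k) f.
  have [e [xe ne]] : exists e, ele _ (x k) e /\ e <> x k.
    by move/existsNP: xk => [e /not_implyP[? ?]]; exists e.
  have [|f fP fmin] := emin_ex (P := fun f => elt (x k) f) (e := e).
    by rewrite /elt xe andbT; apply/eqP => /esym.
  exists f; split=> // f' f'P; apply: fmin => //.
  by rewrite -(ele_rng (proj2 (andP fP))) -(ele_rng (proj2 (andP f'P))).
have [z [zk zmin zpath zx]] := min_ext (bratteliP (sval B)) f (pth x).
have rf : rng _ f = rng _ (x k).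
  by case: fs => /andP[_ /ele_rng ->].
have zP n : rng _ (z n) = src _ (z n.+1).
  have [nk|kn|->] := ltngtP n k; first exact: zpath.
    by rewrite (zx _ kn) (zx n.+1 (ltnW kn)); exact: pthP.
  by rewrite zk rf (zx k.+1 (ltnSn k)); exact: pthP.
exists (PathSpace zP); right; exists k; split=> //=; last by rewrite zk.
by move=> i ik; apply: contrapT => /asboolP/kmin; rewrite leqNgt ik.
Qed.

Lemma vershik_functional (x y z : path_space D) :
  vershik_rel x y -> vershik_rel x z -> y = z.
Proof.
have xmaxP : max_path xmax by rewrite /xmax; case: cid => ? [].
case=> [[xE ->]|[k [k1 k2 k3 k4 k5]]] [[xE' ->]|[l [l1 l2 l3 l4 l5]]].
- by [].
- by case: l2; rewrite xE; exact: xmaxP.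
- by case: k2; rewrite xE'; exact: xmaxP.
have kl : k = l.
  have [kl|lk|//] := ltngtP k l; first by case: k2; exact: l1.
  by case: l2; exact: k1.
subst l; apply: path_eq => n.
have yzk : y k = z k.
  case: k3 l3 => h1 h1' [h2 h2']; apply: (@ele_anti _ _ (dedge D k)).
  by rewrite h1' // h2'.
have [nk|kn|->//] := ltngtP n k; last by rewrite k5 // l5.
have H m : m <= k -> y (k - m) = z (k - m).
  elim: m => [|m IHm] mk; first by rewrite subn0.
  have IH := IHm (ltnW mk).
  have lt : k - m.+1 < k by rewrite ltn_subrL /= (leq_trans _ mk).
  apply: emin_uniq; [exact: k4|exact: l4|].
  rewrite !pthP; have -> : (k - m.+1).+1 = k - m by rewrite -subSn // subSS.
  by rewrite IH.
by have := H (k - n) (leq_subr _ _); rewrite subKn // ltnW.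
Qed.

Definition vershik (x : path_space D) : path_space D :=
  sval (cid (vershik_total x)).

(* the towers of the n-th partition: $T_v$ for v a vertex of level n *)
Definition vtower n (v : vtx D n) : seq (set (path_space D)) :=
  [seq cylinder p | p <- sort (ele (epath D 0 n))
                           [seq p <- enum (epath D 0 n) | rng _ p == v]].

Definition vpart n : towers (path_space D) :=
  [fset vtower v | v in vtx D n]%fset.
End Vershik.

(* $\mathcal{V}(B) = (X_B, \lambda_B, x_{\max}, \mathcal{R}_B)$ *)
Definition Vsys (B : OBDpo) : system :=
  @System (path_space (bdiag (sval B))) (@vershik B) (xmax B) (@vpart B).

Record is_obdpo (B : diagram) : Prop := IsObdpo {
  obdpo_bratteli : is_bratteli B;
  obdpo_po : properly_ordered B
}.

Definition Pobj (R : realType)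
    (wP : forall X : SDS R, is_obdpo (Pdiag X)) (X : SDS R) : OBDpo :=
  exist (fun B : OBD => properly_ordered (B : bratteli))
    (Bratteli (obdpo_bratteli (wP X))) (obdpo_po (wP X)).

Definition Vobj (R : realType)
    (wV : forall B : OBDpo, is_sds R (Vsys B)) (B : OBDpo) : SDS R :=
  Sds (wV B).

(* [f] is the premorphism $f_B$: level n goes to level n, by exactly one edge
   from v to $T_v$ for each vertex v *)
Definition is_tau (R : realType) (B : OBDpo) (wB : is_sds R (Vsys B))
    (f : premorphism (bdiag (sval B)) (Pdiag (Sds wB))) :=
  forall n,
    [/\ plev f n = n,
        bijective (src (pedge f n)) &
        forall e : pedge f n,
          val (rng (pedge f n) e : spart (Vsys B) (plev f n)) =
          vtower (src (pedge f n) e)].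

(* Main.v *)
From mathcomp Require Import all_boot all_order all_algebra finmap.
From mathcomp Require Import all_classical reals topology.
Require Import Defs.

(** A tower is a finite sequence of sets; read from bottom to top it is an
    interval of an orbit. An ordered edge set [F] between two finite families
    [t] and [u] of towers _stacks_ [t] into [u] when each tower of [u] is, in
    the order of the fibre of [F] over it, the concatenation of (refinements of)
    the towers of [t] at the sources of its edges. Both the position at which
    an edge [e] starts and the height of a tower of [u] are then forced: they
    are the sum of the heights of the sources of the edges below [e]
    ([offset]), respectively of all the edges of the fibre ([height]). Three
    facts make stacking behave like a functor: stacked edge sets compose
    ([stacks_comp]), pull back along maps ([stacks_preim]), and are determined
    up to isomorphism by the two families ([stacks_uniq]).

    A _model_ of a diagram [D] on a system [X] names the towers of the n-th
    partition of [X] by the n-th vertices of [D], in such a way that the edge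
    sets of [D] stack each level into the next. Every system is a model of its
    own diagram ([taut_model]), and every properly ordered diagram has a model
    on its path space ([can_model]): the n-th towers list the cylinders of
    length n by range, and the offset of a path is its rank.

    Let [X] carry a model of [B] and [Y] a model of [C]. A factor map
    [alpha : X -> Y] induces a premorphism [f : C -> B] when the n-th edge set
    of [f] stacks the inverse images of the n-th towers of [Y] into the towers
    of level [plev f n] of [X]. By compactness every [alpha] admits levels at
    which the towers of [X] are fine enough ([pull_levels]); any two induced
    premorphisms are equivalent ([induces_equiv]); equivalent premorphisms come
    from equal maps, as the cells of [Y] separate its points ([induces_inj]).
    Conversely, a premorphism [f] tells, for each point [x] and each level [n],
    in which floor of which n-th tower of [Y] the image of [x] should lie; the
    commutation isomorphisms of [f] preserve offsets, so these floors are nested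
    and, again by compactness, meet in a single point ([induces_surj]).

    Hence factor maps [X -> Y] correspond bijectively to morphisms [C -> B],
    compatibly with identities and compositions. The functor P is this
    correspondence for the models of systems on their own diagrams, V its
    inverse for the models on path spaces; the components of tau and sigma
    correspond to an identity map and to an identity morphism, between two
    different models. Every clause of the theorem then follows by comparing two
    composites under the correspondence.

    That path spaces are systems, and that diagrams of systems are properly
    ordered, uses only the towers: see [towers_homeo], [towers_minimal] and
    [extremal_path]. *)

Set Implicit Arguments.
Unset Strict Implicit.
Unset Printing Implicit Defensive.

Import Order.TTheory GRing.Theory Num.Theory.

Local Open Scope classical_set_scope.

(** * Heights and offsets in ordered edge sets *)

Section Heights.
Variables (S T : finType) (F : edgeset S T) (h : S -> nat).
Implicit Types (e : F) (b : T).

(** The total height of the edges with range [b], each of them as high as its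
    source under [h]. *)
Definition height b := \sum_(e : F | rng F e == b) h (src F e).

(** The total height of the edges below [e] in its fibre: the position at which
    [e] starts when the fibre is stacked up in its order. *)
Definition offset e := \sum_(e' : F | elt e' e) h (src F e').

Lemma elt_rng e e' : elt e e' -> rng F e = rng F e'.
Proof. by case/andP=> _ /ele_rng. Qed.

Lemma elt_ele_trans (x y z : F) : elt x y -> ele F y z -> elt x z.
Proof.
case/andP=> xy lxy lyz; rewrite /elt (ele_trans lxy lyz) andbT.
apply: contraNneq xy => xz; subst z.
by apply/eqP; apply: (@ele_anti _ _ F); rewrite lxy lyz.
Qed.

Lemma ele_elt_trans (x y z : F) : ele F x y -> elt y z -> elt x z.
Proof.
move=> lxy /andP[yz lyz]; rewrite /elt (ele_trans lxy lyz) andbT.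
apply: contraNneq yz => xz; subst z.
by apply/eqP; apply: (@ele_anti _ _ F); rewrite lxy lyz.
Qed.

Lemma ele_eqVelt e e' : ele F e e' = (e == e') || elt e e'.
Proof. by rewrite /elt; case: eqVneq => //= ->; rewrite ele_refl. Qed.

Lemma nele_elt e e' : rng F e = rng F e' -> ele F e e' = false -> elt e' e.
Proof.
move=> r n; have := ele_cmp e e'; rewrite r eqxx n /= ele_eqVelt.
by case/orP=> [/eqP ee'|//]; move: n; rewrite ee' ele_refl.
Qed.

Lemma offsetE e : \sum_(e' : F | ele F e' e) h (src F e') =
  offset e + h (src F e).
Proof.
rewrite (bigD1 e) ?ele_refl //= addnC; congr (_ + _).
by apply: eq_bigl => e'; rewrite /elt andbC.
Qed.

Lemma leq_sum_pred (P Q : pred F) (f : F -> nat) : (forall e, P e -> Q e) ->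
  \sum_(e | P e) f e <= \sum_(e | Q e) f e.
Proof.
move=> PQ; rewrite [leqRHS](bigID P) /= -[leqLHS]addn0; apply: leq_add => //.
rewrite leq_eqVlt; apply/orP; left; apply/eqP; apply: eq_bigl => e.
by case: (boolP (P e)) => [/PQ ->//|]; rewrite andbF.
Qed.

Lemma offset_lt e e' : elt e e' -> offset e + h (src F e) <= offset e'.
Proof.
move=> ee'; rewrite -offsetE; apply: leq_sum_pred => x xe.
exact: ele_elt_trans ee'.
Qed.

Lemma offset_height e : offset e + h (src F e) <= height (rng F e).
Proof.
by rewrite -offsetE; apply: leq_sum_pred => x /ele_rng ->.
Qed.

Lemma offset_emax e : emax e -> offset e + h (src F e) = height (rng F e).
Proof.
move=> me; rewrite -offsetE; apply: eq_bigl => x.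
apply/idP/eqP => [/ele_rng//|r].
by have := ele_cmp e x; rewrite r eqxx => /orP[/me ->|//]; rewrite ele_refl.
Qed.

Lemma offset_emin e : emin e -> offset e = 0.
Proof.
move=> me; rewrite /offset big_pred0 // => x; apply/negbTE/negP => /andP[xe].
by move/me/eqP; rewrite (negbTE xe).
Qed.

Hypothesis h_gt0 : forall a, 0 < h a.

Lemma emax_offset e : offset e + h (src F e) = height (rng F e) -> emax e.
Proof.
move=> oe x ex; apply/eqP; apply/negPn/negP => ne.
have xe : elt e x by rewrite /elt eq_sym ne.
have := offset_height x; rewrite -(elt_rng xe) -oe leqNgt => /negP[].
apply: leq_ltn_trans (offset_lt xe) _.
by rewrite -[ltnLHS]addn0 ltn_add2l.
Qed.

Lemma emin_offset e : offset e = 0 -> emin e.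
Proof.
move=> oe x xe; apply/eqP; apply/negPn/negP => ne.
have ex : elt x e by rewrite /elt ne.
have := offset_lt ex; rewrite oe leqn0 addn_eq0.
by have := h_gt0 (src F x); case: (h _) => // k _; rewrite andbF.
Qed.

(** The intervals of length [h (src F e)] starting at [offset e], for [e] in a
    fibre over [b], tile the integers below [height b]: they are disjoint here,
    and cover in [offset_ex]. *)
Lemma offset_uniq e e' i i' : rng F e = rng F e' ->
  i < h (src F e) -> i' < h (src F e') ->
  offset e + i = offset e' + i' -> e = e' /\ i = i'.
Proof.
have aux x y k k' : elt x y -> k < h (src F x) ->
    offset x + k = offset y + k' -> False.
  move=> xy kx E; have := offset_lt xy; rewrite leqNgt => /negP[].
  apply: leq_ltn_trans (leq_addr k' _) _.
  by rewrite -E ltn_add2l.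
move=> r ie ie' E; have [ee'|ne] := eqVneq e e'.
  by subst e'; split=> //; move/addnI: E.
exfalso; have := ele_cmp e e'; rewrite r eqxx => /orP[] l.
  by apply: (aux e e' i i') => //; rewrite /elt ne.
by apply: (aux e' e i' i) => //; rewrite /elt eq_sym ne.
Qed.

Lemma offset_ex b k : k < height b ->
  exists e i, [/\ rng F e = b, i < h (src F e) & k = offset e + i].
Proof.
elim: k => [|k IHk] kb.
  have [e0 /eqP r0|n] := pickP [pred e : F | rng F e == b]; last first.
    by move: kb; rewrite /height big_pred0.
  have [|e /eqP re emin] := @emin_ex _ _ F (fun e => rng F e == b) e0.
    by rewrite r0.
  exists e, 0; split=> //; rewrite addn0 offset_emin // => x xe.
  apply: (@ele_anti _ _ F); rewrite xe emin //.
    by rewrite (ele_rng xe) re.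
  exact: ele_rng.
have [e [i [re ie kE]]] := IHk (ltnW kb).
have [ie'|] := ltnP i.+1 (h (src F e)).
  by exists e, i.+1; split=> //; rewrite addnS -kE.
move=> hi; have ih : h (src F e) = i.+1 by apply/eqP; rewrite eqn_leq hi.
have kE' : k.+1 = offset e + h (src F e) by rewrite ih addnS -kE.
have [x0 /andP[/eqP r0 n0]|n] :=
    pickP [pred x : F | (rng F x == b) && ~~ ele F x e]; last first.
  move: kb; rewrite kE' -re offset_emax ?ltnn // => x ex.
  have := n x; rewrite /= -(ele_rng ex) re eqxx /= => /negbT/negPn xe.
  by apply: (@ele_anti _ _ F); rewrite ex xe.
(* The block of [e] ends at [k], so [k.+1] is the start of the edge that
   follows [e], the least one not below [e]. *)
have [|x /andP[/eqP rx nx] xmin] := @emin_ex _ _ F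
    (fun x => (rng F x == b) && ~~ ele F x e) x0.
  by rewrite r0 eqxx.
have xe : elt e x by apply: nele_elt; [rewrite rx re|exact: negbTE].
exists x, 0; split=> //; rewrite addn0 kE' -offsetE; apply: eq_bigl => y.
apply/idP/idP => [ye|yx]; first exact: ele_elt_trans xe.
apply/negPn/negP => ny.
have ry : rng F y = b by rewrite (elt_rng yx).
have xy : ele F x y by apply: xmin; rewrite ?ry ?eqxx // rx.
by have := elt_ele_trans yx xy; rewrite /elt eqxx.
Qed.

Lemma height_gt0 b : 0 < height b <-> exists e, rng F e = b.
Proof.
split=> [/offset_ex[e [i [re _ _]]]|[e <-]]; first by exists e.
by apply: leq_trans (offset_height e); rewrite addn_gt0 h_gt0 orbT.
Qed.

(** If the intervals of length [h (src F e)] starting at [p e], for [e] in [P],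
    tile the integers below [N], their lengths add up to [N]. Applied to the
    edges below a given one this identifies [p] with [offset], and applied to a
    fibre it computes [height]. *)
Lemma tiling_sum (P : pred F) (p : F -> nat) N :
  (forall e, P e -> p e + h (src F e) <= N) ->
  (forall k, k < N -> exists2 e, P e & p e <= k < p e + h (src F e)) ->
  (forall e e' k, P e -> P e' -> p e <= k < p e + h (src F e) ->
     p e' <= k < p e' + h (src F e') -> e = e') ->
  \sum_(e | P e) h (src F e) = N.
Proof.
move=> PN Pc Pd.
have /choice[g gP] (k : 'I_N) : exists e, P e /\ p e <= k < p e + h (src F e).
  by have [e] := Pc k (ltn_ord k); exists e.
rewrite -[RHS]card_ord -sum1_card (partition_big g P) /=; last first.
  by move=> k _; have [] := gP k.
apply: eq_bigr => e Pe.
transitivity (\sum_(k < N | p e <= k < p e + h (src F e)) 1); last first.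
  apply: eq_bigl => k; have [Pg gk] := gP k; apply/idP/eqP => [|<-//] ek.
  exact: Pd gk ek.
rewrite -(big_mkord (fun k => p e <= k < p e + h (src F e)) (fun=> 1)).
have Ph := PN e Pe.
rewrite (big_cat_nat (n := p e)) //=; last exact: leq_trans (leq_addr _ _) Ph.
rewrite big_nat_cond big_pred0 ?add0n; last first.
  by move=> k; rewrite ltnNge /=; case: (p e <= k).
rewrite (big_cat_nat (n := p e + h (src F e))) ?leq_addr //= addnC.
rewrite big_nat_cond big_pred0 ?add0n; last first.
  move=> k; apply/negbTE/negP => /andP[/andP[lk _] /andP[_ kl]].
  by move: kl; rewrite ltnNge lk.
rewrite big_nat_cond (eq_bigl (fun k => (p e <= k < p e + h (src F e)) && true)).
  by rewrite -big_nat_cond sum_nat_const_nat muln1 addKn.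
by move=> k; rewrite andbb andbT.
Qed.
End Heights.

Lemma height_eq (S T : finType) (F : edgeset S T) (h k : S -> nat) :
  h =1 k -> height F h =1 height F k.
Proof. by move=> hk b; apply: eq_bigr => e _; rewrite hk. Qed.

Lemma offset_eq (S T : finType) (F : edgeset S T) (h k : S -> nat) :
  h =1 k -> offset (F := F) h =1 offset k.
Proof. by move=> hk b; apply: eq_bigr => e _; rewrite hk. Qed.

Section Isomorphism.
Variables (S T : finType) (F G : edgeset S T) (g : F -> G) (h : S -> nat).
Hypotheses (gb : bijective g) (gs : forall e, src G (g e) = src F e)
  (gr : forall e, rng G (g e) = rng F e)
  (gl : forall e e', ele G (g e) (g e') = ele F e e').

Lemma height_iso : height G h =1 height F h.
Proof.
move=> b; rewrite /height (reindex g); last exact: onW_bij.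
by apply: eq_big => [e|e _]; rewrite ?gr ?gs.
Qed.

Lemma offset_iso e : offset h (g e) = offset h e.
Proof.
rewrite /offset (reindex g); last exact: onW_bij.
apply: eq_big => [x|x _]; last by rewrite gs.
by rewrite /elt gl (bij_eq gb).
Qed.
End Isomorphism.

Section Composition.
Variables (S T U : finType) (F : edgeset S T) (G : edgeset T U) (h : S -> nat).

Lemma big_ecomp (Q : pred (F * G)) (f : F * G -> nat) :
  \sum_(p : F \;e G | Q (val p)) f (val p) =
  \sum_(g : G) \sum_(e : F | (rng F e == src G g) && Q (e, g)) f (e, g).
Proof.
pose A := [pred p : F * G | rng F p.1 == src G p.2].
transitivity (\sum_(p : F * G | A p && Q p) f p).
  pose s : F \;e G -> F * G := val.
  rewrite (reindex_omap s (insub : F * G -> option (F \;e G))) /=.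
    apply: eq_big => [p|p _] //.
    by rewrite /s (valP p) /= valK eqxx andbT.
  by move=> p /andP[Ap _]; rewrite /s insubT.
rewrite (eq_bigr (fun p => f (p.1, p.2))); last by case.
rewrite (eq_bigl (fun p => predT p.1 &&
  ((rng F p.1 == src G p.2) && Q (p.1, p.2)))); last by case.
rewrite -(pair_big_dep predT
  (fun e g => (rng F e == src G g) && Q (e, g)) (fun e g => f (e, g))) /=.
by rewrite (exchange_big_dep predT).
Qed.

Lemma height_comp : height (F \;e G) h =1 height G (height F h).
Proof.
move=> c; rewrite /height.
rewrite (big_ecomp (fun p => rng G p.2 == c) (fun p => h (src F p.1))) /=.
rewrite [RHS]big_mkcond; apply: eq_bigr => g _; case: eqP => _.
  by apply: eq_bigl => e; rewrite andbT.
by rewrite big_pred0 // => e; rewrite andbF.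
Qed.

(** The order of a composition compares second components first, so an edge
    [(e, g)] starts at position [offset e] inside the block of [g]. *)
Lemma offset_comp (p : F \;e G) :
  offset h p = offset (height F h) (val p).2 + offset h (val p).1.
Proof.
case: p => [[e g] /= eg]; rewrite /offset /=.
rewrite (eq_bigl (fun q : F \;e G => elt (val q).2 g ||
   ((val q).2 == g) && elt (val q).1 e)); last first.
  move=> [[e' g'] eg'] /=; rewrite {1}/elt /= /ecomp_ele /elt -val_eqE /=.
  rewrite xpair_eqE.
  by case: (eqVneq g' g) => //= _; rewrite ?andbF ?andbT.
rewrite (big_ecomp (fun p => elt p.2 g || (p.2 == g) && elt p.1 e)
  (fun p => h (src F p.1))) /=.
rewrite (bigD1 g) //= addnC; congr (_ + _); last first.
  apply: eq_bigl => x; rewrite {1}/elt !eqxx /=.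
  case: (boolP (elt x e)) => [xe|]; last by rewrite andbF.
  by rewrite (elt_rng xe) eg.
rewrite big_mkcond [RHS]big_mkcond; apply: eq_bigr => x _.
case: eqP => [->|/eqP nx] /=; first by rewrite /elt eqxx.
case: (boolP (elt x g)) => xg; last first.
  by rewrite big_pred0 // => y; rewrite andbF.
by apply: eq_bigl => y; rewrite andbT.
Qed.
End Composition.

Section Diagonal.
Variables (V : nat -> finType) (k : nat) (h : V k -> nat).

Lemma ediagE (p : ediag V k k) : (val p).1 = (val p).2.
Proof.
by apply: (@eq_from_Tagged _ (fun n => V n : eqType)); exact/eqP/(valP p).
Qed.

Lemma offset_diag (p : ediag V k k) : offset h p = 0.
Proof.
rewrite /offset big_pred0 // => q; rewrite /elt /= /ediag_ele.
by case: eqP.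
Qed.

Lemma height_diag : height (ediag V k k) h =1 h.
Proof.
move=> v; rewrite /height.
pose d : ediag V k k := exist _ (v, v) (eqxx _).
rewrite (big_pred1 d) // => p /=; apply/eqP/eqP => [pv|->//].
apply: val_inj; rewrite /= -{2}pv [LHS]surjective_pairing; congr pair.
by rewrite ediagE pv.
Qed.
End Diagonal.

(** * Towers and the edge sets that stack them *)

Section Towers.
Variable X : Type.

(** The point [x] lies on floor [i] of the tower with name [a]. *)
Definition located (A : finType) (t : A -> seq (set X)) x a i :=
  i < size (t a) /\ nth set0 (t a) i x.

(** The floors of the towers [t a] are non-empty and partition [X]. Distinct
    names denote disjoint towers. *)
Record tower_partition (A : finType) (t : A -> seq (set X)) : Prop :=
  TowerPartition {
  tp_size : forall a, 0 < size (t a);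
  tp_ne : forall a i, i < size (t a) -> exists x, located t x a i;
  tp_cover : forall x, exists a i, located t x a i;
  tp_uniq : forall x a b i j, located t x a i -> located t x b j ->
    a = b /\ i = j
}.

(** The edge set [F] stacks the towers [t] into the towers [u]: each [u b] is as
    high as the fibre over [b], and the block of [u b] that starts at
    [offset e] is contained, floor by floor, in the tower [t (src F e)]. *)
Definition stacks (A B : finType) (t : A -> seq (set X)) (F : edgeset A B)
    (u : B -> seq (set X)) :=
  (forall b, size (u b) = height F (fun a => size (t a)) b) /\
  forall (e : F) i, i < size (t (src F e)) ->
    nth set0 (u (rng F e)) (offset (fun a => size (t a)) e + i) `<=`
    nth set0 (t (src F e)) i.

Section Stacks.
Variables (A B : finType) (t : A -> seq (set X)) (u : B -> seq (set X)).
Variables (F : edgeset A B).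
Hypothesis tFu : stacks t F u.

Lemma stacks_located x b k : (forall a, 0 < size (t a)) -> located u x b k ->
  exists e i, [/\ rng F e = b, k = offset (fun a => size (t a)) e + i &
    located t x (src F e) i].
Proof.
move=> t0 [kb xk]; move: (kb); rewrite (proj1 tFu) => kb'.
have [e [i [re ie kE]]] := offset_ex t0 kb'.
exists e, i; split=> //; split=> //.
by apply: (proj2 tFu) => //; rewrite -kE re.
Qed.

Lemma stacks_offset (e : F) i : i < size (t (src F e)) ->
  offset (fun a => size (t a)) e + i < size (u (rng F e)).
Proof.
move=> ie; rewrite (proj1 tFu); apply: leq_trans (offset_height _ e).
by rewrite ltn_add2l.
Qed.

Lemma stacks_rng b : (forall a, 0 < size (t a)) -> (forall b, 0 < size (u b)) ->
  exists e, rng F e = b.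
Proof.
by move=> t0 u0; apply/(@height_gt0 _ _ F _ t0); rewrite -(proj1 tFu).
Qed.

Lemma stacks_src a : tower_partition t -> tower_partition u ->
  exists e, src F e = a.
Proof.
move=> tt tu; have [x xa] := tp_ne tt (tp_size tt a).
have [b [k xb]] := tp_cover tu x.
have [e [i [_ _ xe]]] := stacks_located (tp_size tt) xb.
by exists e; have [] := tp_uniq tt xe xa.
Qed.
End Stacks.

Lemma stacks_comp (A B C : finType) t u v (F : edgeset A B) (G : edgeset B C) :
  stacks t F u -> stacks u G v -> stacks t (F \;e G) v.
Proof.
move=> [su iu] [sv iv]; split=> [c|p i ip].
  by rewrite height_comp sv; apply: height_eq.
rewrite offset_comp -(offset_eq su) -addnA.
move=> x /iv; rewrite -(eqP (valP p)) => /(_ _)/iu; apply => //.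
rewrite su; apply: leq_trans (offset_height _ _).
by rewrite ltn_add2l.
Qed.

Lemma stacks_iso (A B : finType) t u (F G : edgeset A B) :
  eiso F G -> stacks t F u -> stacks t G u.
Proof.
move=> [g [gb gs gr gl]] [su iu]; split=> [b|e i].
  by rewrite su (height_iso _ gb gs gr).
have [g' gK g'K] := gb; rewrite -(g'K e) gs gr (offset_iso _ gb gs gl).
exact: iu.
Qed.

Lemma stacks_diag (V : nat -> finType) k (t : V k -> seq (set X)) :
  stacks t (ediag V k k) t.
Proof.
split=> [v|p i ip]; first by rewrite height_diag.
by rewrite offset_diag /= ediagE.
Qed.

Lemma stacks_bij (A B : finType) t u (F : edgeset A B) :
  bijective (src F) -> bijective (rng F) ->
  (forall e, u (rng F e) = t (src F e)) -> stacks t F u.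
Proof.
move=> sb rb ut; have [r' rK r'K] := rb; split=> [b|e i ie].
  rewrite /height (big_pred1 (r' b)) -?ut ?r'K // => e /=.
  by rewrite -{1}(r'K b) (bij_eq rb).
rewrite /offset big_pred0 ?ut // => e'; apply/negbTE/negP => ee'.
by have := bij_inj rb (elt_rng ee') => E; move: ee'; rewrite E /elt eqxx.
Qed.

(** Two families of towers determine the edge set that stacks one into the
    other: an edge is recovered from its range and offset, and the floor of
    [u] at that offset lies on the bottom floor of a single tower of [t]. *)
Lemma stacks_uniq (A B : finType) t u (F G : edgeset A B) :
  tower_partition t -> tower_partition u ->
  stacks t F u -> stacks t G u -> eiso F G.
Proof.
move=> tt tu; set h := fun a => size (t a).
have aux (F' G' : edgeset A B) : stacks t F' u -> stacks t G' u ->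
    exists g : F' -> G', forall e, [/\ src G' (g e) = src F' e,
      rng G' (g e) = rng F' e & offset h (g e) = offset h e].
  move=> sF sG.
  have /choice[g gP] : forall e : F', exists e' : G', [/\ src G' e' = src F' e,
      rng G' e' = rng F' e & offset h e' = offset h e].
    move=> e; have lt := stacks_offset sF (tp_size tt (src F' e)).
    have [x xe] := tp_ne tu lt.
    have [e' [i [r oE xi]]] := stacks_located sG (tp_size tt) xe.
    have xe0 : located t x (src F' e) 0.
      split; first exact: tp_size.
      by apply: (proj2 sF); [exact: tp_size|exact: (proj2 xe)].
    have [s i0] := tp_uniq tt xi xe0; subst i.
    by exists e'; split=> //; move: oE; rewrite !addn0.
  by exists g.
move=> sF sG; have [g gP] := aux _ _ sF sG; have [g' g'P] := aux _ _ sG sF.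
have inj (F' : edgeset A B) (e e' : F') : rng F' e = rng F' e' ->
    offset h e = offset h e' -> e = e'.
  move=> r o; have [] // := @offset_uniq _ _ F' h e e' 0 0 r.
  - exact: tp_size.
  - exact: tp_size.
  - by rewrite o.
apply: (@eiso_mono _ _ _ _ g).
- exists g' => e; apply: inj.
  + by have [_ -> _] := g'P (g e); have [] := gP e.
  + by have [_ _ ->] := g'P (g e); have [] := gP e.
  + by have [_ -> _] := gP (g' e); have [] := g'P e.
  + by have [_ _ ->] := gP (g' e); have [] := g'P e.
- by move=> e; have [] := gP e.
- by move=> e; have [] := gP e.
move=> e e' ee'; have [_ r o] := gP e; have [_ r' o'] := gP e'.
apply/negPn/negP => /negbTE ne.
have lt : elt (g e') (g e) by apply: nele_elt; rewrite // r r' (ele_rng ee').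
have := offset_lt h lt; rewrite o o' leqNgt => /negP[].
have ee : offset h e <= offset h e'.
  move: ee'; rewrite ele_eqVelt => /orP[/eqP ->//|/(offset_lt h)].
  by apply: leq_trans; exact: leq_addr.
apply: leq_ltn_trans ee _; rewrite -[ltnLHS]addn0 ltn_add2l.
exact: tp_size.
Qed.

Lemma stacks_epath (D : diagram) (t : forall n, vtx D n -> seq (set X)) :
  (forall n, stacks (t n) (dedge D n) (t n.+1)) ->
  forall k l, k <= l -> stacks (t k) (epath D k l) (t l).
Proof.
move=> tD k; elim=> [|l IHl].
  by rewrite leqn0 => /eqP k0; subst k; rewrite epath_diag; exact: stacks_diag.
rewrite leq_eqVlt => /orP[/eqP e|].
  by subst k; rewrite epath_diag; exact: stacks_diag.
by rewrite ltnS => kl; rewrite epathS //; exact: stacks_comp (IHl kl) _.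
Qed.

Section TowerEdgesStack.
Variables (A : finType) (t : A -> seq (set X)) (Q : towers X).
Hypothesis t_size : forall S, 0 < size (t S).
Hypothesis t_disj : forall S S',
  nth set0 (t S) 0 `&` nth set0 (t S') 0 !=set0 -> S = S'.
Hypothesis Q_ne : forall T : Q, forall Y, Y \in val T -> Y !=set0.
Hypothesis t_uniq : forall x a b i j, located t x a i -> located t x b j ->
  a = b /\ i = j.
Hypothesis tiled : forall (T : Q) k, k < size (val T) -> exists a i,
  [/\ i <= k, i < size (t a) & occurs (t a) (val T) (k - i)].

Let F := tower_edges t_size t_disj Q_ne.
Let h a := size (t a).

Lemma tower_edgeP (e : F) :
  occurs (t (src F e)) (val (rng F e)) (tower_pos e).
Proof. exact/asboolP/(valP e). Qed.

(** The edge set made of all occurrences of towers of [t] in towers of [Q] stacks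
    [t] into [Q] as soon as each floor of [Q] belongs to an occurrence. *)
Lemma tower_edges_stack : stacks t F (fun T : Q => val T).
Proof.
have dj (e e' : F) k : rng F e = rng F e' ->
    tower_pos e <= k < tower_pos e + h (src F e) ->
    tower_pos e' <= k < tower_pos e' + h (src F e') -> e = e'.
  move=> r /andP[ek ke] /andP[e'k ke'].
  have [s o] := tower_edgeP e; have [s' o'] := tower_edgeP e'.
  have kT : k < size (val (rng F e)) by exact: leq_trans s.
  have [x xk] := Q_ne (mem_nth set0 kT).
  have l : located t x (src F e) (k - tower_pos e).
    have lt : k - tower_pos e < size (t (src F e)) by rewrite ltn_subLR.
    by split=> //; apply: (o _ lt); rewrite subnKC.
  have l' : located t x (src F e') (k - tower_pos e').
    have lt : k - tower_pos e' < size (t (src F e')) by rewrite ltn_subLR.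
    by split=> //; apply: (o' _ lt); rewrite subnKC // -r.
  have [_ ee'] := t_uniq l l'.
  have pp : tower_pos e = tower_pos e' by rewrite -(subKn ek) -(subKn e'k) ee'.
  apply: (@ele_anti _ _ F); apply/andP; split.
    by rewrite /= /tower_ele -[tower_rng e]/(rng F e) r pp eqxx /=.
  by rewrite /= /tower_ele -[tower_rng e]/(rng F e) r pp eqxx /=.
have cv (T : Q) k : k < size (val T) -> exists2 e : F, rng F e = T &
    tower_pos e <= k < tower_pos e + h (src F e).
  move=> kT; have [a [i [ik ia o]]] := tiled kT.
  have lt : k - i < size (val T) by apply: leq_ltn_trans kT; exact: leq_subr.
  pose e0 : A * {T : Q & 'I_(size (val T))} := (a, Tagged _ (Ordinal lt)).
  have e0P : `[< occurs (t e0.1) (val (tag e0.2)) (tagged e0.2) >].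
    exact/asboolP.
  exists (exist _ e0 e0P : F) => //.
  by rewrite /tower_pos /= leq_subr /h /= -{1}(subnK ik) ltn_add2l.
have lt (e e' : F) : elt e e' -> tower_pos e + h (src F e) <= tower_pos e'.
  move=> ee'; rewrite leqNgt; apply/negP => lt.
  case/andP: (ee') => ne /andP[_ le].
  have E : e = e'.
    apply: (dj _ _ (tower_pos e') (elt_rng ee')); first by rewrite le lt.
    by rewrite leqnn /= -[ltnLHS]addn0 ltn_add2l t_size.
  by move: ne; rewrite E eqxx.
have oE (e : F) : offset h e = tower_pos e.
  apply: (@tiling_sum _ _ F h _ (@tower_pos _ _ _ _)) => [e'|k ke|e1 e2 k l1 l2].
  - exact: lt.
  - have [|e' r] := cv (rng F e) k.
      by apply: leq_trans ke _; have [s _] := tower_edgeP e;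
        apply: leq_trans s; exact: leq_addr.
    move=> /andP[e'k ke']; exists e'; last by rewrite e'k.
    have lt' : tower_pos e' < tower_pos e by exact: leq_ltn_trans ke.
    apply/andP; split.
      by apply/negP => /eqP E; rewrite E ltnn in lt'.
    rewrite /= /tower_ele -[tower_rng e']/(rng F e') r eqxx /=; exact: ltnW.
  - by apply: dj; rewrite (elt_rng l1) (elt_rng l2).
split=> [T|e i ie].
  apply/esym/(@tiling_sum _ _ F h _ (@tower_pos _ _ _ _)).
  - by move=> e /eqP <-; have [] := tower_edgeP e.
  - by move=> k /cv[e r ke]; exists e => //; rewrite r.
  - by move=> e1 e2 k /eqP r1 /eqP r2; apply: dj; rewrite r1 r2.
by rewrite oE; have [_] := tower_edgeP e; exact.
Qed.
End TowerEdgesStack.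
End Towers.

Lemma nth_preim (X Y : Type) (f : X -> Y) S i :
  nth set0 (preim_tower f S) i = f @^-1` nth set0 S i.
Proof.
have [lt|le] := ltnP i (size S); first by rewrite (nth_map set0).
by rewrite !nth_default ?size_map // preimage_set0.
Qed.

Lemma located_preim (X Y : Type) (f : X -> Y) (A : finType)
    (t : A -> seq (set Y)) x a i :
  located (fun a => preim_tower f (t a)) x a i = located t (f x) a i.
Proof. by rewrite /located size_map nth_preim. Qed.

Lemma stacks_preim (X Y : Type) (f : X -> Y) (A B : finType)
    (t : A -> seq (set Y)) (u : B -> seq (set Y)) (F : edgeset A B) :
  stacks t F u ->
  stacks (fun a => preim_tower f (t a)) F (fun b => preim_tower f (u b)).
Proof.
move=> [su iu].
have E : (fun a => size (preim_tower f (t a))) =1 (fun a => size (t a)).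
  by move=> a; rewrite size_map.
split=> [b|e i]; first by rewrite size_map su (height_eq _ E).
by rewrite size_map (offset_eq E) !nth_preim => /iu s x; exact: s.
Qed.

(** * Clopen towers climbed by a map *)

(** Cantor's intersection theorem. *)
Lemma compact_nested (X : topologicalType) (C : nat -> set X) :
  compact [set: X] -> (forall n, closed (C n)) ->
  (forall n, C n.+1 `<=` C n) -> (forall n, C n !=set0) ->
  exists x, forall n, C n x.
Proof.
move=> cX cC dC /choice[f fC].
have dC' n m : n <= m -> C m `<=` C n.
  elim: m => [|m IHm]; first by rewrite leqn0 => /eqP ->.
  by rewrite leq_eqVlt => /orP[/eqP ->//|]; rewrite ltnS => /IHm h x /dC/h.
have [x [_ xf]] := cX (f @ \oo) _ (@filterT _ _ _).
exists x => n; apply: cC => U xU; apply: (xf (C n) U) => //.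
by exists n => // m /= nm; exact: dC' (fC m).
Qed.

Lemma nested_empty (X : topologicalType) (C : nat -> set X) :
  compact [set: X] -> (forall n, closed (C n)) ->
  (forall n, C n.+1 `<=` C n) -> ~ (exists x, forall n, C n x) ->
  exists N, forall n x, N <= n -> ~ C n x.
Proof.
move=> cX cC dC nC; apply: contrapT => h; apply: nC.
apply: compact_nested => // n; apply: contrapT => Cn; apply: h; exists n.
move=> m x nm Cx; apply: Cn; exists x.
elim: m nm Cx => [|m IHm]; first by rewrite leqn0 => /eqP ->.
by rewrite leq_eqVlt => /orP[/eqP ->//|]; rewrite ltnS => /IHm h /dC/h.
Qed.

Section TowerSystems.
Variables (X : topologicalType) (phi : X -> X).

(** The point [x] lies on the top floor of a tower. *)
Definition top_of (A : finType) (t : A -> seq (set X)) x :=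
  exists a, located t x a (size (t a)).-1.

(** The point [x] lies on the bottom floor of a tower. *)
Definition bottom_of (A : finType) (t : A -> seq (set X)) x :=
  exists a, located t x a 0.

(** Towers that [phi] climbs: it maps each floor into the next one, and the top
    floors into the bottom floors. Pointwise inclusions suffice here, the
    converse inclusions being [located_backS] and [bottom_back]. *)
Record tower_system (A : finType) (t : A -> seq (set X)) : Prop :=
  TowerSystem {
  ts_part : tower_partition t;
  ts_clopen : forall a i, i < size (t a) -> clopen (nth set0 (t a) i);
  ts_step : forall x a i, located t x a i -> i.+1 < size (t a) ->
    located t (phi x) a i.+1;
  ts_top : forall x, top_of t x -> bottom_of t (phi x)
}.

(** The towers [u] refine the towers [t], and the top floors of [u] lie in the
    top floors of [t]. *)
Definition finer (A B : finType) (t : A -> seq (set X)) (u : B -> seq (set X)) :=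
  (forall x y b k a i, located u x b k -> located u y b k -> located t x a i ->
     located t y a i) /\
  (forall x, top_of u x -> top_of t x).

Lemma finer_trans (A B C : finType) (t : A -> seq (set X))
    (u : B -> seq (set X)) (v : C -> seq (set X)) : tower_partition u ->
  finer t u -> finer u v -> finer t v.
Proof.
move=> pu [tu tu'] [uv uv']; split=> [x y c k a i xc yc xa|x /uv'/tu'//].
have [b [j xb]] := tp_cover pu x.
exact: tu xb (uv _ _ _ _ _ _ xc yc xb) xa.
Qed.

Section OneSystem.
Variables (A : finType) (t : A -> seq (set X)).
Hypothesis tt : tower_system t.
Let tp := ts_part tt.

Lemma located_size x a i : located t x a i -> i < size (t a).
Proof. by case. Qed.

Lemma located_succ x a i : located t x a i -> i.+1 < size (t a) \/ top_of t x.
Proof.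
move=> xa; have := located_size xa; rewrite leq_eqVlt => /orP[/eqP ai|]; last by left.
by right; exists a; rewrite -ai.
Qed.

Lemma located_top x a i : located t x a i -> top_of t x -> i = (size (t a)).-1.
Proof. by move=> xa [b xb]; have [-> ->] := tp_uniq tp xa xb. Qed.

Lemma located_backS x a i : located t (phi x) a i.+1 -> located t x a i.
Proof.
move=> xa; have [b [j xb]] := tp_cover tp x; have [lt|] := located_succ xb.
  by have [-> []] := tp_uniq tp xa (ts_step tt xb lt) => ->.
by case/(ts_top tt) => c /(tp_uniq tp xa)[].
Qed.

Lemma bottom_back x : bottom_of t (phi x) -> top_of t x.
Proof.
move=> [a xa]; have [b [j xb]] := tp_cover tp x; have [lt|//] := located_succ xb.
by have [] := tp_uniq tp xa (ts_step tt xb lt).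
Qed.

(** A set that is a union of floors is open; so is its complement. *)
Lemma saturated_open (S : set X) :
  (forall x y a i, located t x a i -> located t y a i -> S x -> S y) -> open S.
Proof.
move=> Ssat; rewrite openE => x Sx; have [a [i xa]] := tp_cover tp x.
have [o _] := ts_clopen tt (located_size xa).
apply: (@filterS _ (nbhs x) _ (nth set0 (t a) i)); last first.
  by apply: open_nbhs_nbhs; split=> //; exact: (proj2 xa).
by move=> y ya; apply: (Ssat _ _ _ _ xa _ Sx); split=> //; exact: located_size xa.
Qed.

Lemma saturated_closed (S : set X) :
  (forall x y a i, located t x a i -> located t y a i -> S x -> S y) -> closed S.
Proof.
move=> Ssat; rewrite -openC; apply: saturated_open => x y a i xa ya nS Sy.
by apply: nS; exact: Ssat ya xa Sy.
Qed.

Lemma closed_top : closed (top_of t).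
Proof.
apply: saturated_closed => x y a i xa ya xt.
by exists a; rewrite -(located_top xa xt).
Qed.

Lemma closed_bottom : closed (bottom_of t).
Proof.
apply: saturated_closed => x y a i xa ya [b xb].
by exists a; have [_ <-] := tp_uniq tp xa xb.
Qed.
End OneSystem.

Section Finer.
Hypothesis phi_surj : forall y, exists x, phi x = y.
Variables (A B : finType) (t : A -> seq (set X)) (u : B -> seq (set X)).
Hypotheses (tt : tower_system t) (tu : tower_system u) (ftu : finer t u).

Lemma finer_occurs0 x b k a :
  located u x b k -> located t x a 0 -> occurs (t a) (u b) k.
Proof.
move=> xb xa.
have H j : j < size (t a) -> exists y, located u y b (k + j) /\ located t y a j.
  elim: j => [|j IHj] ja; first by exists x; rewrite addn0.
  have [y [yb ya]] := IHj (ltnW ja).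
  have [lt|/(proj2 ftu) ty] := located_succ yb; last first.
    have := located_top tt ya ty => E; move: ja; rewrite E.
    by case: (size (t a)) => //= n; rewrite ltnn.
  exists (phi y); rewrite addnS.
  by split; [exact: ts_step tu _ _ _ yb lt|exact: ts_step tt _ _ _ ya ja].
split=> [|j ja].
  have [y [yb ya]] := H (size (t a)).-1
    (leq_ltn_trans (leqnn _) (eq_leq (prednK (tp_size (ts_part tt) a)))).
  have := located_size yb.
  by rewrite -{2}(prednK (tp_size (ts_part tt) a)) addnS.
have [y [yb ya]] := H j ja => z zb; have lt := located_size yb.
by have [] := proj1 ftu y z b (k + j) a j yb (conj lt zb) ya.
Qed.

(** A floor of [u] that lies on floor [i] of [t a] is floor [i] of an occurrence
    of [t a]: going down from it, the bottom of [u b] cannot be reached before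
    that of [t a], because bottom floors of [u] lie in bottom floors of [t]. *)
Lemma finer_occurs x b k a i : located u x b k -> located t x a i ->
  i <= k /\ occurs (t a) (u b) (k - i).
Proof.
elim: i x b k => [|i IHi] x b k xb xa.
  by rewrite subn0; split=> //; exact: finer_occurs0 xa.
have [y yx] := phi_surj x; subst x.
case: k xb => [|k] xb; last first.
  by have [] := IHi _ _ _ (located_backS tu xb) (located_backS tt xa).
have yt : top_of u y by apply: bottom_back => //; exists b.
by have [c /(tp_uniq (ts_part tt) xa)[]] := ts_top tt (proj2 ftu _ yt).
Qed.

Lemma finer_tiled b k : k < size (u b) ->
  exists a i, [/\ i <= k, i < size (t a) & occurs (t a) (u b) (k - i)].
Proof.
move=> kb; have [x xb] := tp_ne (ts_part tu) kb.
have [a [i xa]] := tp_cover (ts_part tt) x.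
by exists a, i; have [] := finer_occurs xb xa; split=> //; exact: located_size xa.
Qed.
End Finer.

(** The map [t] enumerates the towers of [P], possibly with repetitions. *)
Definition names (A : finType) (t : A -> seq (set X)) (P : towers X) :=
  forall S, S \in P <-> exists a, t a = S.

Lemma names_cells (A : finType) (t : A -> seq (set X)) P Z : names t P ->
  cells P Z <-> exists a i, i < size (t a) /\ nth set0 (t a) i = Z.
Proof.
move=> tP; split=> [[S /tP[a <-] ZS]|[a [i [ia <-]]]].
  by exists a, (index Z (t a)); rewrite index_mem nth_index.
by exists (t a); [apply/tP; exists a|exact: mem_nth].
Qed.

Lemma names_tops (A : finType) (t : A -> seq (set X)) P x : names t P ->
  (forall a, 0 < size (t a)) -> tops P x <-> top_of t x.
Proof.
move=> tP t0; split=> [[S /= /tP[a <-]] xS|[a [_ xa]]].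
  by exists a; split; [rewrite prednK|rewrite nth_last].
by exists (t a); [apply/tP; exists a|rewrite -nth_last].
Qed.

Lemma names_bottoms (A : finType) (t : A -> seq (set X)) P x : names t P ->
  (forall a, 0 < size (t a)) -> bottoms P x <-> bottom_of t x.
Proof.
move=> tP t0; split=> [[S /= /tP[a <-]] xS|[a [_ xa]]].
  by exists a; split; rewrite ?nth0.
by exists (t a); [apply/tP; exists a|rewrite -nth0].
Qed.

Lemma finerP (A B : finType) (t : A -> seq (set X)) (u : B -> seq (set X))
    (P Q : towers X) : tower_partition t -> tower_partition u ->
  names t P -> names u Q ->
  (refines P Q /\ tops Q `<=` tops P) <-> finer t u.
Proof.
move=> tp up tP uQ.
have Pt x := names_tops x tP (tp_size tp).
have Qt x := names_tops x uQ (tp_size up).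
split=> -[H K]; split.
- move=> x y b k a i [kb xb] [_ yb] xa.
  have [|Z ZP sub] := H (nth set0 (u b) k).
    by apply/(names_cells _ uQ); exists b, k.
  have [a' [i' [i'a' E]]] := iffLR (names_cells _ tP) ZP; subst Z.
  have [-> ->] := tp_uniq tp xa (conj i'a' (sub _ xb)).
  by split=> //; exact: sub.
- by move=> x /Qt/K/Pt.
- move=> Y /(names_cells _ uQ)[b [k [kb <-]]].
  have [x xb] := tp_ne up kb; have [a [i xa]] := tp_cover tp x.
  exists (nth set0 (t a) i); first by apply/(names_cells _ tP); exists a, i; case: xa.
  by move=> y yb; have [] := H x y b k a i xb (conj kb yb) xa.
- by move=> x /Qt/K/Pt.
Qed.

Lemma kr_tower_system x0 (P : towers X) (A : finType) (t : A -> seq (set X)) :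
  kr_partition phi x0 P -> injective t -> names t P -> tower_system t.
Proof.
move=> kr tI tP; have PA a : t a \in P by apply/tP; exists a.
have tp : tower_partition t.
  split=> [a|a i ia|x|x a b i j [ia xa] [jb xb]].
  - exact: (kr_size kr).
  - have [|x xa] := kr_ne kr (Z := nth set0 (t a) i); last by exists x.
    by apply/(names_cells _ tP); exists a, i.
  - have [Z /(names_cells _ tP)[a [i [ia <-]]] xa] := kr_cover kr x.
    by exists a, i.
  - have [|/tI -> ->] // := kr_disj kr (PA a) (PA b) ia jb.
    by exists x.
split=> // [a i ia|x a i [ia xa] lt|x].
- by apply: (kr_clopen kr); apply/(names_cells _ tP); exists a, i.
- by split=> //; rewrite -(kr_step kr) //; exists x.
- move/(names_tops _ tP (tp_size tp)) => xt.
  by apply/(names_bottoms _ tP (tp_size tp)); rewrite -(kr_bottom kr); exists x.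
Qed.
End TowerSystems.

(** * Tower models and the premorphisms induced by factor maps *)

(** At each level [n], the vertices of [D] name bijectively the towers of the
    n-th partition of [X]. *)
Record naming (X : system) (D : diagram) (t : forall n, vtx D n -> seq (set (space X)))
  : Prop := Naming {
  naming_inj : forall n, injective (t n);
  naming_names : forall n, names (t n) (spart X n)
}.

(** A naming for which the edge sets of [D] stack each level into the next. *)
Record model (X : system) (D : diagram) (t : forall n, vtx D n -> seq (set (space X)))
  : Prop := Model {
  model_naming :> naming t;
  model_stacks : forall n, stacks (t n) (dedge D n) (t n.+1)
}.

Section Models.
Variables (R : realType) (X : sds R) (D : diagram).
Variable t : forall n, vtx D n -> seq (set (space X)).
Arguments t : clear implicits.
Hypothesis Xt : naming t.
Let phi := @smap X.
Let x0 := spt X.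
Let krX := sds_kr (sdsP X).

Lemma sds_compact : compact [set: space X].
Proof. by have [] := sds_em (sdsP X). Qed.

Lemma smap_surj y : exists x, phi x = y.
Proof.
by have [_ _ _ [_ [g [_ _ gK]]] _] := sds_em (sdsP X); exists (g y); exact: gK.
Qed.

Lemma model_ts n : tower_system phi (t n).
Proof.
exact: kr_tower_system (krs_kr krX n) (@naming_inj _ _ _ Xt n) (naming_names Xt n).
Qed.

Lemma model_tp n : tower_partition (t n).
Proof. exact: ts_part (model_ts n). Qed.

Lemma model_size n v : 0 < size (t n v).
Proof. exact: tp_size (model_tp n) v. Qed.

Lemma model_tops n x : tops (spart X n) x <-> top_of (t n) x.
Proof. exact: names_tops x (naming_names Xt n) (tp_size (model_tp n)). Qed.

Lemma model0 v : t 0 v = [:: setT].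
Proof.
have : t 0 v \in spart X 0 by apply/(naming_names Xt); exists v.
by rewrite (krs_0 krX) inE => /eqP.
Qed.

Lemma model_vtx0 (v w : vtx D 0) : v = w.
Proof. by apply: (naming_inj Xt); rewrite !model0. Qed.

Lemma model_top0 x : top_of (t 0) x.
Proof.
have [v [i xv]] := tp_cover (model_tp 0) x.
by exists v; rewrite model0; split; rewrite model0.
Qed.

Lemma model_finerS n : finer (t n) (t n.+1).
Proof.
split; last first.
  case: n => [x _|n x]; first exact: model_top0.
  by rewrite -!model_tops; exact: (krs_tops krX).
move=> x y b k a i [kb xb] [_ yb] xa.
have [|Z ZP sub] := krs_refines krX (n := n) (Y := nth set0 (t n.+1 b) k).
  by apply/(names_cells _ (naming_names Xt n.+1)); exists b, k.
have [a' [i' [ia' E]]] := iffLR (names_cells _ (naming_names Xt n)) ZP; subst Z.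
have [-> ->] := tp_uniq (model_tp n) xa (conj ia' (sub _ xb)).
by split=> //; exact: sub.
Qed.

Lemma model_finer n m : n <= m -> finer (t n) (t m).
Proof.
elim: m => [|m IHm].
  rewrite leqn0 => /eqP ->; split=> // x y b k a i xb yb xa.
  by have [-> ->] := tp_uniq (model_tp 0) xa xb.
rewrite leq_eqVlt => /orP[/eqP ->|].
  split=> // x y b k a i xb yb xa.
  by have [-> ->] := tp_uniq (model_tp m.+1) xa xb.
rewrite ltnS => /IHm h; exact: finer_trans (model_tp m) h (model_finerS m).
Qed.

Lemma model_cap x : (forall n, top_of (t n.+1) x) -> x = x0.
Proof.
move=> H; suff : (\bigcap_(n in [set n | 0 < n]) tops (spart X n)) x.
  by rewrite (krs_cap krX).
by move=> [//|n] _; apply/model_tops.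
Qed.

Lemma model_x0 n : top_of (t n) x0.
Proof. by apply/model_tops; exact: kr_top (krs_kr krX n). Qed.

Lemma model_basis x (U : set (space X)) : nbhs x U ->
  exists n a i, located (t n) x a i /\ nth set0 (t n a) i `<=` U.
Proof.
move=> /(proj2 (krs_basis krX) x)[Z [[n _ Zn] Zx] ZU].
have [a [i [ia E]]] := iffLR (names_cells _ (naming_names Xt n)) Zn; subst Z.
by exists n, a, i.
Qed.

(** Points that are on the same floor at each level are equal. *)
Lemma model_sep x y :
  (forall n a i, located (t n) x a i -> located (t n) y a i) -> x = y.
Proof.
move=> H; have [mX _ _ _ _] := sds_em (sdsP X).
apply: (metrizable_hausdorff mX) => U V /model_basis[n [a [i [xa sub]]]] yV.
exists y; split; last exact: nbhs_singleton yV.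
by apply: sub; have [] := H _ _ _ xa.
Qed.

End Models.

Lemma model_epath (X : system) (D : diagram)
    (t : forall n, vtx D n -> seq (set (space X))) k l : model t -> k <= l ->
  stacks (t k) (epath D k l) (t l).
Proof. by move=> Xt; exact/stacks_epath/(model_stacks Xt). Qed.

Section Pullback.
Variables (X Y : system) (alpha : sds_hom X Y).

Lemma sfunE x : alpha (smap x) = smap (alpha x).
Proof. exact: (congr1 (fun f => f x) (sfun_equiv alpha)). Qed.

Lemma pull_ts (A : finType) (u : A -> seq (set (space Y))) :
  tower_system (@smap Y) u ->
  tower_system (@smap X) (fun a => preim_tower alpha (u a)).
Proof.
move=> uS; have up := ts_part uS; split; first split.
- by move=> a; rewrite size_map; exact: (tp_size up).
- move=> a i; rewrite size_map => /(tp_ne up)[y ya].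
  by have [x xy] := sfun_surj alpha y; exists x; rewrite located_preim xy.
- move=> x; have [a [i xa]] := tp_cover up (alpha x).
  by exists a, i; rewrite located_preim.
- by move=> x a b i j; rewrite !located_preim; exact: (tp_uniq up).
- move=> a i; rewrite size_map nth_preim => /(ts_clopen uS) c.
  by apply: preimage_clopen c _; exact: sfun_cont.
- by move=> x a i; rewrite !located_preim size_map sfunE; exact: (ts_step uS).
- move=> x [a]; rewrite located_preim size_map => xa.
  have [|b xb] := ts_top uS (x := alpha x); first by exists a.
  by exists b; rewrite located_preim sfunE.
Qed.

Lemma top_of_pull (A : finType) (u : A -> seq (set (space Y))) x :
  top_of (fun a => preim_tower alpha (u a)) x <-> top_of u (alpha x).
Proof. by split=> -[a]; rewrite ?located_preim ?size_map => ?; exists a;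
  rewrite ?located_preim ?size_map. Qed.
End Pullback.

Section Induced.
Variables (R : realType) (X Y : sds R) (B C : diagram).
Variable t : forall n, vtx B n -> seq (set (space X)).
Variable u : forall n, vtx C n -> seq (set (space Y)).
Arguments t : clear implicits.
Arguments u : clear implicits.
Hypotheses (Xt : model t) (Yu : model u).

(** The factor map [alpha] induces the premorphism [f]: at each level [f] stacks
    the inverse images of the towers of [Y] into towers of [X]. *)
Definition induces (alpha : sds_hom X Y) (f : premorphism C B) :=
  forall n, stacks (fun v => preim_tower alpha (u n v)) (pedge f n) (t (plev f n)).

Section Levels.
Variable alpha : sds_hom X Y.
Let au n (v : vtx C n) := preim_tower alpha (u n v).
Arguments au : clear implicits.
Let aus n : tower_system (@smap X) (au n) := pull_ts alpha (model_ts Yu n).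

(** At level 0 any choice is admissible: there is a single tower, whose only floor
    is the whole space. *)
Lemma pull_finer0 m : finer (au 0) (t m).
Proof.
split=> [x y b k a i xb yb|x _]; last by apply/top_of_pull; exact: model_top0 Yu _.
rewrite /au !located_preim /located (model0 Yu) => -[].
by case: i.
Qed.

(** The towers of [X] eventually refine the inverse images of the n-th towers of
    [Y]. The points where this fails at level [m], and those on a top floor of
    [X] but not on an inverse image of a top floor of [Y], form decreasing
    sequences of closed sets; a common point would contradict that the cells
    are a basis, respectively that the tops of [X] meet in the base point only. *)
Lemma pull_finer n : exists M, forall m, M <= m -> finer (au n) (t m).
Proof.
have cX : compact [set: space X] := sds_compact (X := X).
pose C1 m : set (space X) := [set x | exists y b k, [/\ located (t m) x b k,
  located (t m) y b k &
  exists a i, located (au n) x a i /\ ~ located (au n) y a i]].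
have [] := @nested_empty _ C1 cX.
- move=> m; apply: (saturated_closed (model_ts Xt m)) => x x' b k xb x'b.
  move=> [y [b' [k' [xb' yb [a [i [xa ya]]]]]]].
  have [E1 E2] := tp_uniq (model_tp Xt m) xb xb'; subst b' k'.
  have [x'a|x'a] := pselect (located (au n) x' a i).
    by exists y, b, k; split=> //; exists a, i.
  have [a' [i' x'a']] := tp_cover (ts_part (aus n)) x'.
  exists x, b, k; split=> //; exists a', i'; split=> // xa'.
  by have [E1 E2] := tp_uniq (ts_part (aus n)) xa xa'; subst a' i'.
- move=> m x [y [b [k [xb yb [a [i [xa ya]]]]]]].
  have [b' [k' xb']] := tp_cover (model_tp Xt m) x.
  exists y, b', k'; split=> //; last by exists a, i.
  exact: (proj1 (model_finerS Xt m)) xb yb xb'.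
- move=> [x Cx]; have [a [i xa]] := tp_cover (ts_part (aus n)) x.
  have nx : nbhs x (nth set0 (au n a) i).
    apply: open_nbhs_nbhs; split; last by case: xa.
    by have [] := ts_clopen (aus n) (located_size xa).
  have [m [b [k [xb sub]]]] := model_basis Xt nx.
  have [y [b' [k' [xb' yb [a' [i' [xa' ya]]]]]]] := Cx m.
  have [E1 E2] := tp_uniq (model_tp Xt m) xb xb'; subst b' k'.
  have [E1 E2] := tp_uniq (ts_part (aus n)) xa xa'; subst a' i'.
  apply: ya; split; first exact: located_size xa.
  by apply: sub; case: yb.
move=> M1 H1.
pose C2 m : set (space X) := top_of (t m.+1) `&` ~` top_of (au n).
have [] := @nested_empty _ C2 cX.
- move=> m; apply: closedI; first exact: closed_top (model_ts Xt _).
  apply: (saturated_closed (aus n)) => x y a i xa ya nx yt; apply: nx.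
  by exists a; rewrite -(located_top (aus n) ya yt).
- by move=> m x [xt xn]; split=> //; exact: (proj2 (model_finerS Xt _)).
- move=> [x Cx]; have xE : x = spt X.
    by apply: (model_cap Xt) => m; have [] := Cx m.
  have [_] := Cx 0; apply; apply/top_of_pull; rewrite xE sfun_pt.
  exact: model_x0 Yu _.
move=> M2 H2; exists (maxn M1 M2.+1) => m; rewrite geq_max => /andP[m1 m2].
split.
  move=> x y b k a i xb yb xa; apply: contrapT => ya.
  by apply: (H1 m x m1); exists y, b, k; split=> //; exists a, i.
case: m m2 {m1} => // m m2 x xt; apply: contrapT => xn.
exact: (H2 m x m2).
Qed.

Lemma pull_levels : exists l : nat -> nat, [/\ l 0 = 0, forall n, l n <= l n.+1,
  forall N, exists n, N <= l n &
  forall n, finer (au n) (t (l n))].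
Proof.
have /choice[M MP] := pull_finer.
pose l := fix l n := if n is k.+1 then maxn (l k) (maxn n (M n)) else 0.
exists l; split=> //.
- by move=> n; exact: leq_maxl.
- by case=> [|n]; [exists 0|exists n.+1; rewrite /= !leq_max leqnn orbT].
- case=> [|n]; first exact: pull_finer0.
  by apply: MP; rewrite /= !leq_max leqnn !orbT.
Qed.

Section Construction.
Variables (l : nat -> nat) (F : forall n, edgeset (vtx C n) (vtx B (l n))).
Hypotheses (l0 : l 0 = 0) (l_mono : forall n, l n <= l n.+1)
  (l_unb : forall N, exists n, N <= l n)
  (Fs : forall n, stacks (au n) (F n) (t (l n))).

Let tp n := model_tp Xt n.

Lemma induced_rng n (w : vtx B (l n)) : exists e : F n, rng _ e = w.
Proof. exact: (stacks_rng (Fs n) w (tp_size (ts_part (aus n))) (tp_size (tp _))). Qed.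

Lemma induced_src n (v : vtx C n) : exists e : F n, src _ e = v.
Proof. exact: (stacks_src (Fs n) v (ts_part (aus n)) (tp _)). Qed.

Lemma induced_ne n : 0 < #|F n|.
Proof.
have [v _] := tp_cover (model_tp Yu n) (spt Y); have [e _] := induced_src v.
by apply/card_gt0P; exists e.
Qed.

Lemma induced0 : #|F 0| = 1.
Proof.
apply/eqP; rewrite eqn_leq induced_ne andbT.
suff H (e e' : F 0) : e = e'.
  have /card_gt0P[e _] := induced_ne 0; rewrite -(card1 e); apply: subset_leq_card.
  by apply/fintype.subsetP => e' _; rewrite inE (H e' e).
have r : rng (F 0) e = rng (F 0) e'.
  by move: (rng _ e) (rng _ e'); rewrite l0 => a b; exact: model_vtx0 Xt a b.
have s1 (w : vtx B (l 0)) : size (t (l 0) w) = 1.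
  by move: w; rewrite l0 => w; rewrite (model0 Xt).
have s (e1 : F 0) : offset (fun a => size (au 0 a)) e1 = 0.
  have := stacks_offset (Fs 0) (tp_size (ts_part (aus 0)) (src _ e1)).
  by rewrite addn0 s1 ltnS leqn0 => /eqP.
have [] // := @offset_uniq _ _ _ (fun a => size (au 0 a)) e e' 0 0 r.
- exact: tp_size (ts_part (aus 0)) _.
- exact: tp_size (ts_part (aus 0)) _.
- by rewrite !s.
Qed.

Lemma induced_comm n :
  eiso (dedge C n \;e F n.+1) (F n \;e epath B (l n) (l n.+1)).
Proof.
apply: (stacks_uniq (ts_part (aus n)) (tp (l n.+1))).
  by apply: stacks_comp (Fs _); apply: stacks_preim; exact: model_stacks Yu n.
by apply: stacks_comp (Fs n) _; exact: model_epath Xt (l_mono n).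
Qed.

(** Edge sets that stack the inverse images of the towers of [Y] into the towers
    of [X] at the levels [l] form a premorphism; the commutation isomorphisms are
    those of [stacks_uniq]. *)
Definition induced : premorphism C B :=
  Premorphism l0 l_mono l_unb induced_ne induced_src induced_rng induced0 induced_comm.
End Construction.
End Levels.

Lemma induces_equiv alpha f g :
  induces alpha f -> induces alpha g -> pequiv f g.
Proof.
suff H f' g' : induces alpha f' -> induces alpha g' -> pdom f' g'.
  by move=> fa ga; apply: pdom_pequiv; exact: H.
move=> fa ga n; have [n0 h0] := plev_event g' (plev f' n).+1.
exists (maxn n.+1 n0) => m; rewrite geq_max => /andP[nm /h0 fg]; split=> //.
apply: (stacks_uniq (ts_part (pull_ts alpha (model_ts Yu n))) (model_tp Xt _)).
  by apply: stacks_comp (ga m); apply: stacks_preim; exact: model_epath Yu (ltnW nm).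
by apply: stacks_comp (fa n) _; exact: model_epath Xt (ltnW fg).
Qed.

(** Equivalent premorphisms share, at arbitrarily high levels [n], an edge set
    that stacks both inverse images of the n-th towers of [Y] into the same
    towers of [X]. Both maps thus send a point to the same floor of level [n]. *)
Lemma induces_inj alpha beta f g :
  induces alpha f -> induces beta g -> pequiv f g -> alpha = beta.
Proof.
move=> fa gb /pequiv_dom fg; apply: sds_hom_eq; apply/funext => x.
apply: (model_sep Yu) => n a i xa; have [m0 /(_ _ (leqnn _))[nm fgm I]] := fg n.
have sa := stacks_comp (fa n) (model_epath Xt (ltnW fgm)).
have sb : stacks (fun v => preim_tower beta (u n v)) (epath C n m0 \;e pedge g m0)
    (t (plev g m0)).
  by apply: stacks_comp (gb m0); apply: stacks_preim; exact: model_epath Yu (ltnW nm).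
move/(stacks_iso I): sb => sb.
have [b [k xb]] := tp_cover (model_tp Xt (plev g m0)) x.
have tpa := ts_part (pull_ts alpha (model_ts Yu n)).
have [e [j [re kE xj]]] := stacks_located sa (tp_size tpa) xb.
have [E1 E2] : src _ e = a /\ j = i.
  by move: xj; rewrite located_preim => /(tp_uniq (model_tp Yu n)); exact.
subst a j; have lt : i < size (preim_tower beta (u n (src _ e))).
  by rewrite size_map; case: xa.
split; first by case: xa.
have := proj2 sb e i lt; rewrite nth_preim; apply; rewrite re.
have -> : offset (fun a => size (preim_tower beta (u n a))) e + i = k.
  by rewrite kE; congr (_ + _); apply: offset_eq => v; rewrite !size_map.
by case: xb.
Qed.
End Induced.

(** * Every premorphism is induced by a factor map *)

Lemma induces_id (R : realType) (X : sds R) (D : diagram) (wD : is_bratteli D)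
    (t : forall n, vtx D n -> seq (set (space X))) :
  induces t t (sds_id X) (pid wD).
Proof.
move=> n; have -> : (fun v => preim_tower (sds_id X) (t n v)) = t n.
  by apply/funext => v; rewrite /preim_tower map_id.
exact: stacks_diag.
Qed.

Lemma induces_comp (R : realType) (X Y Z : sds R) (B C D : diagram)
    (t : forall n, vtx B n -> seq (set (space X)))
    (u : forall n, vtx C n -> seq (set (space Y)))
    (w : forall n, vtx D n -> seq (set (space Z)))
    (alpha : sds_hom X Y) (beta : sds_hom Y Z) f g :
  induces t u alpha f -> induces u w beta g ->
  induces t w (sds_comp beta alpha) (pcomp f g).
Proof.
move=> fa gb n; apply: stacks_comp (fa (plev g n)).
have -> : (fun v => preim_tower (sds_comp beta alpha) (w n v)) =
    (fun v => preim_tower alpha (preim_tower beta (w n v))).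
  by apply/funext => v; rewrite /preim_tower -map_comp.
exact: stacks_preim (gb n).
Qed.

Section Realization.
Variables (R : realType) (X Y : sds R) (B C : diagram).
Variable t : forall n, vtx B n -> seq (set (space X)).
Variable u : forall n, vtx C n -> seq (set (space Y)).
Arguments t : clear implicits.
Arguments u : clear implicits.
Hypotheses (Xt : model t) (Yu : model u).
Variable f : premorphism C B.
Let l := plev f.
Let h n v := size (u n v).
Arguments h : clear implicits.
Let phi := @smap X.
Let psi := @smap Y.

(** The heights of the towers of [X] are those prescribed by [f] and by the
    heights of the towers of [Y]. By induction on [n], using that isomorphic edge
    sets have equal heights. *)
Lemma pedge_height n (b : vtx B (l n)) : size (t (l n) b) = height (pedge f n) (h n) b.
Proof.
elim: n b => [|n IHn] b.
  have l0 : l 0 = 0 := plev0 f.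
  have s1 (w : vtx B (l 0)) : size (t (l 0) w) = 1.
    by move: w; rewrite l0 => w; rewrite (model0 Xt).
  have rE e : rng (pedge f 0) e = b.
    by move: (rng _ e) b; rewrite -/(l 0) l0; exact: model_vtx0 Xt.
  rewrite s1 /height (eq_bigr (fun=> 1)); last first.
    by move=> e _; rewrite /h (model0 Yu).
  rewrite sum1_card -[LHS](pedge0 f); apply: eq_card => e.
  by apply/esym/eqP; exact: rE.
rewrite (proj1 (model_epath Xt (plev_mono f n))) (height_eq _ IHn) -height_comp.
have [g [gb gs gr _]] := pedge_comm f n.
rewrite (height_iso _ gb gs gr) height_comp; apply: height_eq => v.
by rewrite /h (proj1 (model_stacks Yu n)).
Qed.

(** According to [f], the image of [x] should lie on floor [i] of the tower of
    [Y] with name [v]: this is floor [i] of the block of an edge [e] of [f], over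
    the tower of [X] that contains [x]. *)
Definition follows n x v i := i < size (u n v) /\ exists e : pedge f n,
  src _ e = v /\ located (t (l n)) x (rng _ e) (offset (h n) e + i).
Arguments follows : clear implicits.

Lemma follows_ex n x : exists v i, follows n x v i.
Proof.
have [b [k xb]] := tp_cover (model_tp Xt (l n)) x.
have [|e [i [re ie kE]]] := @offset_ex _ _ (pedge f n) (h n) (model_size Yu (n := n)) b k.
  by rewrite -pedge_height; case: xb.
by exists (src _ e), i; split=> //; exists e; rewrite re -kE.
Qed.

Lemma follows_uniq n x v w i j : follows n x v i -> follows n x w j ->
  v = w /\ i = j.
Proof.
move=> [iv [e [ev xe]]] [jw [e' [ew xe']]]; subst v w.
have [re oE] := tp_uniq (model_tp Xt (l n)) xe xe'.
by have [-> ->] := offset_uniq re iv jw oE.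
Qed.

Lemma follows_sat n x y b k v i : located (t (l n)) x b k ->
  located (t (l n)) y b k -> follows n x v i -> follows n y v i.
Proof.
move=> xb yb [iv [e [ev xe]]]; split=> //; exists e; split=> //.
by have [<- <-] := tp_uniq (model_tp Xt (l n)) xb xe.
Qed.

(** The floors prescribed at consecutive levels are nested: the isomorphism
    between the two composite edge sets of [pedge_comm] preserves sources and
    offsets, and an offset determines its edge. *)
Lemma follows_nest n x v i w j : follows n x v i -> follows n.+1 x w j ->
  nth set0 (u n.+1 w) j `<=` nth set0 (u n v) i.
Proof.
move=> xv [jw [e [ew xe]]]; subst w.
have [hE iE] := model_stacks Yu n.
have [|g [i' [rg ig jE]]] := @offset_ex _ _ (dedge C n) (h n) (model_size Yu (n := n))
    (src _ e) j; first by rewrite -hE.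
suff /(follows_uniq xv)[-> ->] : follows n x (src _ g) i'.
  by rewrite jE -rg; exact: iE.
have ge : rng (dedge C n) g == src (pedge f n.+1) e by rewrite rg.
pose p : dedge C n \;e pedge f n.+1 := exist _ (g, e) ge.
have [k [kb ks kr kl]] := pedge_comm f n.
have o := offset_iso (h n) kb ks kl p; have s := ks p; have r := kr p.
case: (k p) o s r => [[e' s] es] /=; rewrite !offset_comp /= => o s' r.
have es' : rng (pedge f n) e' = src _ s by exact/eqP.
split; first by [].
exists e'; split; first exact: s'.
have lt : offset (h n) e' + i' < size (t (l n) (src _ s)).
  rewrite -es' pedge_height; apply: leq_trans (offset_height _ e').
  by rewrite ltn_add2l s'.
rewrite es'; split=> //.
apply: (proj2 (model_epath Xt (plev_mono f n))) => //.
rewrite r (offset_eq (@pedge_height n)) addnA o.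
by case: xe => _; rewrite jE addnA (offset_eq (proj1 (model_stacks Yu n))).
Qed.

Lemma follows_step n x v i : follows n x v i -> i.+1 < size (u n v) ->
  follows n (phi x) v i.+1.
Proof.
move=> [iv [e [ev xe]]] lt; split=> //; exists e; split=> //; rewrite addnS.
apply: (ts_step (model_ts Xt (l n)) xe); rewrite pedge_height.
apply: leq_trans (offset_height _ e); rewrite -addnS ltn_add2l.
by rewrite ev.
Qed.

Lemma follows_back n x v i : follows n (phi x) v i.+1 -> follows n x v i.
Proof.
move=> [iv [e [ev xe]]]; split; first exact: ltnW.
exists e; split=> //; apply: (located_backS (model_ts Xt (l n))).
by rewrite -addnS.
Qed.

Lemma follows_top n x v : follows n x v (size (u n v)).-1 ->
  exists w, follows n (phi x) w 0.
Proof.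
move=> xv; have [w [[|i] xw]] := follows_ex n (phi x); first by exists w.
have [E1 E2] := follows_uniq xv (follows_back xw); subst v i.
by case: xw => []; rewrite prednK ?ltnn // (model_size Yu).
Qed.

Lemma follows_open n v i : open [set x | follows n x v i].
Proof.
apply: (saturated_open (model_ts Xt (l n))) => x y b k xb yb.
exact: follows_sat xb yb.
Qed.

Lemma limit_ex x : exists y, forall n v i, follows n x v i -> located (u n) y v i.
Proof.
pose D n : set (space Y) := [set y | exists v i, follows n x v i /\
  located (u n) y v i].
have [||n|y yD] := @compact_nested _ D (sds_compact (X := Y)).
- move=> n; apply: (saturated_closed (model_ts Yu n)) => y z a k ya za.
  move=> [v [i [xv yv]]]; exists v, i; split=> //.
  by have [<- <-] := tp_uniq (model_tp Yu n) ya yv.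
- move=> n y [w [j [xw [jw yw]]]]; have [v [i xv]] := follows_ex n x.
  exists v, i; split=> //; split; first by case: xv.
  exact: (follows_nest xv xw).
- have [v [i xv]] := follows_ex n x.
  have [|y yv] := tp_ne (model_tp Yu n) (a := v) (i := i); first by case: xv.
  by exists y, v, i.
exists y => n v i xv; have [w [j [xw yw]]] := yD n.
by have [-> ->] := follows_uniq xv xw.
Qed.

Section Map.
Variable a : space X -> space Y.
Hypothesis aP : forall x n v i, follows n x v i -> located (u n) (a x) v i.

Lemma locatedP x n v i : located (u n) (a x) v i -> follows n x v i.
Proof.
move=> xv; have [w [j xw]] := follows_ex n x.
by have [-> ->] := tp_uniq (model_tp Yu n) xv (aP xw).
Qed.

Lemma limit_cont : continuous a.
Proof.
move=> x U /(model_basis Yu)[n [v [i [xv sub]]]].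
apply: (@filterS _ (nbhs x) _ [set x | follows n x v i]).
  by move=> y /aP[_ yv]; exact: sub.
by apply: open_nbhs_nbhs; split; [exact: follows_open|exact: locatedP].
Qed.

(** If the image of [x] is off the top floors at some level, then it is off them
    at all higher levels and both sides climb by one floor. Otherwise it is the
    base point, and both sides lie on the bottom floors at each level. *)
Lemma limit_equiv x : a (phi x) = psi (a x).
Proof.
have [H|/existsNP[n0 nt]] := pselect (forall n, top_of (u n) (a x)).
  have ax : a x = spt Y by apply: (model_cap Yu) => n.
  have [z zE] := smap_surj (X := Y) (a (phi x)).
  suff -> : a x = z by [].
  rewrite ax; apply/esym/(model_cap Yu) => n.
  apply: (bottom_back (model_ts Yu n.+1)); rewrite zE.
  by have [v /locatedP/follows_top[w /aP xw]] := H n.+1; exists w.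
apply: (model_sep Yu) => n v i xv; pose m := maxn n n0.
have [w [j xw]] := tp_cover (model_tp Yu m) (a x).
have [lt|/(proj2 (model_finer Yu (leq_maxr n n0)))//] := located_succ xw.
have ya := aP (follows_step (locatedP xw) lt).
have ya' := ts_step (model_ts Yu m) xw lt.
exact: (proj1 (model_finer Yu (leq_maxl n n0))) ya ya' xv.
Qed.

Lemma limit_pt : a (spt X) = spt Y.
Proof.
apply: (model_cap Yu) => n; have [b xb] := model_x0 Xt (l n.+1).
have [v [i [iv [e [ev xe]]]]] := follows_ex n.+1 (spt X); subst v.
exists (src _ e); have [rE kE] := tp_uniq (model_tp Xt _) xb xe.
suff E : i = (size (u n.+1 (src _ e))).-1.
  by rewrite -E; apply: aP; split=> //; exists e.
have := offset_height (h n.+1) e; rewrite -pedge_height -rE.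
rewrite -(prednK (model_size Xt b)) kE -addnS leq_add2l /h => le.
by apply/eqP; rewrite eqn_leq -ltnS -(ltnS _ i) !prednK ?(model_size Yu) // iv.
Qed.

Lemma limit_surj y : exists x, a x = y.
Proof.
pose D n : set (space X) := [set x | forall v i, located (u n) y v i ->
  follows n x v i].
have [|n x xD v i yv|n|x xD] := @compact_nested _ D (sds_compact (X := X)).
- move=> n; apply: (saturated_closed (model_ts Xt (l n))) => x z b k xb zb xD v i.
  by move/xD; exact: follows_sat xb zb.
- have [w [j yw]] := tp_cover (model_tp Yu n.+1) y.
  have [v' [i' xv]] := follows_ex n x.
  have sub := follows_nest xv (xD _ _ yw).
  have [|-> ->] // := tp_uniq (model_tp Yu n) yv (b := v') (j := i').
  by split; [case: xv|apply: sub; case: yw].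
- have [v [i yv]] := tp_cover (model_tp Yu n) y.
  have [e ev] := pedge_src f v.
  have lt : offset (h n) e + i < size (t (l n) (rng _ e)).
    rewrite pedge_height; apply: leq_trans (offset_height _ e).
    by rewrite ltn_add2l ev; case: yv.
  have [x xe] := tp_ne (model_tp Xt (l n)) lt.
  exists x => w j /(tp_uniq (model_tp Yu n) yv)[<- <-]; split; first by case: yv.
  by exists e.
exists x; apply/esym/(model_sep Yu) => n v i yv.
exact/aP/xD.
Qed.

(** The factor map that sends [x] to the point common to the prescribed floors. *)
Definition limit_hom : sds_hom X Y :=
  SdsHom limit_cont (funext limit_equiv) limit_pt limit_surj.

Lemma limit_induces : induces t u limit_hom f.
Proof.
have E n : (fun v => size (preim_tower limit_hom (u n v))) =1 h n.
  by move=> v; rewrite size_map.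
move=> n; split=> [b|e i]; first by rewrite pedge_height (height_eq _ (E n)).
rewrite size_map nth_preim (offset_eq (E n)) => ie x xe.
have [_] // : located (u n) (a x) (src _ e) i.
apply: aP; split=> //; exists e; split=> //; split=> //.
rewrite pedge_height; apply: leq_trans (offset_height _ e).
by rewrite ltn_add2l.
Qed.
End Map.

Lemma induces_surj : exists alpha, induces t u alpha f.
Proof.
by have /choice[a aP] := limit_ex; exists (limit_hom aP); exact: limit_induces.
Qed.
End Realization.

(** * The diagram of a system *)

(** The towers of the n-th partition of [X], named by themselves. *)
Definition taut (R : realType) (X : sds R) n (S : vtx (Pdiag X) n) :
  seq (set (space X)) := val (S : spart X n).
Arguments taut {R} X n S.

Section Tautological.
Variables (R : realType) (X : sds R).
Let krX := sds_kr (sdsP X).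

Lemma taut_naming : naming (taut X).
Proof.
split=> n; first exact: val_inj.
by move=> S; split=> [SP|[a <-]]; [exists [` SP]%fset|exact: fsvalP].
Qed.

Lemma taut_model : model (taut X).
Proof.
split=> [|n]; first exact: taut_naming.
apply: tower_edges_stack; first exact: (tp_uniq (model_tp taut_naming n)).
move=> T k kT; apply: (finer_tiled (@smap_surj R X) (model_ts taut_naming n)
  (model_ts taut_naming n.+1) (model_finerS taut_naming n) kT).
Qed.
End Tautological.

Lemma pull_stacks (R : realType) (X Y : sds R) (a : sds_hom X Y) n m :
  finer (fun S => preim_tower a (taut Y n S)) (taut X m) ->
  stacks (fun S => preim_tower a (taut Y n S)) (pull_edges a n m) (taut X m).
Proof.
move=> fin; have aY := pull_ts a (model_ts (taut_naming Y) n).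
apply: tower_edges_stack; first exact: (tp_uniq (ts_part aY)).
move=> T k kT.
exact: (finer_tiled (@smap_surj R X) aY (model_ts (taut_naming X) m) fin kT).
Qed.

Lemma finer_represents (R : realType) (X Y : sds R) (a : sds_hom X Y) n m :
  finer (fun S => preim_tower a (taut Y n S)) (taut X m) <->
  refines (preim_partition a (spart Y n)) (spart X m) /\
  tops (spart X m) `<=` tops (preim_partition a (spart Y n)).
Proof.
apply: iff_sym; apply: finerP.
- exact: ts_part (pull_ts a (model_ts (taut_naming Y) n)).
- exact: model_tp (taut_naming X) m.
- move=> S; split=> [/imfsetP[T /= TP ->]|[T <-]].
    by exists [` TP]%fset.
  by apply/imfsetP; exists (val T) => //; exact: fsvalP.
- exact: naming_names (taut_naming X) m.
Qed.

Lemma represents_induces (R : realType) (X Y : sds R) (a : sds_hom X Y) f :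
  represents a f -> induces (taut X) (taut Y) a f.
Proof.
move=> fa n; have [H K ->] := fa n.
by apply: pull_stacks; apply/finer_represents.
Qed.

Lemma represents_ex (R : realType) (X Y : sds R) (a : sds_hom X Y) :
  exists f, represents a f.
Proof.
have [l [l0 lm lu fin]] := pull_levels (taut_model X) (taut_model Y) a.
exists (induced (taut_model X) (taut_model Y) l0 lm lu
  (fun n => pull_stacks (fin n))) => n.
by have [] := iffLR (finer_represents _ _ _) (fin n).
Qed.

Section ExtremalPaths.
Variables (R : realType) (X : sds R) (D : diagram).
Variable t : forall n, vtx D n -> seq (set (space X)).
Arguments t : clear implicits.
Hypothesis Xt : model t.
Variables (idx : forall n, vtx D n -> nat) (x1 : space X).
Arguments idx : clear implicits.
Variable ext : forall n, dedge D n -> Prop.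
Hypotheses (idx_lt : forall n v, idx n v < size (t n v))
  (extP : forall n (e : dedge D n), ext e <-> idx n.+1 (rng _ e) =
    offset (fun v => size (t n v)) e + idx n (src _ e))
  (x1P : forall n, exists v, located (t n) x1 v (idx n v))
  (x1_uniq : forall x, (forall n, exists v, located (t n) x v (idx n v)) -> x = x1).

(** Choose a floor [idx v] in each tower so that a single point [x1] is on a
    chosen floor at each level, and call an edge extremal if it sends the chosen
    floor of its range to that of its source. Then a single path consists of
    extremal edges: the chosen floors along such a path are nested, hence contain
    [x1], which determines the path. With top floors this gives the maximal path,
    with bottom floors the minimal one. *)
Lemma extremal_path : exists! y : path_space D, forall n, ext (y n).
Proof.
have tp n := model_tp Xt n.
have H n : exists e : dedge D n,
    ext e /\ located (t n.+1) x1 (rng _ e) (idx n.+1 (rng _ e)).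
  have [w xw] := x1P n.+1; have [v xv] := x1P n.
  have [e [i [re kE xe]]] := stacks_located (model_stacks Xt n) (tp_size (tp n)) xw.
  exists e; rewrite re; split=> //; apply/extP; rewrite re kE.
  by have [<- <-] := tp_uniq (tp n) xv xe.
pose e n := sval (cid (H n)); have eP n : ext (e n) /\
    located (t n.+1) x1 (rng _ (e n)) (idx n.+1 (rng _ (e n))) :=
  svalP (cid (H n)).
have eL n : located (t n) x1 (src _ (e n)) (idx n (src _ (e n))).
  have [/extP E [lt xe]] := eP n; split; first exact: idx_lt.
  by apply: (proj2 (model_stacks Xt n)); rewrite -?E.
have eR n : rng _ (e n) = src _ (e n.+1).
  by have [_ xe] := eP n; have [] := tp_uniq (tp n.+1) xe (eL n.+1).
exists (PathSpace eR); split=> [n|y yext]; first by have [] := eP n.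
pose C n := nth set0 (t n (src _ (y n))) (idx n (src _ (y n))).
have [||n|x xC] := @compact_nested _ C (sds_compact (X := X)).
- by move=> n; have [] := ts_clopen (model_ts Xt n) (idx_lt (src _ (y n))).
- move=> n; rewrite /C -(pthP y n) (iffLR (extP _) (yext n)).
  by apply: (proj2 (model_stacks Xt n)); exact: idx_lt.
- by have [x [_ xC]] := tp_ne (tp n) (idx_lt (src _ (y n))); exists x.
have xE : x = x1 by apply: x1_uniq => n; exists (src _ (y n)); split; last exact: xC.
have sE n : src _ (e n) = src _ (y n).
  have xy : located (t n) x1 (src _ (y n)) (idx n (src _ (y n))).
    by split=> //; rewrite -xE; exact: xC.
  by have [] := tp_uniq (tp n) (eL n) xy.
apply: path_eq => n /=; have re : rng _ (e n) = rng _ (y n).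
  by rewrite eR sE pthP.
have [en _] := eP n; have := iffLR (extP _) (yext n).
rewrite -re (iffLR (extP _) en) => E.
by have [] := offset_uniq re (idx_lt _) (idx_lt _) E.
Qed.
End ExtremalPaths.

Section Proper.
Variables (R : realType) (X : sds R) (D : diagram).
Variable t : forall n, vtx D n -> seq (set (space X)).
Arguments t : clear implicits.
Hypothesis Xt : model t.

Lemma model_bratteli : is_bratteli D.
Proof.
have tp n := model_tp Xt n; have tS n := model_stacks Xt n.
have ne n : exists v : vtx D n, True.
  by have [v _] := tp_cover (tp n) (spt X); exists v.
have srcP n (v : vtx D n) : exists e : dedge D n, src _ e = v.
  exact: stacks_src (tS n) v (tp n) (tp n.+1).
split=> //.
- by move=> n; have [v _] := ne n; apply/card_gt0P; exists v.
- have [v _] := ne 0; rewrite -(card1 v); apply: eq_card => w.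
  by rewrite !inE; apply/esym/eqP; exact: model_vtx0 Xt w v.
- move=> n; have [v _] := ne n; have [e _] := srcP n v.
  by apply/card_gt0P; exists e.
- by move=> n v; exact: stacks_rng (tS n) v (tp_size (tp n)) (tp_size (tp n.+1)).
Qed.

Lemma model_max n (e : dedge D n) : emax e <->
  (size (t n.+1 (rng _ e))).-1 =
  offset (fun v => size (t n v)) e + (size (t n (src _ e))).-1.
Proof.
have s0 := model_size Xt; rewrite (proj1 (model_stacks Xt n)).
have E : (offset (fun v => size (t n v)) e + size (t n (src _ e))).-1 =
    offset (fun v => size (t n v)) e + (size (t n (src _ e))).-1.
  by rewrite -{1}(prednK (s0 n (src _ e))) addnS.
split=> [/(offset_emax (fun v => size (t n v)))|]; first by rewrite -E => ->.
rewrite -E => H; apply: (emax_offset (s0 n)).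
have o := offset_height (fun v => size (t n v)) e.
have p : 0 < offset (fun v => size (t n v)) e + size (t n (src _ e)).
  by rewrite addn_gt0 s0 orbT.
by rewrite -(prednK p) -H prednK // (leq_trans p).
Qed.

Lemma model_min n (e : dedge D n) : emin e <->
  0 = offset (fun v => size (t n v)) e + 0.
Proof.
rewrite addn0; split=> [/(offset_emin (fun v => size (t n v))) ->//|/esym].
by apply: emin_offset; exact: model_size Xt n.
Qed.

Lemma model_proper : properly_ordered D.
Proof.
have ts n := model_ts Xt n; split.
  apply: (extremal_path Xt (idx := fun n v => (size (t n v)).-1) (x1 := spt X)
    (ext := fun n e => emax e)).
  - by move=> n v; rewrite ltn_predL; exact: model_size Xt n v.
  - exact: model_max.
  - exact: model_x0 Xt.
  - by move=> x xP; apply: (model_cap Xt) => n; exact: xP.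
apply: (extremal_path Xt (idx := fun n v => 0) (x1 := smap (spt X))
  (ext := fun n e => emin e)).
- exact: model_size Xt.
- exact: model_min.
- by move=> n; exact/(ts_top (ts n))/(model_x0 Xt).
- move=> y yP; have [x xy] := smap_surj y; rewrite -xy; congr (smap _).
  apply: (model_cap Xt) => n; apply: (bottom_back (ts _)); rewrite xy.
  exact: yP.
Qed.
End Proper.

Lemma Pdiag_obdpo (R : realType) (X : SDS R) : is_obdpo (Pdiag X).
Proof.
by split; [exact: model_bratteli (taut_model X)|exact: model_proper (taut_model X)].
Qed.

(** * Dynamics on a space with refining towers *)

Lemma stacks_finer (X : topologicalType) (A B : finType)
    (t : A -> seq (set X)) (u : B -> seq (set X)) (F : edgeset A B) :
  tower_partition t -> tower_partition u -> stacks t F u -> finer t u.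
Proof.
move=> tp up tFu; split=> [x y b k a i xb yb xa|x [b xb]].
  have [e [j [re kE xj]]] := stacks_located tFu (tp_size tp) xb.
  have [e' [j' [re' kE' yj]]] := stacks_located tFu (tp_size tp) yb.
  have re'' : rng F e = rng F e' by rewrite re re'.
  have E : offset (fun a => size (t a)) e + j = offset (fun a => size (t a)) e' + j'.
    by rewrite -kE -kE'.
  have [ee jj] := offset_uniq re'' (located_size xj) (located_size yj) E; subst e' j'.
  by have [-> ->] := tp_uniq tp xa xj.
have [e [j [re kE xj]]] := stacks_located tFu (tp_size tp) xb.
exists (src F e); suff <- : j = (size (t (src F e))).-1 by [].
have := stacks_offset tFu (e := e) (i := (size (t (src F e))).-1).
rewrite prednK ?(tp_size tp) // => /(_ (leqnn _)).
rewrite re -(prednK (tp_size up b)) kE ltnS leq_add2l => le.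
have := located_size xj; rewrite -{1}(prednK (tp_size tp (src F e))) ltnS => le'.
by apply/eqP; rewrite eqn_leq le le'.
Qed.

Lemma stacks_bottom (X : topologicalType) (A B : finType)
    (t : A -> seq (set X)) (u : B -> seq (set X)) (F : edgeset A B) x :
  tower_partition t -> stacks t F u -> bottom_of u x -> bottom_of t x.
Proof.
move=> tp tFu [b xb].
have [e [i [_ /esym/eqP]]] := stacks_located tFu (tp_size tp) xb.
by rewrite addn_eq0 => /andP[_ /eqP ->] xe; exists (src F e).
Qed.

Section FromTowers.
(* A compact space with increasingly fine towers that [phi] climbs. The map [phi]
   is not assumed continuous, nor bijective. The top floors shrink to [x0], the
   bottom floors to [x1]. *)
Variables (X : topologicalType) (phi : X -> X) (A : nat -> finType).
Variable t : forall n, A n -> seq (set X).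
Arguments t : clear implicits.
Variables x0 x1 : X.
Hypotheses (cX : compact [set: X]) (hX : hausdorff_space X).
Hypotheses (ts : forall n, tower_system phi (t n))
  (finS : forall n, finer (t n) (t n.+1))
  (botS : forall n x, bottom_of (t n.+1) x -> bottom_of (t n) x)
  (tbasis : forall x (U : set X), nbhs x U ->
    exists n a i, located (t n) x a i /\ nth set0 (t n a) i `<=` U)
  (x0P : forall n, top_of (t n) x0) (x0U : forall x, (forall n, top_of (t n) x) -> x = x0)
  (x1U : forall x, (forall n, bottom_of (t n) x) -> x = x1).

Let tp n := ts_part (ts n).

Lemma towers_finer n m : n <= m -> finer (t n) (t m).
Proof.
have refl k : finer (t k) (t k).
  split=> // x y b j a i xb yb xa.
  by have [-> ->] := tp_uniq (tp k) xa xb.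
elim: m => [|m IHm]; first by rewrite leqn0 => /eqP ->.
rewrite leq_eqVlt => /orP[/eqP -> //|].
by rewrite ltnS => /IHm h; exact: finer_trans (tp m) h (finS m).
Qed.

Lemma towers_sep x y :
  (forall n a i, located (t n) x a i -> located (t n) y a i) -> x = y.
Proof.
move=> H; apply: hX => U V /tbasis[n [a [i [xa sub]]]] yV.
exists y; split; last exact: nbhs_singleton yV.
by apply: sub; have [] := H _ _ _ xa.
Qed.

Lemma towers_nbhs n x a i : located (t n) x a i -> nbhs x (nth set0 (t n a) i).
Proof.
move=> xa; apply: open_nbhs_nbhs; split; last by case: xa.
by have [] := ts_clopen (ts n) (located_size xa).
Qed.

Lemma image_x0 : phi x0 = x1.
Proof. by apply: x1U => n; apply: (ts_top (ts n)); exact: x0P. Qed.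

Lemma towers_bottom n m x : n <= m -> bottom_of (t m) x -> bottom_of (t n) x.
Proof.
elim: m => [|m IHm]; first by rewrite leqn0 => /eqP ->.
by rewrite leq_eqVlt => /orP[/eqP -> //|]; rewrite ltnS => /IHm h /botS/h.
Qed.

(** The bottom floors shrink to the point [x1]. *)
Lemma bottoms_shrink n : exists m, forall x a i, bottom_of (t m) x ->
  located (t n) x1 a i -> located (t n) x a i.
Proof.
have [b [k xb]] := tp_cover (tp n) x1.
pose C m := bottom_of (t m) `&` [set z | ~ located (t n) z b k].
have [|||M H] := @nested_empty _ C cX.
- move=> m; apply: closedI; first exact: closed_bottom (ts m).
  apply: (saturated_closed (ts n)) => x y a i xa ya nx yk; apply: nx.
  by have [<- <-] := tp_uniq (tp n) ya yk.
- by move=> m x [/botS].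
- move=> [x Cx]; have xE : x = x1 by apply: x1U => m; have [] := Cx m.
  by have [_] := Cx 0; rewrite xE.
exists M => x a i xM /(tp_uniq (tp n) xb)[<- <-].
by apply: contrapT => nx; apply: (H M x).
Qed.

(** At a point that is off the top floors at some level, [phi] climbs a floor
    together with a neighbourhood of the point. The remaining point is [x0], near
    which [phi] takes values in small bottom floors. *)
Lemma towers_cont : continuous phi.
Proof.
move=> x U /tbasis[n [a [i [xa sub]]]].
have [H|/existsNP[k nt]] := pselect (forall n, top_of (t n) x).
  have xE := x0U H; have [m mP] := bottoms_shrink n.
  have [b xb] := x0P m.
  apply: (@filterS _ (nbhs x) _ _ _ _ (towers_nbhs (n := m) (a := b) _)).
    move=> z zb; apply: sub.
    have [] // : located (t n) (phi z) a i.
    apply: mP; last by rewrite -image_x0 -xE.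
    apply: (ts_top (ts m)); exists b; split; last exact: zb.
    exact: located_size xb.
  by rewrite xE.
have [b [j xb]] := tp_cover (tp (maxn n k)) x.
apply: (@filterS _ (nbhs x) _ _ _ _ (towers_nbhs xb)) => z zb; apply: sub.
have {}zb : located (t (maxn n k)) z b j by split=> //; exact: located_size xb.
have [lt|/(proj2 (towers_finer (leq_maxr n k)))//] := located_succ xb.
have [] // := proj1 (towers_finer (leq_maxl n k)) (phi x) (phi z) b j.+1 a i.
- exact: (ts_step (ts _) xb).
- exact: (ts_step (ts _) zb).
Qed.

(** The image of [phi] is closed, so it suffices to approximate [y]. Any floor
    other than a bottom floor contains points of the image, and a point on the
    bottom floors at all levels is the image of [x0]. *)
Lemma towers_surj y : exists x, phi x = y.
Proof.
have cl : closed (phi @` setT).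
  apply: compact_closed => //; apply: continuous_compact => //.
  by apply: continuous_subspaceT; exact: towers_cont.
suff [x _ <-] : (phi @` setT) y by exists x.
apply: cl => U /tbasis[n [a [i [ya sub]]]].
have [H|/existsNP[k nb]] := pselect (forall n, bottom_of (t n) y).
  exists y; split; last by apply: sub; case: ya.
  by exists x0 => //; rewrite image_x0 (x1U H).
have [b [[|j] yb]] := tp_cover (tp (maxn n k)) y.
  by case: nb; apply: (towers_bottom (leq_maxr n k)); exists b.
have [x xb] := tp_ne (tp _) (ltnW (located_size yb)).
have fb := ts_step (ts _) xb (located_size yb).
exists (phi x); split; first by exists x.
by apply: sub; have [] := proj1 (towers_finer (leq_maxl n k)) _ _ _ _ _ _ yb fb ya.
Qed.

Lemma towers_inj : injective phi.
Proof.
move=> x x' E.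
have [H|/existsNP[k nb]] := pselect (forall n, bottom_of (t n) (phi x)).
  have xE : x = x0 by apply: x0U => n; exact: (bottom_back (ts n)).
  have x'E : x' = x0 by apply: x0U => n; apply: (bottom_back (ts n)); rewrite -E.
  by rewrite xE x'E.
apply: towers_sep => n a i xa.
have [b [[|j] yb]] := tp_cover (tp (maxn n k)) (phi x).
  by case: nb; apply: (towers_bottom (leq_maxr n k)); exists b.
have xb := located_backS (ts _) yb.
have x'b : located (t (maxn n k)) x' b j by apply: (located_backS (ts _)); rewrite -E.
exact: (proj1 (towers_finer (leq_maxl n k))) xb x'b xa.
Qed.

Lemma towers_homeo : homeomorphism phi.
Proof.
split; first exact: towers_cont.
have /choice[g gP] := towers_surj; exists g; split=> //; last first.
  by move=> x; apply: towers_inj; rewrite gP.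
apply/continuous_closedP => A' cA.
have -> : g @^-1` A' = phi @` A'.
  apply/seteqP; split=> [y /= gy|_ [x xA <-]]; first by exists (g y).
  by rewrite /preimage /= (_ : g (phi x) = x) //; apply: towers_inj; rewrite gP.
apply: compact_closed => //; apply: continuous_compact.
  by apply: continuous_subspaceT; exact: towers_cont.
exact: subclosed_compact cA cX _.
Qed.

Lemma invariant_top n (N : set X) x : (forall z, N z -> N (phi z)) -> N x ->
  exists y, N y /\ top_of (t n) y.
Proof.
move=> Nphi; have [a [i xa]] := tp_cover (tp n) x.
have [k] := ubnP (size (t n a) - i); elim: k x i xa => // k IHk x i xa le Nx.
have [lt|xt] := located_succ xa; last by exists x.
apply: (IHk (phi x) i.+1); [exact: ts_step (ts n) _ _ _ xa lt| |exact: Nphi].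
by rewrite subnS; move: le; rewrite -(subnSK (ltnW lt)) subnS.
Qed.

(** A closed invariant set meets the top floors at each level, hence contains
    [x0]. *)
Lemma invariant_x0 (N : set X) : closed_invariant phi N -> N x0.
Proof.
move=> [cN [x Nx] iN].
have [||n|y yP] := @compact_nested _ (fun n => N `&` top_of (t n)) cX.
- by move=> n; apply: closedI => //; exact: closed_top (ts n).
- by move=> n y [Ny /(proj2 (finS n))].
- have Nphi z : N z -> N (phi z) by move=> Nz; rewrite -iN; exists z.
  by have [y [Ny yt]] := invariant_top n Nphi Nx; exists y.
by rewrite -(x0U (x := y)); [have [] := yP 0|move=> n; have [] := yP n].
Qed.

Lemma towers_minimal : exists2 M, unique (minimal_subset phi) M & M x0.
Proof.
pose M : set X := \bigcap_(N in [set N | closed_invariant phi N]) N.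
have sub N : closed_invariant phi N -> M `<=` N by move=> iN x; apply.
have Mx0 : M x0 by move=> N; exact: invariant_x0.
have iM : closed_invariant phi M.
  split; first by apply: closed_bigI => N [].
    by exists x0.
  apply/seteqP; split=> [_ [x Mx <-] N iN|y My].
    by have [_ _ <-] := iN; exists x => //; exact: Mx.
  have [x xy] := towers_surj y; exists x => // N iN.
  have [_ _ E] := iN; have := My N iN; rewrite -E -xy => -[x' Nx' /towers_inj].
  by move=> <-; rewrite E.
exists M => //; split.
  by split=> // N iN NM; apply/seteqP; split=> //; exact: sub.
move=> M' [iM' minM'].
by rewrite (minM' M iM) //; exact: sub.
Qed.
End FromTowers.

Lemma towers_kr (X : topologicalType) (phi : X -> X) (A : finType)
    (t : A -> seq (set X)) (P : towers X) x0 :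
  (forall y, exists x, phi x = y) -> tower_system phi t -> names t P ->
  top_of t x0 -> kr_partition phi x0 P.
Proof.
move=> surj ts tP x0t; have tp := ts_part ts.
split.
- by move=> S /tP[a <-]; exact: tp_size tp a.
- move=> Z /(names_cells _ tP)[a [i [ia <-]]].
  by have [x [_ xa]] := tp_ne tp ia; exists x.
- move=> Z /(names_cells _ tP)[a [i [ia <-]]]; exact: ts_clopen ts _ _ ia.
- move=> x; have [a [i [ia xa]]] := tp_cover tp x.
  by exists (nth set0 (t a) i) => //; apply/(names_cells _ tP); exists a, i.
- move=> S T i j /tP[a <-] /tP[b <-] ia jb [x [xa xb]].
  by have [-> ->] := tp_uniq tp (conj ia xa) (conj jb xb).
- move=> S i /tP[a <-] lt; apply/seteqP; split=> [_ [x xa <-]|y ya].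
    by have [] := ts_step ts (conj (ltnW lt) xa) lt.
  have [x xy] := surj y; exists x => //.
  by have [] // := located_backS ts (x := x) (a := a) (i := i); split=> //; rewrite xy.
- exact/(names_tops _ tP (tp_size tp)).
- apply/seteqP; split=> [_ [x xt <-]|y].
    by apply/(names_bottoms _ tP (tp_size tp))/(ts_top ts)/(names_tops _ tP (tp_size tp)).
  move/(names_bottoms _ tP (tp_size tp)) => yb; have [x xy] := surj y.
  exists x => //; apply/(names_tops _ tP (tp_size tp))/(bottom_back ts).
  by rewrite xy.
Qed.

(** * The path space of a diagram *)

(** The index of an element of a sorted sequence is the number of elements below
    it. *)
Lemma index_sorted (T : eqType) (r : rel T) (s : seq T) x :
  {in s & &, transitive r} -> {in s &, antisymmetric r} ->
  uniq s -> sorted r s -> x \in s ->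
  index x s = count (fun y => (y != x) && r y x) s.
Proof.
elim: s => // a s IHs rt ra /= /andP[as_ us] srt.
have sub : {subset s <= a :: s} by move=> y ys; rewrite inE ys orbT.
have rt' : {in s & &, transitive r}.
  by move=> y z w ys zs ws; apply: rt; exact: sub.
have amin : all (r a) s.
  apply: (order_path_min_in (P := mem (a :: s))) srt => //.
  by apply/allP => y; rewrite !inE.
rewrite inE eq_sym; case: eqVneq => [E|ax] /= xs.
  subst x; rewrite ?eqxx /= ?add0n; apply/esym/eqP; rewrite -leqn0 leqNgt -has_count.
  apply/hasPn => y ys; rewrite negb_and negbK orbC -implybE; apply/implyP => ya.
  by apply/eqP/ra; [exact: sub|exact: mem_head|rewrite ya (allP amin)].
rewrite (allP amin) //= add1n; congr _.+1; apply: IHs => //.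
- by move=> y z ys zs; apply: ra; exact: sub.
- exact: path_sorted srt.
Qed.

Section Paths.
Variables (D : diagram) (wD : is_bratteli D).

(** The number of paths from level 0 to a vertex. *)
Definition vheight n : vtx D n -> nat := height (epath D 0 n) (fun=> 1).

Lemma vheight0 v : vheight (n := 0) v = 1.
Proof. exact: (@height_diag (vtx D) 0 (fun=> 1) v). Qed.

Lemma vheightS n v : vheight (n := n.+1) v = height (dedge D n) (@vheight n) v.
Proof. by rewrite /vheight /= height_comp. Qed.

Lemma vheight_gt0 n (v : vtx D n) : 0 < vheight v.
Proof.
elim: n v => [|n IHn] v; first by rewrite vheight0.
rewrite vheightS; apply/(@height_gt0 _ _ (dedge D n) _ IHn). exact (dedge_rng wD v).
Qed.

Lemma vtx0_eq (v w : vtx D 0) : v = w.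
Proof. by have /fintype_le1P/(_ w)/(_ v) := eq_leq (vtx0 wD). Qed.

(** The rank of the initial segment of length [n] of [x] among the paths from
    level 0 with the same range, counted from 0. *)
Definition pos n (x : path_space D) := \sum_(i < n) offset (@vheight i) (x i).

Lemma posS n x : pos n.+1 x = offset (@vheight n) (x n) + pos n x.
Proof. by rewrite /pos big_ord_recr /= addnC. Qed.

Lemma cylinder_pos n (p : epath D 0 n) x : cylinder p x ->
  offset (fun=> 1) p = pos n x /\ rng _ p = src _ (x n).
Proof.
elim: n p => [|n IHn] p.
  move=> _; rewrite /pos big_ord0; split; first exact: (@offset_diag (vtx D) 0).
  exact: vtx0_eq.
move=> /= [/IHn[E _] xn]; rewrite posS -E xn -pthP xn.
by split; first exact: (@offset_comp _ _ _ (epath D 0 n) (dedge D n)).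
Qed.

Lemma prefix_ex n (x : path_space D) : exists p : epath D 0 n, cylinder p x.
Proof.
elim: n => [|n [p px]].
  by exists (exist _ (src _ (x 0), src _ (x 0)) (eqxx _) : ediag (vtx D) 0 0).
have px' : rng (epath D 0 n) p == src (dedge D n) (x n).
  by have [_ ->] := cylinder_pos px.
by exists (exist _ (p, x n) px' : epath D 0 n \;e dedge D n).
Qed.

Lemma cylinder_uniq n (p q : epath D 0 n) x : cylinder p x -> cylinder q x -> p = q.
Proof.
move=> /cylinder_pos[op rp] /cylinder_pos[oq rq].
have r : rng _ p = rng _ q by rewrite rp rq.
have [] // := @offset_uniq _ _ _ (fun=> 1) p q 0 0 r => //.
by rewrite op oq.
Qed.

Lemma src_full n (v : vtx D n) : exists e : dedge D n, src _ e = v.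
Proof. exact (dedge_src wD v). Qed.

Lemma path_extend n (z : forall i, dedge D i) :
  (forall i, i.+1 < n -> rng _ (z i) = src _ (z i.+1)) ->
  exists x : path_space D, forall i, i < n -> x i = z i.
Proof.
(* Follow [z] up to level [n], then any edge issued from the current vertex. *)
move=> zP; pose nx m (v : vtx D m) := sval (cid (src_full v)).
have nxP m (v : vtx D m) : src _ (nx m v) = v := svalP (cid (src_full v)).
pose g := fix g m : dedge D m := if m is k.+1 return dedge D m then
  if k.+1 < n then z k.+1 else nx k.+1 (rng _ (g k)) else z 0.
have gz m : m < n -> g m = z m by case: m => //= m ->.
have gP m : rng _ (g m) = src _ (g m.+1).
  rewrite /=; have [lt|le] := ltnP m.+1 n; last by rewrite nxP.
  by rewrite gz ?zP //; exact: ltnW.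
by exists (PathSpace gP).
Qed.

(** Any finite path followed by an edge extends to an infinite path. *)
Lemma cylinder_ext n (p : epath D 0 n) (e : dedge D n) : rng _ p = src _ e ->
  exists x : path_space D, cylinder p x /\ x n = e.
Proof.
elim: n p e => [|n IHn] p e pe.
  have [z _] : exists z : forall i, dedge D i, True.
    have ne i : exists e : dedge D i, True.
      by have /card_gt0P[e' _] := dedge_ne wD i; exists e'.
    by exists (fun i => sval (cid (ne i))).
  have [|x xz] := @path_extend 1 (dfwith z 0 e); first by [].
  by exists x; rewrite xz // dfwithin.
have [x [px xn]] := IHn (val p).1 (val p).2 (eqP (valP p)).
have [|y yx] := @path_extend n.+2 (dfwith x n.+1 e).
  move=> i; rewrite ltnS ltnS leq_eqVlt => /orP[/eqP ->|lt].
    by rewrite dfwithin dfwithout ?neq_ltn ?ltnSn ?orbT // xn.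
  by rewrite !dfwithout ?neq_ltn ?ltnS ?lt ?(ltnW lt) ?orbT // pthP.
have yx' i : i <= n -> y i = x i.
  by move=> le; rewrite yx ?dfwithout ?neq_ltn ?ltnS ?le ?orbT // ltnW.
exists y; split; last by rewrite yx // dfwithin.
split; last by rewrite yx'.
by apply/(cylinderP y px) => i lt; apply: yx'; exact: ltnW.
Qed.

Lemma cylinder_ne n (p : epath D 0 n) : exists x : path_space D, cylinder p x.
Proof.
have [e ep] := src_full (rng _ p); have [|x [px _]] := @cylinder_ext n p e => //.
by exists x.
Qed.

(** The paths from level 0 to [v], in increasing order. *)
Definition vlist n (v : vtx D n) := sort (ele (epath D 0 n))
  [seq p <- enum (epath D 0 n) | rng _ p == v].

Lemma mem_vlist n (v : vtx D n) p : (p \in vlist v) = (rng _ p == v).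
Proof. by rewrite mem_sort mem_filter mem_enum andbT. Qed.

Lemma vlist_uniq n (v : vtx D n) : uniq (vlist v).
Proof. by rewrite sort_uniq filter_uniq // enum_uniq. Qed.

Lemma size_vlist n (v : vtx D n) : size (vlist v) = vheight v.
Proof.
by rewrite size_sort size_filter -sum1_count big_enum_cond.
Qed.

Lemma index_vlist n (p : epath D 0 n) :
  index p (vlist (rng _ p)) = offset (fun=> 1) p.
Proof.
rewrite (@index_sorted _ (ele (epath D 0 n))) ?mem_vlist ?vlist_uniq ?eqxx //.
- rewrite (permP (permEl (perm_sort _ _))) count_filter -sum1_count big_enum_cond.
  apply: eq_bigl => q; rewrite /= -[_ && ele _ q p]/(elt q p) andbC.
  by case: eqP => // ne; apply/esym/negbTE/negP => /elt_rng.
- by move=> x y z _ _ _; exact: ele_trans.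
- by move=> x y _ _; exact: ele_anti.
- apply: (@sort_sorted_in _ (fun q => rng _ q == rng _ p)).
    by move=> x y /eqP xp /eqP yp; rewrite ele_cmp xp yp.
  by apply/allP => q; rewrite mem_filter => /andP[].
Qed.

(** The tower of cylinders over the vertex [v]. *)
Definition vcells n (v : vtx D n) : seq (set (path_space D)) :=
  [seq cylinder p | p <- vlist v].
Arguments vcells n v : clear implicits.

Lemma size_vcells n (v : vtx D n) : size (vcells n v) = vheight v.
Proof. by rewrite size_map size_vlist. Qed.

Lemma located_vcells n x (v : vtx D n) i :
  located (vcells n) x v i <-> src _ (x n) = v /\ pos n x = i.
Proof.
have [p px] := prefix_ex n x; have [op rp] := cylinder_pos px.
split=> [[]|[<- <-]].
  rewrite size_map => iv; rewrite (nth_map p) // => qx.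
  have [oq rq] := cylinder_pos qx; have := mem_nth p iv.
  rewrite mem_vlist rq => /eqP E; split=> //.
  by rewrite -oq -index_vlist rq E index_uniq // vlist_uniq.
have pv : p \in vlist (src _ (x n)) by rewrite mem_vlist rp.
have E : index p (vlist (src _ (x n))) = pos n x by rewrite -rp index_vlist op.
split; first by rewrite size_map -E index_mem.
by rewrite (nth_map p) -?E ?index_mem // nth_index.
Qed.

Lemma locatedI n x : located (vcells n) x (src _ (x n)) (pos n x).
Proof. exact/located_vcells. Qed.

Lemma pos_lt n x : pos n x < vheight (src _ (x n)).
Proof. by have [] := locatedI n x; rewrite size_vcells. Qed.

Lemma vcells_tp n : tower_partition (vcells n).
Proof.
split.
- by move=> v; rewrite size_vcells vheight_gt0.
- move=> v i; rewrite size_map => iv.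
  have [p0 _] : exists p0 : epath D 0 n, p0 \in vlist v.
    by case: (vlist v) iv => // p s _; exists p; rewrite mem_head.
  have [x px] := cylinder_ne (nth p0 (vlist v) i).
  by exists x; split; rewrite ?size_map // (nth_map p0).
- by move=> x; exists (src _ (x n)), (pos n x); exact: locatedI.
- by move=> x v w i j /located_vcells[<- <-] /located_vcells[<- <-].
Qed.

Lemma vcells_inj n : injective (vcells n).
Proof.
move=> v w E; have [x [xs xv]] := tp_ne (vcells_tp n) (tp_size (vcells_tp n) v).
have [] // := tp_uniq (vcells_tp n) (a := v) (b := w) (conj xs xv) (i := 0) (j := 0).
by split; rewrite -E.
Qed.

Lemma vcells_stacks n : stacks (vcells n) (dedge D n) (vcells n.+1).
Proof.
have E : (fun v => size (vcells n v)) =1 @vheight n.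
  by move=> v; rewrite size_vcells.
split=> [v|e i]; first by rewrite size_vcells vheightS; apply/esym/height_eq.
rewrite (offset_eq E) E => ie x xe.
have lt : offset (@vheight n) e + i < size (vcells n.+1 (rng _ e)).
  rewrite size_vcells vheightS; apply: leq_trans (offset_height _ e).
  by rewrite ltn_add2l.
have /located_vcells[re] : located (vcells n.+1) x (rng _ e)
  (offset (@vheight n) e + i) by [].
rewrite posS => oE; rewrite -(pthP x n) in re.
have [ee ii] := offset_uniq re (pos_lt n x) ie oE.
by have [_] // : located (vcells n) x (src _ e) i by apply/located_vcells; rewrite -ee.
Qed.

Lemma open_pathE (A : set (path_space D)) : open A = path_open A.
Proof. by []. Qed.

Lemma cylinder_open n (p : epath D 0 n) : open (cylinder p).
Proof. by rewrite open_pathE => x px; exists n, p; split. Qed.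

Lemma cylinder_clopen n (p : epath D 0 n) : clopen (cylinder p).
Proof.
split; first exact: cylinder_open.
rewrite -openC open_pathE => x npx; have [q qx] := prefix_ex n x.
by exists n, q; split=> // y qy py; apply: npx; rewrite (cylinder_uniq py qy).
Qed.

Lemma vcells_clopen n (v : vtx D n) i :
  i < size (vcells n v) -> clopen (nth set0 (vcells n v) i).
Proof.
rewrite size_map => iv.
have [p0 _] : exists p0 : epath D 0 n, p0 \in vlist v.
  by case: (vlist v) iv => // p s _; exists p; rewrite mem_head.
by rewrite (nth_map p0) //; exact: cylinder_clopen.
Qed.

Lemma nbhs_cylinder (x : path_space D) U : nbhs x U ->
  exists n (p : epath D 0 n), cylinder p x /\ cylinder p `<=` U.
Proof.
rewrite nbhsE => -[V [+ Vx] VU]; rewrite open_pathE => oV; have [n [p [px pV]]] := oV x Vx.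
by exists n, p; split=> //; exact: subset_trans VU.
Qed.

Lemma vcells_basis (x : path_space D) U : nbhs x U ->
  exists n v i, located (vcells n) x v i /\ nth set0 (vcells n v) i `<=` U.
Proof.
move=> /nbhs_cylinder[n [p [px pU]]]; exists n, (src _ (x n)), (pos n x).
split=> [|y yE]; first exact: locatedI.
apply: pU; have [q qy] := prefix_ex n y.
have [ly Ey] := locatedI n x.
have /located_vcells[sy py] : located (vcells n) y (src _ (x n)) (pos n x) by [].
have [oq rq] := cylinder_pos qy; have [op rp] := cylinder_pos px.
have r : rng _ p = rng _ q by rewrite rp rq sy.
have [] // := @offset_uniq _ _ _ (fun=> 1) p q 0 0 r => //; last by move=> ->.
by rewrite op oq py.
Qed.

(** An ultrafilter on the path space concentrates, at each level, on the paths
    through a single edge, as there are finitely many; it converges to the path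
    made of these edges. *)
Lemma path_compact : compact [set: path_space D].
Proof.
rewrite compact_ultra => F FU _.
have H n : exists e : dedge D n, F [set x : path_space D | x n = e].
  apply: contrapT => /forallNP nF.
  have : F [set x : path_space D | forall e : dedge D n, x n <> e].
    apply: filter_forall => e.
    by have [/nF//|] := in_ultra_setVsetC [set x : path_space D | x n = e] FU.
  by move=> /filter_ex[x /(_ (x n))].
pose e n := sval (cid (H n)).
have eF n : F [set x : path_space D | x n = e n] := svalP (cid (H n)).
have eP n : rng _ (e n) = src _ (e n.+1).
  have /filter_ex[x [xn xn']] : F ([set x : path_space D | x n = e n] `&`
      [set x : path_space D | x n.+1 = e n.+1]) by apply: filterI; exact: eF.
  by rewrite -xn -xn'; exact: pthP.
exists (PathSpace eP); split=> // U /nbhs_cylinder[n [p [px pU]]].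
apply: filterS pU _.
have : F [set x : path_space D | forall i : 'I_n, x i = e i] by apply: filter_forall => i; exact: eF.
by apply: filterS => x xe; apply/(cylinderP x px) => i lt; exact: (xe (Ordinal lt)).
Qed.

Lemma path_totdisc : totally_disconnected [set: path_space D].
Proof.
apply: zero_dimension_totally_disconnected => x y xy.
have [n nn] : exists n, x n <> y n.
  apply: contrapT => /forallNP H; move/eqP: xy; apply; apply: path_eq => n.
  exact: contrapT (H n).
have [p px] := prefix_ex n.+1 x; exists (cylinder p); split=> //.
  exact: cylinder_clopen.
by move=> [_ py]; move: px => [_ px]; apply: nn; rewrite px py.
Qed.

Section Metric.
Variable R : realType.

(** The inverse of [n + 1], where [n] is the first level at which the paths
    differ; 0 if they are equal. *)
Definition path_dist (x y : path_space D) : R :=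
  if pselect (exists n, x n != y n) is left h then (ex_minn h).+1%:R^-1%R else 0%R.

Lemma path_dist_ge (x y : path_space D) n : x n != y n -> (n.+1%:R^-1 <= path_dist x y)%R.
Proof.
move=> xyn; rewrite /path_dist; case: pselect => [h|[]]; last by exists n.
case: ex_minnP => m _ /(_ n xyn) mn.
by rewrite lef_pV2 ?posrE ?ltr0n // ler_nat ltnS.
Qed.

Lemma path_dist_lt (x y : path_space D) n :
  (path_dist x y < n.+1%:R^-1)%R <-> forall i, i <= n -> x i = y i.
Proof.
split=> [lt i le|H].
  apply/eqP/negPn/negP => /path_dist_ge; rewrite leNgt => /negP[].
  by apply: lt_le_trans lt _; rewrite lef_pV2 ?posrE ?ltr0n // ler_nat ltnS.
rewrite /path_dist; case: pselect => [h|_]; last by rewrite invr_gt0 ltr0n.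
case: ex_minnP => m xym _; rewrite ltf_pV2 ?posrE ?ltr0n // ltr_nat ltnS ltnNge.
by apply: contra xym => /H ->.
Qed.

Lemma path_dist_ge0 x y : (0 <= path_dist x y)%R.
Proof. by rewrite /path_dist; case: pselect => // h; rewrite invr_ge0 ler0n. Qed.

Lemma path_dist_le (x y : path_space D) (r : R) : (0 <= r)%R ->
  (forall n, x n != y n -> (n.+1%:R^-1 <= r)%R) -> (path_dist x y <= r)%R.
Proof.
move=> r0 H; rewrite /path_dist; case: pselect => // h.
by case: ex_minnP => m /H.
Qed.

Lemma path_metrizable : metrizable R (path_space D).
Proof.
exists path_dist; split=> [x y|x y|x y z|A].
- apply/eqP/eqP => [d0|->].
    apply: path_eq => n; apply/eqP/negPn/negP => /path_dist_ge.
    by rewrite d0 leNgt invr_gt0 ltr0n.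
  by apply/eqP; rewrite eq_le path_dist_ge0 path_dist_le // => n /eqP.
- apply/eqP; rewrite eq_le; apply/andP; split; apply: path_dist_le => [|n ne];
    rewrite ?path_dist_ge0 //; apply: path_dist_ge; by rewrite eq_sym.
- apply: path_dist_le => [|n ne]; first by rewrite addr_ge0 ?path_dist_ge0.
  have [E|xy] := eqVneq (x n) (y n).
    apply: le_trans (path_dist_ge (x := y) (y := z) (n := n) _) _; first by rewrite -E.
    by rewrite lerDr path_dist_ge0.
  by apply: le_trans (path_dist_ge xy) _; rewrite lerDl path_dist_ge0.
- rewrite open_pathE; split=> [oA x Ax|H x Ax].
    have [n [p [px pA]]] := oA x Ax; exists (n.+1%:R^-1)%R.
      by rewrite invr_gt0 ltr0n.
    move=> y /path_dist_lt xy; apply: pA; apply/(cylinderP y px) => i lt.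
    by rewrite xy // ltnW.
  have [e e0 eA] := H x Ax.
  have [n ne] : exists n, (n.+1%:R^-1 < e)%R.
    exists (Num.truncn e^-1); rewrite invf_plt ?posrE ?ltr0n //.
    by rewrite truncnS_gt.
  have [p px] := prefix_ex n.+1 x; exists n.+1, p; split=> // y py.
  apply: eA => /=; apply: lt_trans ne; apply/path_dist_lt => i le.
  by apply/esym; apply: (iffLR (cylinderP y px)).
Qed.
End Metric.
End Paths.

(** * The system of a properly ordered diagram *)

Lemma offset_esucc (S T : finType) (F : edgeset S T) (h : S -> nat) (e e' : F) :
  esucc e e' -> offset h e' = offset h e + h (src F e).
Proof.
move=> [ee' emn]; rewrite -offsetE; apply: eq_bigl => x.
apply/idP/idP => [xe'|xe]; last exact: ele_elt_trans ee'.
apply/negPn/negP => /negbTE nx.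
have ex : elt e x by apply: nele_elt; rewrite // (elt_rng xe') (elt_rng ee').
by have := elt_ele_trans xe' (emn x ex); rewrite /elt eqxx.
Qed.

Section Positions.
Variables (D : diagram) (wD : is_bratteli D).

Lemma max_posP (x : path_space D) n :
  (pos n x).+1 = vheight (src _ (x n)) <-> forall i, i < n -> emax (x i).
Proof.
have v0 m := @vheight_gt0 _ wD m.
elim: n => [|n [IH1 IH2]]; first by rewrite vheight0 /pos big_ord0.
rewrite posS -pthP vheightS -addnS; split=> [E|H].
  have o := offset_height (@vheight D n) (x n).
  have pv : (pos n x).+1 = vheight (src _ (x n)).
    apply/eqP; rewrite eqn_leq; apply/andP; split; first exact: pos_lt wD n x.
    by rewrite -(leq_add2l (offset (@vheight D n) (x n))) E.
  move=> i; rewrite ltnS leq_eqVlt => /orP[/eqP ->|]; last exact: IH1.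
  by apply: (emax_offset (v0 n)); rewrite -pv.
rewrite IH2; last by move=> i lt; apply: H; exact: ltnW.
exact/offset_emax/H.
Qed.

Lemma min_posP (x : path_space D) n :
  pos n x = 0 <-> forall i, i < n -> emin (x i).
Proof.
have v0 m := @vheight_gt0 _ wD m.
elim: n => [|n [IH1 IH2]]; first by rewrite /pos big_ord0.
rewrite posS; split=> [/eqP|H].
  rewrite addn_eq0 => /andP[/eqP E /eqP/IH1 H] i.
  rewrite ltnS leq_eqVlt => /orP[/eqP ->|]; last exact: H.
  exact: (emin_offset (v0 n) E).
rewrite IH2 ?addn0; last by move=> i lt; apply: H; exact: ltnW.
exact/offset_emin/H.
Qed.

Lemma vcells_top (x : path_space D) n :
  top_of (@vcells D n) x <-> forall i, i < n -> emax (x i).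
Proof.
split=> [[v /(located_vcells wD)[<- E]]|/max_posP E].
  by apply/max_posP; rewrite E size_vcells prednK // vheight_gt0.
exists (src _ (x n)); apply/(located_vcells wD).
by rewrite size_vcells -E.
Qed.

Lemma vcells_bottom (x : path_space D) n :
  bottom_of (@vcells D n) x <-> forall i, i < n -> emin (x i).
Proof.
split=> [[v /(located_vcells wD)[_ E]]|/min_posP E]; first exact/min_posP.
by exists (src _ (x n)); apply/(located_vcells wD).
Qed.
End Positions.

Section VershikSystem.
Variable B : OBDpo.
Let D : diagram := bdiag (sval B).
Let wD : is_bratteli D := bratteliP (sval B).

Lemma vershikP (x : path_space D) : vershik_rel x (@vershik B x).
Proof. exact: (svalP (cid (vershik_total x))). Qed.

Lemma xmaxP : max_path (xmax B).
Proof. by rewrite /xmax; case: cid => ? []. Qed.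

Lemma xminP : min_path (xmin B).
Proof. by rewrite /xmin; case: cid => ? []. Qed.

Lemma emin_xmin (x : path_space D) : min_path x -> x = xmin B.
Proof. by move=> h; rewrite /xmin; case: cid => y [_ yP] /=; rewrite (yP _ h). Qed.

(** The Vershik map raises the rank by one, unless the rank is maximal. *)
Lemma vershik_pos n (x : path_space D) : (pos n x).+1 < vheight (src (dedge D n) (x n)) ->
  src (dedge D n) (vershik x n) = src (dedge D n) (x n) /\
  pos n (vershik x) = (pos n x).+1.
Proof.
move=> lt; have nm : ~ forall i, i < n -> emax (x i).
  by move/(max_posP wD) => E; rewrite E ltnn in lt.
case: (vershikP x) => [[xE _]|[k [k1 k2 k3 k4 k5]]].
  by case: nm => i _; rewrite xE; exact: xmaxP.
set y := vershik x in k3 k4 k5 *.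
have {nm} kn : k < n by rewrite ltnNge; apply/negP => nk; apply: nm => i /leq_trans/(_ nk)/k1.
have rk : rng _ (y k) = rng _ (x k) by have [/elt_rng ->] := k3.
elim: n kn {lt} => // n IHn; rewrite ltnS leq_eqVlt => /orP[/eqP <-|kn].
  rewrite -!pthP rk; split=> //; rewrite !posS.
  rewrite (iffRL (min_posP wD y k) k4) addn0 (offset_esucc _ k3).
  by rewrite -(iffRL (max_posP wD x k) k1) addnS.
have [_ IHp] := IHn kn.
by rewrite -!pthP !posS IHp k5 // addnS.
Qed.

Lemma vershik_top n (x : path_space D) : (forall i, i < n -> emax (x i)) ->
  forall i, i < n -> emin (@vershik B x i).
Proof.
move=> H i lt; case: (vershikP x) => [[_ ->]|[k [k1 k2 _ k4 _]]].
  exact: xminP.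
apply: k4; apply: leq_trans lt _; rewrite leqNgt; apply/negP => kn.
by apply: k2; exact: H.
Qed.

Lemma vcells_ts n : tower_system (@vershik B) (@vcells D n).
Proof.
split; first exact: vcells_tp wD n.
- exact: vcells_clopen wD n.
- move=> x v i /(located_vcells wD)[<- <-]; rewrite size_vcells => lt.
  exact/(located_vcells wD)/vershik_pos.
- by move=> x /(vcells_top wD)/vershik_top/(vcells_bottom wD).
Qed.

Let vtop n (x : path_space D) : top_of (@vcells D n) x <-> forall i, i < n -> emax (x i) :=
  vcells_top wD x n.
Let vbot n (x : path_space D) : bottom_of (@vcells D n) x <-> forall i, i < n -> emin (x i) :=
  vcells_bottom wD x n.

Lemma vcells_x0 n : top_of (@vcells D n) (xmax B).
Proof. by apply/vtop => i _; exact: xmaxP. Qed.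

Lemma vcells_x0U (x : path_space D) : (forall n, top_of (@vcells D n) x) -> x = xmax B.
Proof. by move=> H; apply: emax_xmax => n; apply: (iffLR (vtop n.+1 x)). Qed.

Lemma vcells_x1U (x : path_space D) : (forall n, bottom_of (@vcells D n) x) -> x = xmin B.
Proof. by move=> H; apply: emin_xmin => n; apply: (iffLR (vbot n.+1 x)). Qed.

Lemma vcells_finer n : finer (@vcells D n) (@vcells D n.+1).
Proof. exact: stacks_finer (vcells_tp wD _) (vcells_tp wD _) (vcells_stacks wD n). Qed.

Lemma vcells_botS n (x : path_space D) :
  bottom_of (@vcells D n.+1) x -> bottom_of (@vcells D n) x.
Proof. exact: stacks_bottom (vcells_tp wD _) (vcells_stacks wD n). Qed.

Lemma vpart_names n : names (@vcells D n) (@vpart B n).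
Proof.
move=> S; split=> [/imfsetP[v _ ->]|[v <-]]; first by exists v.
by apply/imfsetP; exists v.
Qed.

Lemma Vsys_sds (R : realType) : is_sds R (Vsys B).
Proof.
have cX : compact [set: path_space D] := @path_compact D; have mX := path_metrizable wD R.
have hX := metrizable_hausdorff mX; have bX := vcells_basis wD.
have surj := towers_surj cX hX vcells_ts vcells_finer vcells_botS bX
  vcells_x0 vcells_x0U vcells_x1U.
have tp n := vcells_tp wD n.
have topsE n x : tops (@vpart B n) x <-> top_of (@vcells D n) x.
  exact: names_tops x (@vpart_names n) (tp_size (tp n)).
split.
  split=> //.
  - exact: path_totdisc wD.
  - exact: (towers_homeo cX hX vcells_ts vcells_finer vcells_botS bX
      vcells_x0 vcells_x0U vcells_x1U).
  - exact: (towers_minimal cX hX vcells_ts vcells_finer vcells_botS bX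
      vcells_x0 vcells_x0U vcells_x1U).
split.
- by move=> n; exact: towers_kr surj (vcells_ts n) (@vpart_names n) (vcells_x0 n).
- apply/fsetP => S; rewrite inE; apply/idP/eqP => [/vpart_names[v <-]|->].
    apply: (@eq_from_nth _ set0) => [|i]; rewrite size_vcells vheight0 // ltnS leqn0.
    move=> /eqP ->; apply/seteqP; split=> // x _ /=.
    have [] // : located (@vcells D 0) x v 0.
    apply/(located_vcells wD); split; first exact: vtx0_eq wD _ _.
    by rewrite /pos big_ord0.
  have [v _] := tp_cover (tp 0) (xmax B); apply/vpart_names; exists v.
  apply: (@eq_from_nth _ set0) => [|i]; rewrite size_vcells vheight0 // ltnS leqn0.
  move=> /eqP ->; apply/seteqP; split=> // x _ /=.
  have [] // : located (@vcells D 0) x v 0.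
  apply/(located_vcells wD); split; first exact: vtx0_eq wD _ _.
  by rewrite /pos big_ord0.
- move=> n; have [] // := iffRL (finerP (tp n) (tp n.+1) (@vpart_names n)
    (@vpart_names n.+1)) (vcells_finer n).
- move=> n _ x /topsE xt; apply/topsE; exact: (proj2 (vcells_finer n)).
- apply/seteqP; split=> [x H|_ -> n _]; last exact/topsE/vcells_x0.
  apply: vcells_x0U => n; apply: (proj2 (vcells_finer n)).
  by apply/topsE; exact: H.
split.
  move=> Z [n _ /(names_cells _ (@vpart_names n))[v [i [iv <-]]]].
  by have [] := vcells_clopen wD iv.
move=> x U /bX[n [v [i [xv sub]]]].
exists (nth set0 (vcells v) i) => //; split; last by case: xv.
exists n => //; apply/(names_cells _ (@vpart_names n)); exists v, i.
by split=> //; exact: located_size xv.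
Qed.
End VershikSystem.

(** The towers of cylinders over the vertices of [B], in the system of [B]. *)
Definition can (R : realType) (B : OBDpo) n (v : vtx (bdiag (sval B)) n) :
  seq (set (space (Sds (Vsys_sds B R)))) := vtower v.
Arguments can R B n v : clear implicits.

Lemma can_model (R : realType) (B : OBDpo) : model (can R B).
Proof.
have wD := bratteliP (sval B).
split; last exact: vcells_stacks wD.
by split=> n; [exact: vcells_inj wD n|exact: vpart_names].
Qed.

(** * Correspondence between factor maps and morphisms of diagrams *)

Section BijectionEdges.
Variables (A B : finType) (g : A -> B).
Hypothesis gI : injective g.

Lemma bij_edges_anti : antisymmetric (@eq_op A).
Proof. by move=> e e' /andP[/eqP]. Qed.

Lemma bij_edges_trans : transitive (@eq_op A).
Proof. by move=> e e' e'' /eqP ->. Qed.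

Lemma bij_edges_cmp e e' : (e == e') || (e' == e) = (g e == g e').
Proof. by rewrite (inj_eq gI) [e' == e]eq_sym orbb. Qed.

(** The edge set with one edge from [v] to [g v] for each [v]; it is an ordered
    edge set because [g] is injective. *)
Definition bij_edges : edgeset A B :=
  @EdgeSet A B A id g eq_op (@eqxx A) bij_edges_anti bij_edges_trans bij_edges_cmp.
End BijectionEdges.

Lemma inj_surj_bij (S T : Type) (f : S -> T) :
  injective f -> (forall y, exists x, f x = y) -> bijective f.
Proof.
move=> fI /choice[g gP]; exists g => [x|//].
by apply: fI; rewrite gP.
Qed.

Section Correspondence.
Variable R : realType.

(** With respect to given models, the factor map [alpha] and the morphism [h]
    correspond to each other: [alpha] induces a premorphism of class [h]. *)
Definition corr (X Y : sds R) (B C : diagram)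
    (t : forall n, vtx B n -> seq (set (space X)))
    (u : forall n, vtx C n -> seq (set (space Y)))
    (alpha : sds_hom X Y) (h : obd_hom C B) :=
  exists f, induces t u alpha f /\ h = class_of f.

Section Bijective.
Variables (X Y : sds R) (B C : diagram).
Variable t : forall n, vtx B n -> seq (set (space X)).
Variable u : forall n, vtx C n -> seq (set (space Y)).
Arguments t : clear implicits.
Arguments u : clear implicits.
Hypotheses (Xt : model t) (Yu : model u).

Lemma corr_fun alpha h k : corr t u alpha h -> corr t u alpha k -> h = k.
Proof.
move=> [f [fa ->]] [g [ga ->]]; apply: class_of_eq.
exact: induces_equiv Xt Yu alpha f g fa ga.
Qed.

Lemma corr_inj alpha beta h : corr t u alpha h -> corr t u beta h -> alpha = beta.
Proof.
move=> [f [fa ->]] [g [gb /class_of_inj fg]].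
exact (induces_inj Xt Yu fa gb fg).
Qed.

Lemma corr_surj h : exists alpha, corr t u alpha h.
Proof.
have [f ->] := obd_homE h; have [alpha fa] := induces_surj Xt Yu f.
by exists alpha, f.
Qed.
End Bijective.

Lemma corr_id (X : sds R) (B : bratteli)
    (t : forall n, vtx B n -> seq (set (space X))) :
  corr t t (sds_id X) (class_of (pid (bratteliP B))).
Proof. by exists (pid (bratteliP B)); split=> //; exact: induces_id. Qed.

Lemma corr_comp (X Y Z : sds R) (B C D : diagram)
    (t : forall n, vtx B n -> seq (set (space X)))
    (u : forall n, vtx C n -> seq (set (space Y)))
    (w : forall n, vtx D n -> seq (set (space Z))) alpha beta h k :
  corr t u alpha h -> corr u w beta k ->
  corr t w (sds_comp beta alpha) (obd_hom_comp h k).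
Proof.
move=> [f [fa ->]] [g [gb ->]]; exists (pcomp f g).
by rewrite obd_hom_compE; split=> //; exact: induces_comp.
Qed.

(** Two models on the same system differ by a renaming of towers, which is a
    premorphism induced by the identity. *)
Lemma relabel_ex (X : sds R) (B C : diagram)
    (t : forall n, vtx B n -> seq (set (space X)))
    (u : forall n, vtx C n -> seq (set (space X))) : model t -> model u ->
  exists f : premorphism C B, induces t u (sds_id X) f /\
    forall n, [/\ plev f n = n, bijective (src (pedge f n)) &
      forall e : pedge f n, t _ (rng _ e) = u _ (src _ e)].
Proof.
move=> Xt Xu.
have H n (v : vtx C n) : exists w : vtx B n, t n w = u n v.
  by apply/(naming_names Xt)/(naming_names Xu); exists v.
pose g n v := sval (cid (H n v)).
have gP n v : t n (g n v) = u n v := svalP (cid (H n v)).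
have gI n : injective (g n).
  by move=> v w E; apply: (naming_inj Xu); rewrite -!gP E.
have gS n (w : vtx B n) : exists v, g n v = w.
  have [v uv] : exists v, u n v = t n w.
    by apply/(naming_names Xu)/(naming_names Xt); exists w.
  by exists v; apply: (naming_inj Xt); rewrite gP.
have idS : (fun n v => preim_tower (sds_id X) (u n v)) = u.
  by apply: functional_extensionality_dep => n; apply/funext => v; rewrite /preim_tower map_id.
have Fs n : stacks (fun v => preim_tower (sds_id X) (u n v)) (bij_edges (@gI n)) (t n).
  rewrite -[fun v => _]/((fun n v => preim_tower (sds_id X) (u n v)) n) idS.
  apply: stacks_bij; first by exists id.
    exact: inj_surj_bij (@gI n) (@gS n).
  exact: gP.
exists (induced Xt Xu (alpha := sds_id X) (l := id) erefl leqnSn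
  (fun N => ex_intro _ N (leqnn N)) Fs).
split; first by move=> n; exact: Fs.
by move=> n; split; [by []|by exists id|exact: gP].
Qed.

(** The system of [B], as an object. *)
Definition VS (B : OBDpo) : sds R := Sds (Vsys_sds B R).

Lemma tau_induces (B : OBDpo) f : is_tau (wB := Vsys_sds B R) f ->
  induces (taut (VS B)) (can R B) (sds_id (VS B)) f.
Proof.
move=> fP n; have [nE sb rE] := fP n.
have -> : (fun v => preim_tower (sds_id (VS B)) (can R B n v)) = can R B n.
  by apply/funext => v; rewrite /preim_tower map_id.
have can_inj : injective (can R B n) := @naming_inj _ _ _ (can_model R B) n.
apply: stacks_bij => //; apply: inj_surj_bij.
  move=> e e' E; apply: (bij_inj sb); apply: can_inj.
  by rewrite /can -!rE E.
move=> w; have [v vw] : exists v, can R B n v = taut (VS B) _ w.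
  have aux m (S : seq (set (space (VS B)))) : m = n -> S \in spart (VS B) m ->
      exists v, can R B n v = S.
    by move=> ->; move/(naming_names (can_model R B)).
  by apply: (aux _ _ nE); apply/(naming_names (taut_naming (VS B))); exists w.
have [s' sK s'K] := sb; exists (s' v); apply: val_inj.
by rewrite rE s'K; exact: vw.
Qed.

Lemma tau_ex (B : OBDpo) : exists f, is_tau (wB := Vsys_sds B R) f.
Proof.
have [f [_ fP]] := relabel_ex (taut_model (VS B)) (can_model R B).
by exists f.
Qed.
End Correspondence.

(** * The equivalence of categories *)

Section Functors.
Variable R : realType.

Let P0 : SDS R -> OBDpo := Pobj (@Pdiag_obdpo R).
Let V0 : OBDpo -> SDS R := Vobj (fun B => Vsys_sds B R).
Let tm (X : SDS R) := taut_model X.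
Let cm (B : OBDpo) := can_model R B.

Lemma Pmap_ex (X Y : SDS R) (a : hom X Y) : exists h : hom (P0 Y) (P0 X),
  corr (taut X) (taut Y) a h.
Proof.
have [f fa] := represents_ex a; exists (class_of f), f; split=> //.
exact: represents_induces.
Qed.

(** The morphism that corresponds to [a] in the models of systems on their own
    diagrams. *)
Definition Pmap (X Y : SDS R) (a : hom X Y) : hom (P0 Y) (P0 X) :=
  sval (cid (Pmap_ex a)).

Lemma PmapP (X Y : SDS R) (a : hom X Y) : corr (taut X) (taut Y) a (Pmap a).
Proof. exact: (svalP (cid (Pmap_ex a))). Qed.

Lemma Pmap1 (X : SDS R) : Pmap (idm X) = idm (P0 X).
Proof.
apply: (corr_fun (tm X) (tm X) (PmapP _)).
exact (corr_id (B := sval (P0 X)) (taut X)).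
Qed.

Lemma PmapM (X Y Z : SDS R) (b : hom Y Z) (a : hom X Y) :
  Pmap (b \c a) = Pmap a \c Pmap b.
Proof.
apply: (corr_fun (tm X) (tm Z) (PmapP _)); exact: corr_comp (PmapP a) (PmapP b).
Qed.

Definition Pfun : contrafunctor P0 := Contrafunctor Pmap1 PmapM.

(** The factor map that corresponds to [h] in the models on path spaces. *)
Definition Vmap (B C : OBDpo) (h : hom B C) : hom (V0 C) (V0 B) :=
  sval (cid (corr_surj (cm C) (cm B) h)).

Lemma VmapP (B C : OBDpo) (h : hom B C) : corr (can R C) (can R B) (Vmap h) h.
Proof. exact: (svalP (cid (corr_surj (cm C) (cm B) h))). Qed.

Lemma Vmap1 (B : OBDpo) : Vmap (idm B) = idm (V0 B).
Proof. apply: (corr_inj (cm B) (cm B) (VmapP _)). exact (corr_id (B := sval B) (can R B)). Qed.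

Lemma VmapM (B C D : OBDpo) (k : hom C D) (h : hom B C) :
  Vmap (k \c h) = Vmap h \c Vmap k.
Proof.
apply: (corr_inj (cm D) (cm B) (VmapP _)); exact: corr_comp (VmapP k) (VmapP h).
Qed.

Definition Vfun : contrafunctor V0 := Contrafunctor Vmap1 VmapM.

Lemma tau_fwd_ex (B : OBDpo) : exists h : hom B (P0 (V0 B)),
  corr (taut (V0 B)) (can R B) (idm (V0 B)) h.
Proof.
have [f [fi _]] := relabel_ex (tm (V0 B)) (cm B).
by exists (class_of f), f.
Qed.

Lemma tau_bwd_ex (B : OBDpo) : exists h : hom (P0 (V0 B)) B,
  corr (can R B) (taut (V0 B)) (idm (V0 B)) h.
Proof.
have [f [fi _]] := relabel_ex (cm B) (tm (V0 B)).
by exists (class_of f), f.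
Qed.

(** The morphisms that correspond to the identity of the system of [B], between
    its two models: one of [B] itself, the other of its own diagram. *)
Definition tau_fwd B := sval (cid (tau_fwd_ex B)).
Definition tau_bwd B := sval (cid (tau_bwd_ex B)).

Lemma tau_fwdP B : corr (taut (V0 B)) (can R B) (idm (V0 B)) (tau_fwd B).
Proof. exact: (svalP (cid (tau_fwd_ex B))). Qed.

Lemma tau_bwdP B : corr (can R B) (taut (V0 B)) (idm (V0 B)) (tau_bwd B).
Proof. exact: (svalP (cid (tau_bwd_ex B))). Qed.

Lemma tau_bwdK B : tau_bwd B \c tau_fwd B = idm B.
Proof.
apply: (corr_fun (cm B) (cm B) (alpha := idm (V0 B) \c idm (V0 B))).
  exact: corr_comp (tau_bwdP B) (tau_fwdP B).
rewrite cmp1m; exact (corr_id (B := sval B) (can R B)).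
Qed.

Lemma tau_fwdK B : tau_fwd B \c tau_bwd B = idm (P0 (V0 B)).
Proof.
apply: (corr_fun (tm (V0 B)) (tm (V0 B)) (alpha := idm (V0 B) \c idm (V0 B))).
  exact: corr_comp (tau_fwdP B) (tau_bwdP B).
rewrite cmp1m; exact (corr_id (B := sval (P0 (V0 B))) (taut (V0 B))).
Qed.

Definition tau B : isom B (P0 (V0 B)) := Isom (tau_bwdK B) (tau_fwdK B).

(** The factor maps that correspond to the identity of the diagram of [X],
    between its models on [X] and on its path space. *)
Definition sigma_fwd (X : SDS R) : hom X (V0 (P0 X)) :=
  sval (cid (corr_surj (tm X) (cm (P0 X)) (idm (P0 X)))).
Definition sigma_bwd (X : SDS R) : hom (V0 (P0 X)) X :=
  sval (cid (corr_surj (cm (P0 X)) (tm X) (idm (P0 X)))).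

Lemma sigma_fwdP X : corr (taut X) (can R (P0 X)) (sigma_fwd X) (idm (P0 X)).
Proof. exact: (svalP (cid (corr_surj (tm X) (cm (P0 X)) (idm (P0 X))))). Qed.

Lemma sigma_bwdP X : corr (can R (P0 X)) (taut X) (sigma_bwd X) (idm (P0 X)).
Proof. exact: (svalP (cid (corr_surj (cm (P0 X)) (tm X) (idm (P0 X))))). Qed.

Lemma sigma_bwdK X : sigma_bwd X \c sigma_fwd X = idm X.
Proof.
apply: (corr_inj (tm X) (tm X) (h := idm (P0 X) \c idm (P0 X))).
  exact: corr_comp (sigma_fwdP X) (sigma_bwdP X).
rewrite cmp1m; exact (corr_id (B := sval (P0 X)) (taut X)).
Qed.

Lemma sigma_fwdK X : sigma_fwd X \c sigma_bwd X = idm (V0 (P0 X)).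
Proof.
apply: (corr_inj (cm (P0 X)) (cm (P0 X)) (h := idm (P0 X) \c idm (P0 X))).
  exact: corr_comp (sigma_bwdP X) (sigma_fwdP X).
rewrite cmp1m; exact (corr_id (B := sval (P0 X)) (can R (P0 X))).
Qed.

Definition sigma X : isom X (V0 (P0 X)) := Isom (sigma_bwdK X) (sigma_fwdK X).

Lemma Pmap_can (B C : OBDpo) (a : hom (V0 C) (V0 B)) (h : hom B C) :
  corr (can R C) (can R B) a h <->
  Pmap a = (tau_fwd C \c h) \c tau_bwd B.
Proof.
have idE : idm (V0 B) \c (a \c idm (V0 C)) = a by rewrite cmp1m cmpm1.
split=> [ah|E].
  apply: (corr_fun (tm (V0 C)) (tm (V0 B)) (PmapP a)); rewrite -{1}idE.
  exact: corr_comp (corr_comp (tau_fwdP C) ah) (tau_bwdP B).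
have -> : h = tau_bwd C \c Pmap a \c tau_fwd B.
  by rewrite E !cmpA tau_bwdK cmp1m -cmpA tau_bwdK cmpm1.
rewrite -{1}idE.
exact: corr_comp (corr_comp (tau_bwdP C) (PmapP a)) (tau_fwdP B).
Qed.

Lemma Pmap_sigma (X : SDS R) (s : hom X (V0 (P0 X))) :
  corr (taut X) (can R (P0 X)) s (idm (P0 X)) <-> Pmap s = tau_bwd (P0 X).
Proof.
have idE : idm (V0 (P0 X)) \c s = s by rewrite cmp1m.
split=> [sP|E].
  apply: (corr_fun (tm X) (tm (V0 (P0 X))) (PmapP s)); rewrite -{1}idE.
  by rewrite -[tau_bwd _]cmp1m; exact: corr_comp sP (tau_bwdP (P0 X)).
rewrite -(tau_bwdK (P0 X)) -E -{1}idE.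
exact: corr_comp (PmapP s) (tau_fwdP (P0 X)).
Qed.

Lemma isom_eq (C : category) (A B : C) (s t : isom A B) : fwd s = fwd t -> s = t.
Proof.
case: s t => f g gf fg [f' g' gf' fg'] /= E; subst f'.
have E : g = g' by rewrite -[g]cmp1m -gf' -cmpA fg cmpm1.
by subst g'; rewrite (Prop_irrelevance gf gf') (Prop_irrelevance fg fg').
Qed.

End Functors.

Theorem theorem3p15 (R : realType) :
  exists (wP : forall X : SDS R, is_obdpo (Pdiag X))
         (wV : forall B : OBDpo, is_sds R (Vsys B)),
  let P0 : SDS R -> OBDpo := Pobj wP in
  let V0 : OBDpo -> SDS R := Vobj wV in
  exists (P : contrafunctor P0) (V : contrafunctor V0)
         (tau : forall B : OBDpo, isom B (P0 (V0 B)))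
         (sigma : forall X : SDS R, isom X (V0 (P0 X))),
  [/\ (* P(alpha) = [f], for every admissible choice of the levels f_n *)
      forall (X Y : SDS R) (alpha : hom X Y),
        (exists f, represents alpha f) /\
        (forall f, represents alpha f -> cfmap P alpha = class_of f),
      (* tau_B = [f_B] *)
      forall B : OBDpo,
        (exists f, is_tau (wB := wV B) f) /\
        (forall f, is_tau (wB := wV B) f -> fwd (tau B) = class_of f),
      (* V(h) is the unique alpha with P(alpha) = tau_C h tau_B^-1 *)
      forall (B C : OBDpo) (h : hom B C),
        unique (fun alpha : hom (V0 C) (V0 B) =>
                  cfmap P alpha = (fwd (tau C) \c h) \c bwd (tau B))
               (cfmap V h),
      (* sigma_X is the unique isomorphism with P(sigma_X) = tau_P(X)^-1 *)
      forall X : SDS R,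
        unique (fun s : isom X (V0 (P0 X)) =>
                  cfmap P (fwd s) = bwd (tau (P0 X)))
               (sigma X) &
      inverse_equivalences P V tau sigma].
Proof.
exists (@Pdiag_obdpo R), (fun B => Vsys_sds B R) => P0 V0.
exists (Pfun R), (Vfun R), (@tau R), (@sigma R).
have tm (X : SDS R) : model (taut X) := taut_model X.
have cm (B : OBDpo) : model (can R B) := can_model R B.
split.
- move=> X Y alpha; split; first exact: represents_ex.
  move=> f /represents_induces fa; apply: (corr_fun (tm X) (tm Y) (PmapP alpha)).
  by exists f.
- move=> B; split; first exact: tau_ex.
  move=> f /tau_induces fi.
  by apply: (corr_fun (tm (V0 B)) (cm B) (tau_fwdP R B)); exists f.
- move=> B C h; split=> [|alpha /Pmap_can ah]; first exact/Pmap_can/VmapP.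
  exact (corr_inj (cm C) (cm B) (VmapP R h) ah).
- move=> X; split=> [|s /Pmap_sigma sP]; first exact/Pmap_sigma/sigma_fwdP.
  apply: isom_eq; exact (corr_inj (tm X) (cm (P0 X)) (sigma_fwdP X) sP).
split=> [B C h|X Y alpha].
- change (tau_fwd R C \c h = Pmap (Vmap R h) \c tau_fwd R B).
  rewrite (iffLR (Pmap_can _ _) (VmapP R h)).
  by rewrite -cmpA tau_bwdK cmpm1.
change (sigma_fwd Y \c alpha = Vmap R (Pmap alpha) \c sigma_fwd X).
apply: (corr_inj (tm X) (cm (P0 Y)) (h := Pmap alpha)).
  rewrite -[Pmap alpha]cmpm1.
  exact: corr_comp (PmapP alpha) (sigma_fwdP Y).
have := corr_comp (sigma_fwdP X) (VmapP R (Pmap alpha)).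
by rewrite -[obd_hom_comp _ _]/(idm (P0 X) \c Pmap alpha) cmp1m.
Qed.
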